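(* Let $k\ge 0$. (i) Let $\mathcal{T}_h$ be a conforming shape-regular simplicial triangulation of $\Omega$. If the stabilization parameter $\tau_t$ is positive everywhere, then the $\mathrm{HDG}_s$ system is well-posed (for all data $\boldsymbol f,\boldsymbol g$ it has exactly one solution $(\boldsymbol w_h,\boldsymbol u_h,p_h,\widehat{\boldsymbol u}^t_h,\widehat p_h)\in \boldsymbol W_h\times\boldsymbol V_h\times Q_h\times \boldsymbol M_h^{t,\boldsymbol g}\times M_h^0$), and the approximation $\boldsymbol u_h$ is globally divergence free, i.e. $\boldsymbol u_h\in \boldsymbol H(\mathrm{div},\Omega)$ and $\nabla\cdot\boldsymbol u_h=0$ in $\Omega$. (ii) If $\mathcal{T}_h$ is any conforming polyhedral triangulation of $\Omega$ and $\tau_t>0$, $\tau_n>0$, then the $\mathrm{HDG}_g$ system is also well-posed (for all data $\boldsymbol f,\boldsymbol g$ it has exactly one solution in $\boldsymbol W_h\times\boldsymbol V_h\times Q_h\times \boldsymbol M_h^{t,\boldsymbol g}\times M_h^0$).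
   Context: $\Omega\subset\mathbb{R}^3$ is a simply connected polyhedral domain, $\boldsymbol f\in L^2(\Omega)^3$, and $\boldsymbol g\in L^2(\partial\Omega)^3$ is tangential. The problem being discretized is: $\nabla\times\boldsymbol u=\boldsymbol w$, $\nabla\times\boldsymbol w+\nabla p=\boldsymbol f$, $\nabla\cdot\boldsymbol u=0$ in $\Omega$; $\boldsymbol u\times\boldsymbol n=\boldsymbol g$, $p=0$ on $\partial\Omega$. $\mathcal{T}_h$ is a conforming partition of $\Omega$, $\mathcal{E}_h$ is the set of all faces, $\partial\mathcal{T}_h=\{\partial K:K\in\mathcal{T}_h\}$, $\boldsymbol n$ is the outward unit normal on $\partial K$, $(\cdot,\cdot)_{\mathcal{T}_h}=\sum_K(\cdot,\cdot)_K$, $\langle\cdot,\cdot\rangle_{\partial\mathcal{T}_h}=\sum_K\langle\cdot,\cdot\rangle_{\partial K}$ ($L^2$ inner products). Differential operators on discrete functions act elementwise. On a face, $\boldsymbol v^t=\boldsymbol n\times(\boldsymbol v\times\boldsymbol n)$ and $\boldsymbol v^n=(\boldsymbol v\cdot\boldsymbol n)\boldsymbol n$. For $k\ge0$, $P_k(D)$ denotes polynomials of total degree at most $k$ on $D$, $\boldsymbol P_k(D)=[P_k(D)]^3$, $\widetilde P_{k+2}(F)$ the homogeneous polynomials of degree $k+2$ on $F$ (in planar coordinates on $F$), and $\boldsymbol M^t(F)=[\boldsymbol P_k(F)+\nabla\widetilde P_{k+2}(F)]^t$ (tangential fields on $F$). Set - $\boldsymbol W_h=\{\boldsymbol r\in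 L^2(\Omega)^3:\boldsymbol r|_K\in\boldsymbol P_k(K)\ \forall K\}$, - $\boldsymbol V_h=\{\boldsymbol v\in L^2(\Omega)^3:\boldsymbol v|_K\in\boldsymbol P_{k+1}(K)\ \forall K\}$, - $Q_h=\{q\in L^2(\Omega):q|_K\in P_k(K)\ \forall K\}$, - $\boldsymbol M^t_h=\{\boldsymbol\mu\in L^2(\mathcal{E}_h)^3:\boldsymbol\mu|_F\in\boldsymbol M^t(F)\ \forall F\in\mathcal{E}_h\}$, with $L^2$-orthogonal projection $\boldsymbol P_{\boldsymbol M}:L^2(\mathcal{E}_h)^3\to\boldsymbol M^t_h$ (applied facewise), - $\boldsymbol M^{t,\boldsymbol g}_h=\{\boldsymbol\mu\in\boldsymbol M^t_h:\boldsymbol\mu|_{\partial\Omega}=\boldsymbol P_{\boldsymbol M}(\boldsymbol n\times\boldsymbol g)\}$, and $\boldsymbol M_h^{t,0}$ is this space with $\boldsymbol g=0$, - $M_h^0=\{\zeta\in L^2(\mathcal{E}_h):\zeta|_F\in P_{k+1}(F)\ \forall F\in\mathcal{E}_h,\ \zeta|_{\partial\Omega}=0\}$. The $\mathrm{HDG}_s$ system ($\mathcal T_h$ simplicial): find $(\boldsymbol w_h,\boldsymbol u_h,p_h,\widehat{\boldsymbol u}^t_h,\widehat p_h)\in\boldsymbol W_h\times\boldsymbol V_h\times Q_h\times\boldsymbol M_h^{t,\boldsymbol g}\times M_h^0$ such that for all $(\boldsymbol r,\boldsymbol v,q,\boldsymbol\eta,\zeta)\in\boldsymbol W_h\times\boldsymbol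 V_h\times Q_h\times\boldsymbol M_h^{t,0}\times M_h^0$: $(\boldsymbol w_h,\boldsymbol r)_{\mathcal T_h}-(\boldsymbol u_h,\nabla\times\boldsymbol r)_{\mathcal T_h}+\langle\widehat{\boldsymbol u}^t_h\times\boldsymbol n,\boldsymbol r\rangle_{\partial\mathcal T_h}=0$, $(\boldsymbol w_h,\nabla\times\boldsymbol v)_{\mathcal T_h}-(p_h,\nabla\cdot\boldsymbol v)_{\mathcal T_h}+\langle\widehat{\boldsymbol w}_h,\boldsymbol v\times\boldsymbol n\rangle_{\partial\mathcal T_h}+\langle\widehat p_h,\boldsymbol v\cdot\boldsymbol n\rangle_{\partial\mathcal T_h}=(\boldsymbol f,\boldsymbol v)_{\mathcal T_h}$, $-(\boldsymbol u_h,\nabla q)_{\mathcal T_h}+\langle\widehat{\boldsymbol u}^n_h\cdot\boldsymbol n,q\rangle_{\partial\mathcal T_h}=0$, $\langle\widehat{\boldsymbol w}_h\times\boldsymbol n,\boldsymbol\eta\rangle_{\partial\mathcal T_h}=0$, $\langle\widehat{\boldsymbol u}^n_h\cdot\boldsymbol n,\zeta\rangle_{\partial\mathcal T_h}=0$, where $\widehat{\boldsymbol w}_h=\boldsymbol w_h+\tau_t(\boldsymbol P_{\boldsymbol M}\boldsymbol u^t_h-\widehat{\boldsymbol u}^t_h)\times\boldsymbol n$ and $\widehat{\boldsymbol u}^n_h\cdot\boldsymbol n=\boldsymbol u_h\cdot\boldsymbol n$. The stabilization parameter $\tau_t$ is a non-negative constant. The $\mathrm{HDG}_g$ system is the same system,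 on a conforming polyhedral triangulation, except that $\widehat{\boldsymbol u}^n_h\cdot\boldsymbol n=\boldsymbol u_h\cdot\boldsymbol n+\tau_n(p_h-\widehat p_h)$, with $\tau_n\ge 0$ a second stabilization parameter on the faces. *)

(* Defs.v *)
From HB Require Import structures.
From mathcomp Require Import all_boot all_order all_algebra.
From mathcomp Require Import all_classical all_reals all_analysis.
(* The notations of mpoly clash with those of MathComp-Analysis. *)
From mathcomp Require Import -(notations) mpoly.

Set Implicit Arguments.
Unset Strict Implicit.
Unset Printing Implicit Defensive.

Import Order.TTheory GRing.Theory Num.Theory.
Import numFieldNormedType.Exports.

Local Open Scope classical_set_scope.
Local Open Scope ring_scope.

Definition dot {R : realType} {d : nat} (u v : 'rV[R]_d) : R :=
  \sum_i u 0 i * v 0 i.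

(* Indices are taken in Z/3. *)
Definition cross {R : realType} (u v : 'rV[R]_3) : 'rV[R]_3 :=
  \row_i (u 0 (i + 1) * v 0 (i + 2) - u 0 (i + 2) * v 0 (i + 1)).

(* The norm that 'rV[R]_d carries in the library is the max norm. *)
Definition enorm {R : realType} {d : nat} (u : 'rV[R]_d) : R :=
  Num.sqrt (dot u u).

Definition tang {R : realType} (n v : 'rV[R]_3) : 'rV[R]_3 :=
  cross n (cross v n).

Definition partial {R : realType} {d : nat} (i : 'I_d.+1)
  (f : 'rV[R]_d.+1 -> R) (x : 'rV[R]_d.+1) : R := 'D_(delta_mx 0 i) f x.

Definition grad {R : realType} {d : nat}
  (f : 'rV[R]_d.+1 -> R) (x : 'rV[R]_d.+1) : 'rV[R]_d.+1 :=
  \row_i partial i f x.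

Definition divg {R : realType} {d : nat}
  (v : 'rV[R]_d.+1 -> 'rV[R]_d.+1) (x : 'rV[R]_d.+1) : R :=
  \sum_i partial i (fun z => v z 0 i) x.

Definition curl {R : realType} (v : 'rV[R]_3 -> 'rV[R]_3) (x : 'rV[R]_3) :
    'rV[R]_3 :=
  \row_i (partial (i + 1) (fun z => v z 0 (i + 2)) x
          - partial (i + 2) (fun z => v z 0 (i + 1)) x).

Definition boundary {T : topologicalType} (A : set T) : set T :=
  closure A `\` interior A.

(* Row vectors carry no measure in the library: integrals over subsets of
   'rV_2 and 'rV_3 are taken with respect to the product Lebesgue measures,
   through the coordinate maps. *)
Definition leb2 (R : realType) : {measure set _ -> \bar R} :=
  (@lebesgue_measure R \x @lebesgue_measure R)%E.
Arguments leb2 R : clear implicits.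
Definition leb3 (R : realType) : {measure set _ -> \bar R} :=
  (leb2 R \x @lebesgue_measure R)%E.
Arguments leb3 R : clear implicits.

Definition pt2 {R : realType} (t : R * R) : 'rV[R]_2 :=
  \row_(i < 2) [:: t.1; t.2]`_i.
Definition pt3 {R : realType} (t : R * R * R) : 'rV[R]_3 :=
  \row_(i < 3) [:: t.1.1; t.1.2; t.2]`_i.

Definition int2 {R : realType} (A : set 'rV[R]_2) (f : 'rV[R]_2 -> R) : R :=
  \int[leb2 R]_(t in pt2 @^-1` A) f (pt2 t).
Definition int3 {R : realType} (A : set 'rV[R]_3) (f : 'rV[R]_3 -> R) : R :=
  \int[leb3 R]_(t in pt3 @^-1` A) f (pt3 t).

Definition sq_integrable {R : realType} {dp : measure_display}
    {X : measurableType dp} (mu : {measure set X -> \bar R})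
    (D : set X) (f : X -> R) : Prop :=
  measurable_fun D f /\ mu.-integrable D (fun x => (f x ^+ 2)%:E).

Definition L2 {R : realType} (D : set 'rV[R]_3) (f : 'rV[R]_3 -> R) : Prop :=
  sq_integrable (leb3 R) (pt3 @^-1` D) (f \o pt3).
Definition L2vec {R : realType} (D : set 'rV[R]_3) (f : 'rV[R]_3 -> 'rV[R]_3) :
    Prop :=
  forall i, L2 D (fun x => f x 0 i).

Definition smooth {R : realType} (phi : 'rV[R]_3 -> R) : Prop :=
  forall (s : seq 'rV[R]_3) (x : 'rV[R]_3),
    differentiable (foldr (fun v (h : 'rV[R]_3 -> R) y => 'D_v h y) phi s) x.

Definition test_function {R : realType} (D : set 'rV[R]_3)
    (phi : 'rV[R]_3 -> R) : Prop :=
  smooth phi /\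
  exists2 C, compact C & C `<=` D /\ forall x, ~ C x -> phi x = 0.

Definition weak_div {R : realType} (D : set 'rV[R]_3)
    (u : 'rV[R]_3 -> 'rV[R]_3) (d : 'rV[R]_3 -> R) : Prop :=
  forall phi, test_function D phi ->
    int3 D (fun x => dot (u x) (grad phi x)) = - int3 D (fun x => d x * phi x).

Definition Hdiv {R : realType} (D : set 'rV[R]_3)
    (u : 'rV[R]_3 -> 'rV[R]_3) : Prop :=
  L2vec D u /\ exists2 d, L2 D d & weak_div D u d.

(* Polynomials on a set with nonempty interior are identified with polynomial
   functions on the whole space. *)
Definition Ppoly {R : realType} {d : nat} (k : nat) (f : 'rV[R]_d -> R) : Prop :=
  exists q : mpoly d R,
    (msize q <= k.+1)%N /\ forall x, f x = meval (x 0) q.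

Definition Phomog {R : realType} {d : nat} (k : nat) (f : 'rV[R]_d -> R) : Prop :=
  exists q : mpoly d R,
    q \is ishomog1 k (@mdeg d) /\ forall x, f x = meval (x 0) q.

Definition Pvec {R : realType} {d : nat} (k : nat)
    (f : 'rV[R]_d -> 'rV[R]_3) : Prop :=
  forall i, Ppoly k (fun x => f x 0 i).

Definition convex_polyhedron {R : realType} {d : nat} (P : set 'rV[R]_d) : Prop :=
  exists (m : nat) (a : 'I_m -> 'rV[R]_d) (b : 'I_m -> R),
    P = [set x | forall i, dot (a i) x <= b i].

(* Not necessarily convex. The equation interior (closure D) = D rules out
   slits. *)
Definition polyhedral_domain {R : realType} {d : nat} (D : set 'rV[R]_d.+1) :
    Prop :=
  [/\ open D, connected D, D !=set0, bounded_set D & interior (closure D) = D] /\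
  exists (m : nat) (P : 'I_m -> set 'rV[R]_d.+1),
    (forall i, convex_polyhedron (P i)) /\ closure D = \bigcup_i P i.

Definition polyhedron {R : realType} {d : nat} (K : set 'rV[R]_d.+1) : Prop :=
  exists2 D, polyhedral_domain D & K = closure D.

Definition hull {R : realType} {d : nat} (A : set 'rV[R]_d) : set 'rV[R]_d :=
  [set x | exists (m : nat) (p : 'I_m -> 'rV[R]_d) (a : 'I_m -> R),
    [/\ forall i, A (p i), forall i, 0 <= a i, \sum_i a i = 1
      & x = \sum_i a i *: p i]].

Definition simply_connected {R : realType} (D : set 'rV[R]_3) : Prop :=
  (forall x y, D x -> D y -> exists c : R -> 'rV[R]_3,
     [/\ {within `[0, 1], continuous c}, c 0 = x, c 1 = y
       & forall t : R, t \in `[0, 1] -> D (c t)]) /\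
  (forall c : R -> 'rV[R]_3,
     {within `[0, 1], continuous c} -> c 0 = c 1 ->
     (forall t : R, t \in `[0, 1] -> D (c t)) ->
     exists H : R * R -> 'rV[R]_3,
       [/\ {within `[0, 1] `*` `[0, 1], continuous H},
           forall s t : R, s \in `[0, 1] -> t \in `[0, 1] -> D (H (s, t)),
           forall t : R, t \in `[0, 1] -> H (0, t) = c t,
           forall t : R, t \in `[0, 1] -> H (1, t) = c 0
         & forall s : R, s \in `[0, 1] -> H (s, 0) = c 0 /\ H (s, 1) = c 0]).

(* [fdom F] is the face F read in the planar coordinates
   y |-> forig F + y *m frame F, where the rows of [frame F] form an
   orthonormal basis of the direction of the plane of F; these coordinates
   also turn the surface measure on F into [leb2]. *)
Record mesh (R : realType) := Mesh {
  ncell : nat;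
  nface : nat;
  cell : 'I_ncell -> set 'rV[R]_3;
  forig : 'I_nface -> 'rV[R]_3;
  frame : 'I_nface -> 'M[R]_(2, 3);
  fdom : 'I_nface -> set 'rV[R]_2
}.

Section Mesh.
Context {R : realType} (Th : mesh R).
Local Notation cells := 'I_(ncell Th).
Local Notation faces := 'I_(nface Th).

Definition chart (F : faces) (y : 'rV[R]_2) : 'rV[R]_3 :=
  forig F + y *m frame F.

Definition face (F : faces) : set 'rV[R]_3 := chart F @` fdom F.

Definition relint (F : faces) : set 'rV[R]_3 := chart F @` interior (fdom F).

Definition on_bd (D : set 'rV[R]_3) (F : faces) : bool :=
  `[< face F `<=` boundary D >].

(* Conformity is imposed on the faces: two different faces meet at most along
   their relative boundaries, so that a face belonging to the boundaries of two
   cells is a complete face of both. *)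
Definition conforming_polyhedral (Omega : set 'rV[R]_3) : Prop :=
  [/\ forall K : cells, polyhedron (cell K),
      closure Omega = \bigcup_(K : cells) cell K,
      forall K K' : cells, K != K' -> interior (cell K) `&` interior (cell K') = set0
    & forall F : faces, polyhedron (fdom F) /\ frame F *m (frame F)^T = 1%:M] /\
  [/\ forall K : cells, boundary (cell K) = \bigcup_(F in on_bd (cell K)) face F,
      forall F : faces, exists K : cells, on_bd (cell K) F
    & forall F F' : faces, F != F' -> relint F `&` face F' = set0].

Definition affinely_independent (v : 'I_4 -> 'rV[R]_3) : Prop :=
  row_free (\matrix_(i < 3) (v (lift ord0 i) - v ord0)).

Definition conforming_simplicial (Omega : set 'rV[R]_3) : Prop :=
  conforming_polyhedral Omega /\
  exists vtx : cells -> 'I_4 -> 'rV[R]_3,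
    [/\ forall K, affinely_independent (vtx K) /\ cell K = hull (range (vtx K)),
        forall K i, exists F : faces, face F = hull (vtx K @` [set j | j != i]),
        forall F : faces, exists K i, face F = hull (vtx K @` [set j | j != i])
      & forall K K', K != K' ->
          cell K `&` cell K' = hull (range (vtx K) `&` range (vtx K'))].

Definition diam (K : set 'rV[R]_3) : R :=
  sup [set r | exists x y, [/\ K x, K y & r = enorm (x - y)]].

Definition inradius (K : set 'rV[R]_3) : R :=
  sup [set r | exists c, [set x | enorm (x - c) <= r] `<=` K].

Definition shape_regular (sigma : R) : Prop :=
  forall K : cells, diam (cell K) <= sigma * inradius (cell K).

Definition face_normal (F : faces) : 'rV[R]_3 :=
  cross (row 0 (frame F)) (row 1 (frame F)).

Definition is_outward_normal (D : set 'rV[R]_3) (F : faces) (n : 'rV[R]_3) : Prop :=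
  (n = face_normal F \/ n = - face_normal F) /\
  forall x, relint F x -> \forall t \near 0^'+, ~ D (x + t *: n) /\ D (x - t *: n).

Definition outward_normal (D : set 'rV[R]_3) (F : faces) : 'rV[R]_3 :=
  xget 0 [set n | is_outward_normal D F n].

Definition nrm (K : cells) (F : faces) : 'rV[R]_3 := outward_normal (cell K) F.

(* An elementwise polynomial function on the mesh is given by the family of its
   polynomial pieces, and a facewise polynomial function by the family of its
   polynomial pieces in the planar coordinates of the faces. *)
Definition bvec := cells -> 'rV[R]_3 -> 'rV[R]_3.
Definition bscal := cells -> 'rV[R]_3 -> R.
Definition fvec := faces -> 'rV[R]_2 -> 'rV[R]_3.
Definition fscal := faces -> 'rV[R]_2 -> R.

(* The function on the domain with the pieces v, up to the null set formed by
   the boundaries of the cells. *)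
Definition assemble (v : bvec) (x : 'rV[R]_3) : 'rV[R]_3 :=
  \sum_(K : cells) if `[< interior (cell K) x >] then v K x else 0.

Definition Wh (k : nat) (r : bvec) : Prop := forall K, Pvec k (r K).
Definition Vh (k : nat) (v : bvec) : Prop := forall K, Pvec k.+1 (v K).
Definition Qh (k : nat) (q : bscal) : Prop := forall K, Ppoly k (q K).

Definition MtF (k : nat) (F : faces) (mu : 'rV[R]_2 -> 'rV[R]_3) : Prop :=
  exists p q, [/\ Pvec k p, Phomog k.+2 q
    & forall y, mu y = tang (face_normal F) (p y + grad q y *m frame F)].

Definition Mth (k : nat) (mu : fvec) : Prop := forall F, MtF k F (mu F).

Definition PM (k : nat) (F : faces) (v : 'rV[R]_2 -> 'rV[R]_3) :
    'rV[R]_2 -> 'rV[R]_3 :=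
  xget (fun=> 0) [set mu | MtF k F mu /\ forall eta, MtF k F eta ->
    int2 (fdom F) (fun y => dot (mu y - v y) (eta y)) = 0].

Definition Mthg (k : nat) (Omega : set 'rV[R]_3) (g : 'rV[R]_3 -> 'rV[R]_3)
    (mu : fvec) : Prop :=
  Mth k mu /\ forall F, on_bd Omega F ->
    mu F = PM k F (fun y => cross (outward_normal (closure Omega) F) (g (chart F y))).

Definition Mh0 (k : nat) (Omega : set 'rV[R]_3) (zeta : fscal) : Prop :=
  forall F, Ppoly k.+1 (zeta F) /\ (on_bd Omega F -> forall y, zeta F y = 0).

Definition L2bd (Omega : set 'rV[R]_3) (g : 'rV[R]_3 -> 'rV[R]_3) : Prop :=
  forall F, on_bd Omega F -> forall i,
    sq_integrable (leb2 R) (pt2 @^-1` fdom F) (fun t => g (chart F (pt2 t)) 0 i).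

Definition tangential_bd (Omega : set 'rV[R]_3) (g : 'rV[R]_3 -> 'rV[R]_3) : Prop :=
  forall F, on_bd Omega F ->
    {ae leb2 R, forall t, fdom F (pt2 t) ->
      dot (g (chart F (pt2 t))) (outward_normal (closure Omega) F) = 0}.

Definition ipT (phi : bscal) : R := \sum_(K : cells) int3 (cell K) (phi K).

Definition ipdT (phi : cells -> fscal) : R :=
  \sum_(K : cells) \sum_(F : faces | on_bd (cell K) F) int2 (fdom F) (phi K F).

Record hdg_unknowns := HDGUnknowns {
  w_h : bvec;
  u_h : bvec;
  p_h : bscal;
  uhat : fvec;
  phat : fscal
}.

Definition what (k : nat) (taut : R) (s : hdg_unknowns) (K : cells) : fvec :=
  fun F y => w_h s K (chart F y) +
    taut *: cross (PM k F (fun z => tang (nrm K F) (u_h s K (chart F z))) y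
                   - uhat s F y) (nrm K F).

(* [un] is the normal numerical flux (hat u_h^n . n). *)
Definition hdg_system (k : nat) (taut : R) (un : hdg_unknowns -> cells -> fscal)
    (Omega : set 'rV[R]_3) (f g : 'rV[R]_3 -> 'rV[R]_3) (s : hdg_unknowns) : Prop :=
  [/\ Wh k (w_h s), Vh k (u_h s), Qh k (p_h s), Mthg k Omega g (uhat s)
    & Mh0 k Omega (phat s)] /\
  [/\
    forall r, Wh k r ->
      ipT (fun K x => dot (w_h s K x) (r K x))
      - ipT (fun K x => dot (u_h s K x) (curl (r K) x))
      + ipdT (fun K F y => dot (cross (uhat s F y) (nrm K F)) (r K (chart F y))) = 0,
    forall v, Vh k v ->
      ipT (fun K x => dot (w_h s K x) (curl (v K) x))
      - ipT (fun K x => p_h s K x * divg (v K) x)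
      + ipdT (fun K F y => dot (what k taut s K F y) (cross (v K (chart F y)) (nrm K F)))
      + ipdT (fun K F y => phat s F y * dot (v K (chart F y)) (nrm K F))
      = ipT (fun K x => dot (f x) (v K x)),
    forall q, Qh k q ->
      - ipT (fun K x => dot (u_h s K x) (grad (q K) x))
      + ipdT (fun K F y => un s K F y * q K (chart F y)) = 0,
    forall eta, Mthg k Omega (fun=> 0) eta ->
      ipdT (fun K F y => dot (cross (what k taut s K F y) (nrm K F)) (eta F y)) = 0
  & forall zeta, Mh0 k Omega zeta ->
      ipdT (fun K F y => un s K F y * zeta F y) = 0].

Definition un_s (s : hdg_unknowns) (K : cells) : fscal :=
  fun F y => dot (u_h s K (chart F y)) (nrm K F).

Definition un_g (taun : faces -> R) (s : hdg_unknowns) (K : cells) : fscal :=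
  fun F y => dot (u_h s K (chart F y)) (nrm K F)
             + taun F * (p_h s K (chart F y) - phat s F y).

Definition HDG_s (k : nat) (taut : R) := hdg_system k taut un_s.

Definition HDG_g (k : nat) (taut : R) (taun : faces -> R) :=
  hdg_system k taut (un_g taun).

End Mesh.

(* Main.v *)
Require Import Defs.
From HB Require Import structures.
From mathcomp Require Import all_boot all_order all_algebra.
From mathcomp Require Import all_classical all_reals all_analysis.
From mathcomp Require Import -(notations) mpoly.
From mathcomp Require Import measurable_realfun ring lra.

Set Implicit Arguments.
Unset Strict Implicit.
Unset Printing Implicit Defensive.

Import Order.TTheory GRing.Theory Num.Theory.
Import numFieldNormedType.Exports.

Local Open Scope classical_set_scope.
Local Open Scope ring_scope.


Section PolynomialFunctions.
Context {R : realType} {d : nat}.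
Implicit Types (f g : 'rV[R]_d -> R).

Lemma Ppoly_cst k (c : R) : Ppoly k (fun _ : 'rV[R]_d => c).
Proof.
exists (mpolyC d c); split=> [|x]; last by rewrite mevalC.
by rewrite msizeC; case: (c != 0).
Qed.

Lemma Ppoly_coord i : Ppoly 1 (fun x : 'rV[R]_d => x 0 i).
Proof.
by exists (mpolyX R (mnm1 i)); split=> [|x]; rewrite ?msizeX ?mdeg1 ?mevalXU.
Qed.

Lemma PpolyD k f g : Ppoly k f -> Ppoly k g -> Ppoly k (fun x => f x + g x).
Proof.
move=> [p [ps pE]] [q [qs qE]]; exists (p + q); split=> [|x].
  by rewrite (leq_trans (msizeD_le _ _))// geq_max ps.
by rewrite mevalD pE qE.
Qed.

Lemma PpolyZ k (c : R) f : Ppoly k f -> Ppoly k (fun x => c * f x).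
Proof.
move=> [p [ps pE]]; exists (c *: p); split=> [|x].
  by rewrite (leq_trans (msizeZ_le _ _)).
by rewrite mevalZ pE.
Qed.

Lemma PpolyN k f : Ppoly k f -> Ppoly k (fun x => - f x).
Proof.
move=> /(PpolyZ (-1)) [p [ps pE]]; exists p; split=> // x.
by rewrite -pE mulN1r.
Qed.

Lemma PpolyB k f g : Ppoly k f -> Ppoly k g -> Ppoly k (fun x => f x - g x).
Proof. by move=> fk gk; apply: PpolyD => //; exact: PpolyN. Qed.

Lemma Ppoly_sum k (I : Type) (s : seq I) (P : pred I) (f : I -> 'rV[R]_d -> R) :
  (forall i, P i -> Ppoly k (f i)) -> Ppoly k (fun x => \sum_(i <- s | P i) f i x).
Proof.
move=> fk; elim: s => [|i s [p [ps pE]]].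
  by have := Ppoly_cst k 0; congr Ppoly; apply/funext => x; rewrite big_nil.
case Pi: (P i); last first.
  by exists p; split=> // x; rewrite big_cons Pi pE.
have /PpolyD /(_ (ex_intro _ p (conj ps pE))) := fk _ Pi.
by move=> [q [qs qE]]; exists q; split=> // x; rewrite big_cons Pi qE.
Qed.

Lemma Ppoly_le k l f : (k <= l)%N -> Ppoly k f -> Ppoly l f.
Proof. by move=> kl [p [ps pE]]; exists p; split=> //; exact: leq_trans ps _. Qed.

Lemma PpolyM k l f g : Ppoly k f -> Ppoly l g -> Ppoly (k + l) (fun x => f x * g x).
Proof.
move=> [p [ps pE]] [q [qs qE]]; exists (p * q); split=> [|x]; last first.
  by rewrite mevalM pE qE.
have [->|p0] := eqVneq p 0; first by rewrite mul0r msize0.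
have [->|q0] := eqVneq q 0; first by rewrite mulr0 msize0.
have := leq_add ps qs; rewrite msizeM// addSn addnS.
by case: (_ + _)%N.
Qed.

Lemma PhomogD k f g : Phomog k f -> Phomog k g -> Phomog k (fun x => f x + g x).
Proof.
move=> [p [ps pE]] [q [qs qE]]; exists (p + q); split=> [|x].
  exact: dhomogD.
by rewrite mevalD pE qE.
Qed.

Lemma Phomog0 k : Phomog k (fun _ : 'rV[R]_d => 0 : R).
Proof. by exists 0; split=> [|x]; rewrite ?dhomog0 ?meval0. Qed.

Lemma PhomogZ k (c : R) f : Phomog k f -> Phomog k (fun x => c * f x).
Proof.
move=> [p [ps pE]]; exists (c *: p); split=> [|x]; first exact: dhomogZ.
by rewrite mevalZ pE.
Qed.

Lemma Phomog_poly k f : Phomog k f -> Ppoly k f.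
Proof.
move=> [p [ps pE]]; exists p; split=> //.
apply/bigmax_leqP_seq => m mp _; rewrite ltnS.
by rewrite (dhomog_mf ps mp).
Qed.

Lemma mpoly_split k (p : mpoly d R) : (msize p <= k.+2)%N ->
  exists q : 'I_d -> mpoly d R, (forall i, (msize (q i) <= k.+1)%N) /\
    p = mpolyC d (mcoeff (@mnm0 d) p) + \sum_i (mpolyX R (mnm1 i) : mpoly d R) * q i.
Proof.
move=> ps.
have h m : m \in msupp p -> exists q : 'I_d -> mpoly d R,
    (forall i, (msize (q i) <= k.+1)%N) /\
    (mcoeff m p) *: (mpolyX R m : mpoly d R) = mpolyC d (if m == (@mnm0 d) then mcoeff m p else 0) +
     \sum_i (mpolyX R (mnm1 i) : mpoly d R) * q i.
  move=> mp.
  have [->|m0] := eqVneq m (@mnm0 d).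
    exists (fun=> 0); split=> [i|]; first by rewrite msize0.
    rewrite mpolyX0 -mul_mpolyC mulr1 big1 ?addr0// => i _.
    by rewrite mulr0.
  have [i mi] : exists i, (0 < m i)%N.
    apply: contrapT => /forallNP mi; move/eqP: m0; apply; apply/mnmP => i.
    by rewrite mnm0E; apply/eqP; rewrite -leqn0 leqNgt; apply/negP/mi.
  have le1 : lem (mnm1 i) m.
    by apply/mnm_lepP => j; rewrite mnm1E; case: eqP => // <-.
  exists (fun j => if j == i then (mcoeff m p) *: mpolyX R (mnm_sub m (mnm1 i)) else 0).
  split=> [j|].
    case: ifP => _; last by rewrite msize0.
    rewrite (leq_trans (msizeZ_le _ _))// msizeX -ltnS.
    have := leq_trans (msize_mdeg_lt mp) ps.
    by rewrite -[in X in (X <= _)%N -> _](submK le1) mdegD mdeg1 addn1.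
  rewrite mpolyC0 add0r (bigD1 i)//= eqxx big1 ?addr0 => [|j /negbTE ->]; last first.
    by rewrite mulr0.
  by rewrite -scalerAr -mpolyXD addmC submK.
have {}h m : exists q : 'I_d -> mpoly d R, m \in msupp p ->
    (forall i, (msize (q i) <= k.+1)%N) /\
    (mcoeff m p) *: (mpolyX R m : mpoly d R) = mpolyC d (if m == (@mnm0 d) then mcoeff m p else 0) +
     \sum_i (mpolyX R (mnm1 i) : mpoly d R) * q i.
  by have [/h[q hq]|_] := boolP (m \in msupp p); [exists q|exists (fun=> 0)].
have [Q HQ] := choice h.
exists (fun i => \sum_(m <- msupp p) Q m i); split=> [i|].
  rewrite (leq_trans (msize_sum _ _ _))//.
  apply/bigmax_leqP_seq => m mp _; exact: (HQ m mp).1.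
rewrite [LHS]mpolyE [in LHS]big_seq.
under eq_bigr => m mp do rewrite (HQ m mp).2.
rewrite -big_seq big_split/=; congr (_ + _); last first.
  by rewrite exchange_big/=; apply: eq_bigr => i _; rewrite mulr_sumr.
have [h0|h0] := boolP ((@mnm0 d) \in msupp p).
  rewrite (bigD1_seq (@mnm0 d))//= ?msupp_uniq// eqxx big1 ?addr0// => m /negbTE ->.
  by rewrite mpolyC0.
rewrite big_seq big1 => [|m mp].
  by rewrite (memN_msupp_eq0 h0) mpolyC0.
by case: eqP mp => [->|_ _]; [rewrite (negbTE h0)|rewrite mpolyC0].
Qed.

Lemma Ppoly0E f : Ppoly 0 f -> f = (fun=> f 0).
Proof.
move=> [p [ps pE]]; apply/funext => x.
by rewrite !pE (msize1_polyC ps) !mevalC.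
Qed.

Lemma Ppoly_split k f : Ppoly k.+1 f -> exists2 g : 'I_d -> 'rV[R]_d -> R,
  (forall i, Ppoly k (g i)) & f = (fun x => f 0 + \sum_i x 0 i * g i x).
Proof.
move=> [p [/mpoly_split[q [qs pq]] pE]].
pose g i (x : 'rV[R]_d) := meval (x 0) (q i).
have fE x : f x = mcoeff (@mnm0 d) p + \sum_i x 0 i * g i x.
  rewrite pE [in LHS]pq mevalD mevalC raddf_sum/=; congr (_ + _).
  by apply: eq_bigr => i _; rewrite mevalM mevalXU.
exists g => [i|]; first by exists (q i).
apply/funext => x; rewrite fE; congr (_ + _); rewrite fE big1 ?addr0// => i _.
by rewrite mxE mul0r.
Qed.

(* Polynomial functions are the smallest family containing the constants and
   stable under f = c + sum_i x_i g_i, the degree growing by one. *)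
Lemma Ppoly_ind (P : nat -> ('rV[R]_d -> R) -> Prop) :
  (forall c, P 0%N (fun=> c)) ->
  (forall k c (g : 'I_d -> 'rV[R]_d -> R), (forall i, Ppoly k (g i)) ->
     (forall i, P k (g i)) -> P k.+1 (fun x => c + \sum_i x 0 i * g i x)) ->
  forall k f, Ppoly k f -> P k f.
Proof.
move=> P0 PS; elim=> [f /Ppoly0E ->//|k IH f /Ppoly_split [g gk ->]].
by apply: PS => // i; apply: IH.
Qed.

Lemma Ppoly_step k c (g : 'I_d -> 'rV[R]_d -> R) : (forall i, Ppoly k (g i)) ->
  Ppoly k.+1 (fun x => c + \sum_i x 0 i * g i x).
Proof.
move=> gk; apply: PpolyD; first exact: Ppoly_cst.
by apply: Ppoly_sum => i _; rewrite -add1n; apply: PpolyM => //; exact: Ppoly_coord.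
Qed.

Lemma Ppoly_homog_split k f : Ppoly k.+1 f ->
  exists f1 f2, [/\ Ppoly k f1, Phomog k.+1 f2 & f = (fun x => f1 x + f2 x)].
Proof.
have step l (g2 : 'I_d -> 'rV[R]_d -> R) :
    (forall i, Phomog l (g2 i)) ->
    Phomog l.+1 (fun x => \sum_i x 0 i * g2 i x).
  move=> g2h; have [q Q] := choice g2h.
  exists (\sum_i (mpolyX R (mnm1 i) : mpoly d R) * q i); split=> [|x].
    rewrite rpred_sum// => i _; rewrite -add1n.
    apply: dhomogM; last by case: (Q i).
    by rewrite dhomogX; apply/eqP; exact: mdeg1.
  rewrite raddf_sum/=; apply: eq_bigr => i _; rewrite mevalM mevalXU.
  by case: (Q i) => _ ->.
elim: k f => [f /Ppoly_split[g g0 ->]|k IH f /Ppoly_split[g gk ->]].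
  exists (fun=> f 0), (fun x : 'rV[R]_d => \sum_i x 0 i * g i x); split=> //.
    exact: Ppoly_cst.
  apply: step => // i; rewrite (Ppoly0E (g0 i)).
  exists (mpolyC d (g i 0)); split=> [|x]; last by rewrite mevalC.
  by rewrite -[mpolyC d _]mulr1 mul_mpolyC; apply: dhomogZ; exact: dhomog1.
have /choice[g1 /choice[g2 G]] := fun i => IH _ (gk i).
exists (fun x : 'rV[R]_d => f 0 + \sum_i x 0 i * g1 i x), (fun x : 'rV[R]_d => \sum_i x 0 i * g2 i x).
split; first by apply: Ppoly_step => i; case: (G i).
  by apply: step => // i; case: (G i).
apply/funext => x; rewrite -addrA -big_split/=; congr (_ + _).
by apply: eq_bigr => i _; have [_ _ ->] := G i; rewrite mulrDr.
Qed.

End PolynomialFunctions.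

Lemma Ppoly_comp {R : realType} (d e k : nat) (f : 'rV[R]_d -> R)
    (a : 'rV[R]_e -> 'rV[R]_d) :
  (forall i, Ppoly 1 (fun y => a y 0 i)) -> Ppoly k f -> Ppoly k (fun y => f (a y)).
Proof.
move=> a1; move: k f; apply: Ppoly_ind => [c|k c g gk IH]; first exact: Ppoly_cst.
apply: PpolyD; first exact: Ppoly_cst.
by apply: Ppoly_sum => i _; rewrite -add1n; apply: PpolyM.
Qed.


Section PartialDerivatives.
Context {R : realType} {d : nat}.
Local Notation V := 'rV[R]_d.+1.
Implicit Types (f g : V -> R) (x v : V).

Lemma derive_partial f x v : differentiable f x ->
  'D_v f x = \sum_i v 0 i * partial i f x.
Proof.
move=> df; rewrite deriveE// [in LHS](row_sum_delta v) linear_sum.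
by apply: eq_bigr => i _; rewrite linearZ/= /partial deriveE.
Qed.

Lemma partialD i f g x : differentiable f x -> differentiable g x ->
  partial i (fun z => f z + g z) x = partial i f x + partial i g x.
Proof. by move=> df dg; rewrite /partial -deriveD//; exact: diff_derivable. Qed.

Lemma partialB i f g x : differentiable f x -> differentiable g x ->
  partial i (fun z => f z - g z) x = partial i f x - partial i g x.
Proof. by move=> df dg; rewrite /partial -deriveB//; exact: diff_derivable. Qed.

Lemma partialM i f g x : differentiable f x -> differentiable g x ->
  partial i (fun z => f z * g z) x = partial i f x * g x + f x * partial i g x.
Proof.
move=> df dg; rewrite /partial.
rewrite (_ : 'D_(delta_mx 0 i) (fun z => f z * g z) x = 'D_(delta_mx 0 i) (f * g) x)//.
by rewrite deriveM; [rewrite addrC mulrC|exact: diff_derivable..].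
Qed.

Lemma partial_cst i (c : R) x : partial i (fun=> c) x = 0.
Proof. exact: derive_cst. Qed.

Lemma partialZ i (c : R) f x : differentiable f x ->
  partial i (fun z => c * f z) x = c * partial i f x.
Proof.
by move=> df; rewrite partialM ?partial_cst ?mul0r ?add0r//; exact: differentiable_cst.
Qed.

Lemma partialN i f x : differentiable f x ->
  partial i (fun z => - f z) x = - partial i f x.
Proof. by move=> df; rewrite /partial -deriveN//; exact: diff_derivable. Qed.

Lemma partial_coord i j x : partial i (fun z : V => z 0 j) x = (i == j)%:R.
Proof.
have @f : {linear V -> R}.
  by exists (fun N : V => N 0 j); do 2![eexists]; do ?[constructor];
     rewrite ?mxE// => ? *; rewrite ?mxE//; move=> ?; rewrite !mxE.
have cf : continuous f by exact: coord_continuous.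
rewrite /partial (_ : (fun _ => _) = f)// deriveE; last exact: linear_differentiable.
by rewrite diff_lin// /= mxE eqxx eq_sym.
Qed.

(* Otherwise failed unifications of derivatives unfold them to limits. *)
Opaque partial.

Lemma differentiable_sumf (I : Type) (s : seq I) (P : pred I) (h : I -> V -> R) x :
  (forall i, P i -> differentiable (h i) x) ->
  differentiable (fun z => \sum_(i <- s | P i) h i z) x.
Proof.
move=> dh; elim: s => [|i s IH].
  rewrite (_ : (fun _ => _) = cst 0); first exact: differentiable_cst.
  by apply/funext => z; rewrite big_nil.
case Pi: (P i).
  rewrite (_ : (fun _ => _) = h i + (fun z => \sum_(i <- s | P i) h i z)).
    by apply: differentiableD => //; exact: dh.
  by apply/funext => z; rewrite big_cons Pi.
rewrite (_ : (fun _ => _) = (fun z => \sum_(i <- s | P i) h i z))//.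
by apply/funext => z; rewrite big_cons Pi.
Qed.

Lemma partial_sum (I : Type) (s : seq I) (P : pred I) (h : I -> V -> R) i x :
  (forall j, P j -> differentiable (h j) x) ->
  partial i (fun z => \sum_(j <- s | P j) h j z) x
  = \sum_(j <- s | P j) partial i (h j) x.
Proof.
move=> dh; elim: s => [|j s IH].
  rewrite big_nil; apply: etrans (partial_cst i 0 x).
  by congr (partial i _ x); apply/funext => z; rewrite big_nil.
rewrite big_cons -IH; case Pj: (P j).
  rewrite -partialD; [|exact: dh|exact: differentiable_sumf].
  by congr (partial i _ x); apply/funext => z; rewrite big_cons Pj.
by congr (partial i _ x); apply/funext => z; rewrite big_cons Pj.
Qed.

Lemma Ppoly_diff k f x : Ppoly k f -> differentiable f x.
Proof.
move: k f; apply: Ppoly_ind => [c|k c g _ dg]; first exact: differentiable_cst.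
apply: differentiableD; first exact: differentiable_cst.
apply: differentiable_sumf => i _; apply: differentiableM => //.
exact: differentiable_coord.
Qed.

Lemma Ppoly_continuous k f : Ppoly k f -> continuous f.
Proof. by move=> fk x; apply: differentiable_continuous; exact: Ppoly_diff fk. Qed.

Lemma partial_step i k c (g : 'I_d.+1 -> V -> R) x : (forall i, Ppoly k (g i)) ->
  partial i (fun x => c + \sum_j x 0 j * g j x) x
  = g i x + \sum_j x 0 j * partial i (g j) x.
Proof.
move=> gk; have dg j : differentiable (g j) x by exact: Ppoly_diff (gk j).
have dx j : differentiable (fun z : V => z 0 j) x by exact: differentiable_coord.
have dxg j : differentiable (fun z : V => z 0 j * g j z) x by exact: differentiableM.
rewrite partialD; [|exact: differentiable_cst|exact: differentiable_sumf].
rewrite partial_cst add0r partial_sum//.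
under eq_bigr => j _ do rewrite partialM// partial_coord.
rewrite big_split/=; congr (_ + _).
by rewrite (bigD1 i)//= eqxx mul1r big1 ?addr0// => j /negbTE; rewrite eq_sym => ->; rewrite mul0r.
Qed.

Lemma Ppoly_partial i k f : Ppoly k f -> Ppoly k.-1 (partial i f).
Proof.
move: k f; apply: Ppoly_ind => [c|k c g gk IH].
  rewrite (_ : partial _ _ = fun=> 0); first exact: Ppoly_cst.
  by apply/funext => x; rewrite partial_cst.
rewrite (_ : partial _ _ = fun x => g i x + \sum_j x 0 j * partial i (g j) x); last first.
  by apply/funext => x; rewrite (partial_step _ _ _ gk).
apply: PpolyD => //; case: k gk IH => [|k] gk IH; last first.
  by apply: Ppoly_sum => j _; apply: (@PpolyM _ _ 1 k) => //; exact: Ppoly_coord.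
rewrite (_ : (fun _ => _) = fun=> 0); first exact: Ppoly_cst.
apply/funext => x; rewrite big1// => j _.
by rewrite (Ppoly0E (gk j)) partial_cst mulr0.
Qed.

Lemma partialC i j k f x : Ppoly k f ->
  partial i (partial j f) x = partial j (partial i f) x.
Proof.
move=> fk; move: k f fk x; apply: Ppoly_ind => [c|k c g gk IH] x.
  have E a : partial a (fun _ : V => c) = fun=> 0.
    by apply/funext => y; rewrite partial_cst.
  by rewrite !E !partial_cst.
have dg a l : Ppoly k.-1 (partial a (g l)) by exact: Ppoly_partial.
have E a b : partial a (partial b (fun x => c + \sum_j x 0 j * g j x)) x =
    partial a (g b) x + (partial b (g a) x
      + \sum_l x 0 l * partial a (partial b (g l)) x).
  rewrite (_ : partial b _ =
    fun x => g b x + (0 + \sum_j x 0 j * partial b (g j) x)); last first.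
    by apply/funext => y; rewrite add0r (partial_step _ _ _ gk).
  rewrite partialD; first by rewrite (partial_step _ _ _ (dg b)).
    exact: Ppoly_diff (gk b).
  by apply: (@Ppoly_diff k.-1.+1); exact: Ppoly_step.
have S : \sum_l x 0 l * partial i (partial j (g l)) x =
    \sum_l x 0 l * partial j (partial i (g l)) x.
  by apply: eq_bigr => l _; rewrite IH.
have swap (u v p q s t : R) : u = p + (q + s) -> v = q + (p + t) -> s = t -> u = v.
  by move=> -> -> ->; rewrite addrCA.
exact: swap (E i j) (E j i) S.
Qed.

Lemma Ppoly_line k f x v : Ppoly k f -> exists p : {poly R},
  forall t, f (x + t *: v) = p.[t] /\
            \sum_i v 0 i * partial i f (x + t *: v) = p^`().[t].
Proof.
move: k f; apply: Ppoly_ind => [c|k c g gk /choice[q Q]].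
  exists c%:P => t; rewrite hornerC derivC horner0 big1// => i _.
  by rewrite partial_cst mulr0.
exists (c%:P + \sum_i ((x 0 i)%:P + v 0 i *: 'X) * q i) => t; split.
  rewrite hornerD hornerC horner_sum; congr (_ + _); apply: eq_bigr => i _.
  by rewrite !hornerE !mxE (Q i t).1; congr (_ * _); rewrite mulrC.
under eq_bigr => i _ do rewrite (partial_step _ _ _ gk) mulrDr mulr_sumr.
rewrite derivD derivC add0r raddf_sum/= horner_sum big_split/= exchange_big/= -big_split/=.
apply: eq_bigr => i _; rewrite derivM derivD derivC add0r derivZ derivX !hornerE.
rewrite -(Q i t).1 -(Q i t).2 mulr_sumr; congr (_ + _).
by apply: eq_bigr => j _; rewrite !mxE mulrCA [t * _]mulrC.
Qed.

Lemma poly_eventually0 (p : {poly R}) (e : R) : 0 < e ->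
  (forall t, 0 < t < e -> p.[t] = 0) -> p = 0.
Proof.
move=> e0 p0; apply: contrapT => /eqP pn0.
pose s := [seq e / (i.+2)%:R | i <- iota 0 (size p)].
have us : uniq s.
  rewrite map_inj_uniq ?iota_uniq// => i j /(mulfI (lt0r_neq0 e0)) /invr_inj.
  by move/eqP; rewrite eqr_nat => /eqP[].
suff rs : all (root p) s.
  by have := max_poly_roots pn0 rs us; rewrite size_map size_iota ltnn.
apply/allP => t /mapP[i _ ->]; apply/rootP; apply: p0.
rewrite divr_gt0//= ltr_pdivrMr// ltr_pMr// ltr1n//.
Qed.

Lemma Ppoly_eq0 k f (D : set V) : Ppoly k f -> interior D !=set0 ->
  (forall x, D x -> f x = 0) -> f = (fun=> 0).
Proof.
move=> fk [x0 Dx0] f0; apply/funext => x.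
have [p P] := Ppoly_line x0 (x - x0) fk.
have : \forall t \near (0 : R), D (x0 + t *: (x - x0)).
  have c : {for 0, continuous (fun t : R => x0 + t *: (x - x0))}.
    apply: continuousD; first exact: cst_continuous.
    exact: scalel_continuous.
  by apply: c; rewrite scale0r addr0.
move=> /nbhs_ballP[e/= e0 De].
have p0 : p = 0.
  apply: (poly_eventually0 e0) => t /andP[t0 te].
  rewrite -(P t).1 f0//; apply: De; rewrite /ball/= sub0r normrN gtr0_norm//.
by rewrite -[x](subrKC x0) -[x - x0]scale1r (P 1).1 p0 horner0.
Qed.

End PartialDerivatives.


Section VectorAlgebra.
Context {R : realType}.

Lemma sum_I3 (V : nmodType) (F : 'I_3 -> V) : \sum_i F i = F 0 + F 1 + F 2.
Proof.
rewrite !big_ord_recl big_ord0 addr0 addrA.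
by congr (F _ + F _ + F _); exact: val_inj.
Qed.

Lemma sum_I2 (V : nmodType) (F : 'I_2 -> V) : \sum_i F i = F 0 + F 1.
Proof.
rewrite !big_ord_recl big_ord0 addr0.
by congr (F _ + F _); exact: val_inj.
Qed.

Lemma forall_I3 (P : 'I_3 -> Prop) : P 0 -> P 1 -> P 2 -> forall i, P i.
Proof.
move=> P0 P1 P2 [[|[|[|//]]] i3].
- by rewrite (_ : Ordinal i3 = 0)//; exact: val_inj.
- by rewrite (_ : Ordinal i3 = 1)//; exact: val_inj.
- by rewrite (_ : Ordinal i3 = 2)//; exact: val_inj.
Qed.

Lemma forall_I2 (P : 'I_2 -> Prop) : P 0 -> P 1 -> forall i, P i.
Proof.
move=> P0 P1 [[|[|//]] i2].
- by rewrite (_ : Ordinal i2 = 0)//; exact: val_inj.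
- by rewrite (_ : Ordinal i2 = 1)//; exact: val_inj.
Qed.

Section Dot.
Context {d : nat}.
Implicit Types u v w : 'rV[R]_d.

Lemma dotC u v : dot u v = dot v u.
Proof. by apply: eq_bigr => i _; rewrite mulrC. Qed.

Lemma dotDl u v w : dot (u + v) w = dot u w + dot v w.
Proof. by rewrite -big_split/=; apply: eq_bigr => i _; rewrite mxE mulrDl. Qed.

Lemma dotZl (c : R) u v : dot (c *: u) v = c * dot u v.
Proof. by rewrite /dot mulr_sumr; apply: eq_bigr => i _; rewrite mxE mulrA. Qed.

Lemma dotNl u v : dot (- u) v = - dot u v.
Proof. by rewrite -scaleN1r dotZl mulN1r. Qed.

Lemma dotBl u v w : dot (u - v) w = dot u w - dot v w.
Proof. by rewrite dotDl dotNl. Qed.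

Lemma dotDr u v w : dot u (v + w) = dot u v + dot u w.
Proof. by rewrite dotC dotDl !(dotC u). Qed.

Lemma dotZr (c : R) u v : dot u (c *: v) = c * dot u v.
Proof. by rewrite dotC dotZl dotC. Qed.

Lemma dotNr u v : dot u (- v) = - dot u v.
Proof. by rewrite dotC dotNl dotC. Qed.

Lemma dotBr u v w : dot u (v - w) = dot u v - dot u w.
Proof. by rewrite dotDr dotNr. Qed.

Lemma dot0l u : dot 0 u = 0.
Proof. by rewrite /dot big1// => i _; rewrite mxE mul0r. Qed.

Lemma dot0r u : dot u 0 = 0.
Proof. by rewrite dotC dot0l. Qed.

Lemma dot_suml (I : Type) (s : seq I) (P : pred I) (F : I -> 'rV[R]_d) u :
  dot (\sum_(i <- s | P i) F i) u = \sum_(i <- s | P i) dot (F i) u.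
Proof. exact: (big_morph (fun v => dot v u) (fun a b => dotDl a b u) (dot0l u)). Qed.

Lemma dotvv_ge0 u : 0 <= dot u u.
Proof. by apply: sumr_ge0 => i _; rewrite -expr2 sqr_ge0. Qed.

Lemma dotvv_eq0 u : dot u u = 0 -> u = 0.
Proof.
move/eqP; rewrite psumr_eq0 => [/allP u0|i _]; last by rewrite -expr2 sqr_ge0.
apply/rowP => i; rewrite mxE; apply/eqP.
by rewrite -[_ == 0]orbb -mulf_eq0; apply: u0; rewrite mem_index_enum.
Qed.

Lemma dot_delta u i : dot u (delta_mx 0 i) = u 0 i.
Proof.
rewrite /dot (bigD1 i)//= big1 => [|j /negbTE ji]; rewrite mxE eqxx ?eqxx ?ji ?mulr0//.
by rewrite mulr1 addr0.
Qed.

End Dot.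

Lemma dot_I3 (u v : 'rV[R]_3) :
  dot u v = u 0 0 * v 0 0 + u 0 1 * v 0 1 + u 0 2 * v 0 2.
Proof. exact: sum_I3. Qed.

Lemma crossE (u v : 'rV[R]_3) :
  (cross u v 0 0 = u 0 1 * v 0 2 - u 0 2 * v 0 1) *
  (cross u v 0 1 = u 0 2 * v 0 0 - u 0 0 * v 0 2) *
  (cross u v 0 2 = u 0 0 * v 0 1 - u 0 1 * v 0 0).
Proof.
have e11 : 1 + 1 = 2 :> 'I_3 by exact: val_inj.
have e12 : 1 + 2 = 0 :> 'I_3 by exact: val_inj.
have e21 : 2 + 1 = 0 :> 'I_3 by exact: val_inj.
have e22 : 2 + 2 = 1 :> 'I_3 by exact: val_inj.
by split; [split|]; rewrite mxE ?add0r ?e11 ?e12 ?e21 ?e22.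
Qed.

Lemma rV3P (u v : 'rV[R]_3) :
  u 0 0 = v 0 0 -> u 0 1 = v 0 1 -> u 0 2 = v 0 2 -> u = v.
Proof. by move=> *; apply/rowP; exact: forall_I3. Qed.

Local Ltac vec := try apply: rV3P; rewrite ?(dot_I3, crossE, mxE); ring.

Lemma crossC (u v : 'rV[R]_3) : cross u v = - cross v u.
Proof. vec. Qed.

Lemma crossDl (u v w : 'rV[R]_3) : cross (u + v) w = cross u w + cross v w.
Proof. vec. Qed.

Lemma crossDr (u v w : 'rV[R]_3) : cross u (v + w) = cross u v + cross u w.
Proof. vec. Qed.

Lemma crossZl c (u v : 'rV[R]_3) : cross (c *: u) v = c *: cross u v.
Proof. vec. Qed.

Lemma crossZr c (u v : 'rV[R]_3) : cross u (c *: v) = c *: cross u v.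
Proof. vec. Qed.

Lemma crossNl (u v : 'rV[R]_3) : cross (- u) v = - cross u v.
Proof. vec. Qed.

Lemma crossNr (u v : 'rV[R]_3) : cross u (- v) = - cross u v.
Proof. vec. Qed.

Lemma crossBl (u v w : 'rV[R]_3) : cross (u - v) w = cross u w - cross v w.
Proof. vec. Qed.

Lemma cross0l (u : 'rV[R]_3) : cross 0 u = 0.
Proof. vec. Qed.

Lemma cross0r (u : 'rV[R]_3) : cross u 0 = 0.
Proof. vec. Qed.

Lemma crossvv (u : 'rV[R]_3) : cross u u = 0.
Proof. vec. Qed.

Lemma cross_cross (u v w : 'rV[R]_3) :
  cross u (cross v w) = dot u w *: v - dot u v *: w.
Proof. vec. Qed.

Lemma dot_crossA (u v w : 'rV[R]_3) : dot (cross u v) w = dot u (cross v w).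
Proof. vec. Qed.

Lemma dot_cross (u v a b : 'rV[R]_3) :
  dot (cross u v) (cross a b) = dot u a * dot v b - dot u b * dot v a.
Proof. vec. Qed.

Lemma dot_crossvl (u v : 'rV[R]_3) : dot (cross u v) u = 0.
Proof. vec. Qed.

Lemma dot_crossvr (u v : 'rV[R]_3) : dot (cross u v) v = 0.
Proof. vec. Qed.

Lemma tangE (n v : 'rV[R]_3) : dot n n = 1 -> tang n v = v - dot v n *: n.
Proof. by move=> n1; rewrite /tang cross_cross n1 scale1r dotC. Qed.

Lemma tangN (n v : 'rV[R]_3) : tang (- n) v = tang n v.
Proof. by rewrite /tang crossNl crossNr crossNr opprK. Qed.

Lemma tangD (n v w : 'rV[R]_3) : tang n (v + w) = tang n v + tang n w.
Proof. by rewrite /tang crossDl crossDr. Qed.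

Lemma tangZ c (n v : 'rV[R]_3) : tang n (c *: v) = c *: tang n v.
Proof. by rewrite /tang crossZl crossZr. Qed.

Lemma tang0 (n : 'rV[R]_3) : tang n 0 = 0.
Proof. by rewrite /tang cross0l cross0r. Qed.

Lemma dot_tangn (n v : 'rV[R]_3) : dot (tang n v) n = 0.
Proof. exact: dot_crossvl. Qed.

Lemma tang_id (n v : 'rV[R]_3) : dot n n = 1 -> dot v n = 0 -> tang n v = v.
Proof. by move=> n1 vn; rewrite tangE// vn scale0r subr0. Qed.

Lemma dot_tangl (n v w : 'rV[R]_3) : dot n n = 1 -> dot w n = 0 ->
  dot (tang n v) w = dot v w.
Proof. by move=> n1 wn; rewrite tangE// dotBl dotZl (dotC n) wn mulr0 subr0. Qed.

Section Frame.
Variables (A : 'M[R]_(2, 3)).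
Hypothesis A1 : A *m A^T = 1%:M.
Let n := cross (row 0 A) (row 1 A).

Lemma frame_dot i j : dot (row i A) (row j A) = (i == j)%:R.
Proof.
have := congr1 (fun M : 'M[R]_2 => M i j) A1; rewrite !mxE => <-.
by apply: eq_bigr => k _; rewrite !mxE.
Qed.

Lemma frame_normal_unit : dot n n = 1.
Proof. by rewrite dot_cross !frame_dot/= mulr1 mulr0 subr0. Qed.

Lemma frame_dot_normal i : dot (row i A) n = 0.
Proof. by rewrite dotC; move: i; apply: forall_I2; rewrite ?dot_crossvl ?dot_crossvr. Qed.

Lemma frame_complete v :
  v = dot v (row 0 A) *: row 0 A + dot v (row 1 A) *: row 1 A + dot v n *: n.
Proof.
have -> : dot v (row 0 A) *: row 0 A + dot v (row 1 A) *: row 1 A = tang n v.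
  rewrite /tang [cross v n]cross_cross crossDr crossZr crossNr crossZr.
  have -> : cross n (row 0 A) = row 1 A.
    by rewrite crossC {1}/n cross_cross !frame_dot/= scale1r scale0r sub0r opprK.
  have -> : cross n (row 1 A) = - row 0 A.
    by rewrite crossC {1}/n cross_cross !frame_dot/= scale1r scale0r subr0.
  by rewrite scalerN opprK addrC.
by rewrite tangE ?subrK// frame_normal_unit.
Qed.

Lemma mulmx_frame (y : 'rV[R]_2) : y *m A = y 0 0 *: row 0 A + y 0 1 *: row 1 A.
Proof. by apply/rowP => j; rewrite !mxE sum_I2. Qed.

Lemma dot_mulmx_frame (y : 'rV[R]_2) v :
  dot (y *m A) v = y 0 0 * dot (row 0 A) v + y 0 1 * dot (row 1 A) v.
Proof. by rewrite mulmx_frame dotDl !dotZl. Qed.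

Lemma mulmx_frame_normal (y : 'rV[R]_2) : dot (y *m A) n = 0.
Proof. by rewrite dot_mulmx_frame !frame_dot_normal !mulr0 addr0. Qed.

Lemma frame_project v : dot v n = 0 -> v = (v *m A^T) *m A.
Proof.
move=> vn; rewrite {1}(frame_complete v) vn scale0r addr0 mulmx_frame.
by congr (_ *: _ + _ *: _); rewrite mxE; apply: eq_bigr => k _; rewrite !mxE.
Qed.

Lemma tang_frame v : tang n v = (v *m A^T) *m A.
Proof.
rewrite tangE ?frame_normal_unit// {1}(frame_complete v) addrK mulmx_frame.
by congr (_ *: _ + _ *: _); rewrite mxE; apply: eq_bigr => k _; rewrite !mxE.
Qed.

Lemma mulmx_frameK (y : 'rV[R]_2) : (y *m A) *m A^T = y.
Proof. by rewrite -mulmxA A1 mulmx1. Qed.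

End Frame.

End VectorAlgebra.


Section PolynomialPotentials.
Context {R : realType}.

Lemma euler_solve {d k : nat} (f : 'rV[R]_d.+1 -> R) : Ppoly k f ->
  forall c : R, 0 < c -> exists2 g, Ppoly k g &
    forall x : 'rV[R]_d.+1, \sum_i x 0 i * partial i g x + c * g x = f x.
Proof.
move: k f; apply: Ppoly_ind => [a|k a h hk IH] c c0.
  exists (fun=> a / c) => [|x]; first exact: Ppoly_cst.
  rewrite big1 ?add0r 1?mulrC ?divfK ?gt_eqF// => i _.
  by rewrite partial_cst mulr0.
have c10 : 0 < 1 + c by rewrite addr_gt0.
have [G Gk HG] : exists2 G : 'I_d.+1 -> 'rV[R]_d.+1 -> R, forall j, Ppoly k (G j) &
    forall j (x : 'rV[R]_d.+1), \sum_i x 0 i * partial i (G j) x + (1 + c) * G j x = h j x.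
  have /choice[G HG] : forall j, exists g, Ppoly k g /\
      forall x : 'rV[R]_d.+1, \sum_i x 0 i * partial i g x + (1 + c) * g x = h j x.
    by move=> j; have [g] := IH j _ c10; exists g.
  by exists G => j; have [] := HG j.
exists (fun x : 'rV[R]_d.+1 => a / c + \sum_j x 0 j * G j x) => [|x]; first exact: Ppoly_step.
under eq_bigr => i _ do rewrite (partial_step _ _ _ Gk) mulrDr mulr_sumr.
rewrite big_split/= exchange_big/= mulrDr [c * (a / c)]mulrC divfK ?gt_eqF//.
rewrite addrCA; congr (_ + _); rewrite mulr_sumr -!big_split/=.
apply: eq_bigr => j _; rewrite -HG.
have -> : \sum_i x 0 i * (x 0 j * partial i (G j) x) =
    x 0 j * \sum_i x 0 i * partial i (G j) x.
  by rewrite mulr_sumr; apply: eq_bigr => i _; rewrite mulrCA.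
ring.
Qed.

Lemma euler_inj {d k : nat} (h : 'rV[R]_d.+1 -> R) (n : nat) : Ppoly k h ->
  (forall x : 'rV[R]_d.+1, \sum_i x 0 i * partial i h x + n.+1%:R * h x = 0) ->
  forall x, h x = 0.
Proof.
move=> hk h0 x; have [p P] := Ppoly_line 0 x hk.
have p0 : 'X * p^`() + n.+1%:R *: p = 0.
  apply: (@poly_eventually0 _ _ 1) => // t _; rewrite !hornerE.
  rewrite -(P t).1 -(P t).2 !add0r -[RHS](h0 (t *: x)) mulr_sumr; congr (_ + _).
  by apply: eq_bigr => i _; rewrite mxE mulrA.
suff pE : p = 0 by rewrite -[x]scale1r -[_ *: _]add0r (P 1).1 pE horner0.
apply/polyP => i; rewrite coef0.
have := congr1 (fun q : {poly R} => q`_i) p0.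
rewrite coefD coefXM coefZ coef_deriv coef0.
case: i => [|i] /=; first by rewrite add0r => /eqP; rewrite mulf_eq0 pnatr_eq0/= => /eqP.
by rewrite mulr_natl -mulrnDr => /eqP; rewrite mulrn_eq0/= => /eqP.
Qed.

Lemma polynomial_potential {d k : nat} (u : 'I_d.+1 -> 'rV[R]_d.+1 -> R) :
  (forall i, Ppoly k (u i)) ->
  (forall i j x, partial i (u j) x = partial j (u i) x) ->
  exists2 phi, Ppoly k.+1 phi & forall i x, partial i phi x = u i x.
Proof.
move=> uk usym.
have /choice[v V] : forall i, exists v, Ppoly k v /\
    forall x : 'rV[R]_d.+1, \sum_j x 0 j * partial j v x + 1 * v x = u i x.
  by move=> i; have [v] := euler_solve (uk i) (@ltr01 R); exists v.
have dv i x : differentiable (v i) x by exact: Ppoly_diff (V i).1.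
have dpv i j x : differentiable (partial j (v i)) x.
  by exact: Ppoly_diff (Ppoly_partial j (V i).1).
have dE i j (x : 'rV[R]_d.+1) : \sum_l x 0 l * partial l (partial j (v i)) x
    + 2 * partial j (v i) x = partial j (u i) x.
  have -> : u i = fun x : 'rV[R]_d.+1 => (0 + \sum_l x 0 l * partial l (v i) x) + v i x.
    by apply/funext => z; rewrite -(V i).2 mul1r add0r.
  rewrite partialD//; last first.
    apply: (@Ppoly_diff _ _ k.-1.+1); apply: Ppoly_step => l.
    exact: Ppoly_partial (V i).1.
  rewrite (@partial_step _ _ j k.-1); last by move=> l; exact: Ppoly_partial (V i).1.
  have comb (s t p : R) : s = t -> s + 2 * p = p + t + p by move=> ->; ring.
  apply: comb; apply: eq_bigr => l _; apply: congr1.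
  exact: partialC (V i).1.
have vsym i j x : partial i (v j) x = partial j (v i) x.
  apply/eqP; rewrite -subr_eq0; apply/eqP.
  apply: (@euler_inj _ k.-1 (fun x => partial i (v j) x - partial j (v i) x) 1).
    by apply: PpolyB; apply: Ppoly_partial; exact: (V _).1.
  move=> {}x; under eq_bigr => l _ do rewrite partialB// mulrBr.
  have comb (a b c d' e : R) : a + 2 * b = e -> c + 2 * d' = e ->
      a - c + 2 * (b - d') = 0 by lra.
  rewrite sumrB; apply: comb; first exact: dE.
  by rewrite dE usym.
exists (fun x : 'rV[R]_d.+1 => 0 + \sum_i x 0 i * v i x) => [|j x].
  by apply: Ppoly_step => i; exact: (V i).1.
rewrite (@partial_step _ _ j k); last by move=> i; exact: (V i).1.
rewrite -[RHS](V j).2 mul1r addrC; congr (_ + _).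
by apply: eq_bigr => i _; rewrite vsym.
Qed.

End PolynomialPotentials.

Section UniqueContinuation.
Context {R : realType}.
Implicit Types (u : 'rV[R]_3 -> 'rV[R]_3).

Lemma Pvec_diff {d k : nat} (u : 'rV[R]_d.+1 -> 'rV[R]_3) x i :
  Pvec k u -> differentiable (fun z => u z 0 i) x.
Proof. by move=> uk; exact: Ppoly_diff (uk i). Qed.

Lemma curl_eq0 u x : curl u x = 0 ->
  forall i j, partial i (fun z => u z 0 j) x = partial j (fun z => u z 0 i) x.
Proof.
move=> c0.
have e11 : 1 + 1 = 2 :> 'I_3 by exact: val_inj.
have e12 : 1 + 2 = 0 :> 'I_3 by exact: val_inj.
have e21 : 2 + 1 = 0 :> 'I_3 by exact: val_inj.
have e22 : 2 + 2 = 1 :> 'I_3 by exact: val_inj.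
have c i : partial (i + 1) (fun z => u z 0 (i + 2)) x =
           partial (i + 2) (fun z => u z 0 (i + 1)) x.
  by have /rowP/(_ i) := c0; rewrite !mxE => /eqP; rewrite subr_eq0 => /eqP.
have := (c 0, c 1, c 2); rewrite !add0r e11 e12 e21 e22 => -[[c1 c2] c3].
by apply: forall_I3; apply: forall_I3.
Qed.

Lemma sym_curl_eq0 u x :
  (forall i j, partial i (fun z => u z 0 j) x = partial j (fun z => u z 0 i) x) ->
  curl u x = 0.
Proof. by move=> s; apply/rowP => i; rewrite !mxE s subrr. Qed.

Let Dn (n : 'rV[R]_3) u (x : 'rV[R]_3) : 'rV[R]_3 :=
  \row_j \sum_i n 0 i * partial i (fun z => u z 0 j) x.

Lemma deriv_eq0_const (p : {poly R}) : p^`() = 0 -> forall t, p.[t] = p.[0].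
Proof.
move=> p0 t; suff -> : p = (p`_0)%:P by rewrite !hornerC.
apply/polyP => -[|i]; rewrite coefC//=.
have := congr1 (fun q : {poly R} => q`_i) p0.
by rewrite coef_deriv coef0 => /eqP; rewrite mulrn_eq0/= => /eqP.
Qed.

(* On the plane, the Jacobian of u is symmetric, trace free and kills the
   tangent directions; hence the normal derivative of u vanishes as well, and it
   satisfies the same hypotheses with a smaller degree. *)
Lemma unique_continuation {k : nat} u (o : 'rV[R]_3) (A : 'M[R]_(2, 3)) :
  A *m A^T = 1%:M -> Pvec k u ->
  (forall x, curl u x = 0) -> (forall x, divg u x = 0) ->
  (forall y, u (o + y *m A) = 0) -> forall x, u x = 0.
Proof.
move=> A1; set n := cross (row 0 A) (row 1 A).
elim: k u => [|k IH] u uk uc ud u0 x.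
  apply/rowP => i; have := u0 0; rewrite mul0mx addr0 => /rowP/(_ i).
  by have /(congr1 (fun f => (f x, f o))) := Ppoly0E (uk i) => -[-> ->].
have du i z : differentiable (fun z => u z 0 i) z by exact: Pvec_diff uk.
have pk i j : Ppoly k (partial i (fun z => u z 0 j)).
  exact: (Ppoly_partial i (uk j)).
have Dk : Pvec k (Dn n u).
  move=> j; rewrite (_ : (fun _ => _) =
      fun x => \sum_i n 0 i * partial i (fun z => u z 0 j) x); last first.
    by apply/funext => z; rewrite mxE.
  by apply: Ppoly_sum => i _; exact: PpolyZ.
have pD i j z : partial i (fun z => Dn n u z 0 j) z =
    \sum_l n 0 l * partial i (partial l (fun z => u z 0 j)) z.
  rewrite (_ : (fun _ => _) =
      fun x => \sum_i n 0 i * partial i (fun z => u z 0 j) x); last first.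
    by apply/funext => y; rewrite mxE.
  rewrite partial_sum => [|l _]; last first.
    by apply: differentiableM; [exact: differentiable_cst|exact: Ppoly_diff (pk _ _)].
  by apply: eq_bigr => l _; rewrite partialZ//; exact: Ppoly_diff (pk _ _).
have sym z i j := curl_eq0 (uc z) i j.
have D0 z : Dn n u z = 0.
  apply: IH => //= {}z.
  - apply: sym_curl_eq0 => i j; rewrite !pD; apply: eq_bigr => l _.
    apply: congr1; apply: etrans (partialC i l z (uk j)) _.
    apply: esym; apply: etrans (partialC j l z (uk i)) _.
    by apply: (congr1 (fun h => partial l h z)); apply/funext => y; exact: sym.
  - rewrite /divg; under eq_bigr => i _ do rewrite pD.
    rewrite exchange_big big1//= => l _; rewrite -mulr_sumr.
    have -> : \sum_i partial i (partial l (fun z => u z 0 i)) z =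
        \sum_i partial l (partial i (fun z => u z 0 i)) z.
      by apply: eq_bigr => i _; exact: partialC (uk i).
    rewrite -partial_sum => [|i _]; last exact: Ppoly_diff (pk _ _).
    rewrite (_ : (fun _ => _) = fun=> 0) ?partial_cst ?mulr0//.
    by apply/funext => y; exact: ud.
  pose L (a : 'rV[R]_3) : 'rV[R]_3 := \row_j \sum_i a 0 i * partial i (fun z => u z 0 j) (o + z *m A).
  have LD (a b : R) v w : L (a *: v + b *: w) = a *: L v + b *: L w.
    apply/rowP => j; rewrite !mxE !mulr_sumr -big_split/=.
    by apply: eq_bigr => i _; rewrite !mxE mulrDl !mulrA.
  have Ls a b : dot (L a) b = dot (L b) a.
    rewrite /dot; under eq_bigr => j _ do rewrite mxE mulr_suml.
    under [RHS]eq_bigr => j _ do rewrite mxE mulr_suml.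
    rewrite exchange_big/=; apply: eq_bigr => i _; apply: eq_bigr => j _.
    by rewrite sym; ring.
  have Lt i : L (row i A) = 0.
    apply/rowP => j; rewrite [LHS]mxE [RHS]mxE.
    have [p P] := Ppoly_line (o + z *m A) (row i A) (uk j).
    have p0 : p = 0.
      apply: (@poly_eventually0 _ _ 1) => // t _; rewrite -(P t).1.
      by rewrite -addrA rowE scalemxAl -mulmxDl u0 mxE.
    by have := (P 0).2; rewrite p0 scale0r addr0 linear0 horner0.
  have LE v : L v = dot v n *: L n.
    rewrite {1}(frame_complete A1 v) -/n -[_ + dot v (row 1 A) *: _]scale1r.
    by rewrite LD LD !Lt !scaler0 addr0 scaler0 add0r.
  have tr : \sum_i dot (L (delta_mx 0 i)) (delta_mx 0 i) = 0.
    rewrite -[RHS](ud (o + z *m A)); apply: eq_bigr => i _.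
    rewrite dot_delta mxE (bigD1 i)//= big1 => [|j /negbTE ji].
      by rewrite mxE !eqxx mul1r addr0.
    by rewrite mxE ji andbF mul0r.
  have Lnn : dot (L n) n = 0.
    rewrite -[RHS]tr; apply: eq_bigr => i _.
    by rewrite [L (delta_mx _ _)]LE dotZl dot_delta mulrC dotC dot_delta.
  have : L n = 0.
    rewrite (frame_complete A1 (L n)) !(Ls n (row _ _)) !Lt !dot0l !scale0r add0r.
    by rewrite Lnn scale0r addr0.
  by move=> /rowP Ln; apply/rowP => j; have := Ln j; rewrite !mxE.
pose y := (x - o) *m A^T.
have xE : x = (o + y *m A) + dot (x - o) n *: n.
  rewrite -addrA -(tang_frame A1) tangE ?frame_normal_unit// subrK.
  by rewrite subrKC.
apply/rowP => j; rewrite mxE xE.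
have [p P] := Ppoly_line (o + y *m A) n (uk j).
rewrite (P _).1 deriv_eq0_const.
  by rewrite -(P 0).1 scale0r addr0 u0 mxE.
apply: (@poly_eventually0 _ _ 1) => // t _; rewrite -(P t).2.
by have /rowP/(_ j) := D0 (o + y *m A + t *: n); rewrite !mxE.
Qed.

End UniqueContinuation.


Section MeasurableCoordinates.
Context {R : realType}.
Local Notation mR := (measurableTypeR R).

Lemma pt2E (t : R * R) : (pt2 t 0 0 = t.1) * (pt2 t 0 1 = t.2).
Proof. by rewrite !mxE. Qed.

Lemma pt3E (t : R * R * R) :
  (pt3 t 0 0 = t.1.1) * (pt3 t 0 1 = t.1.2) * (pt3 t 0 2 = t.2).
Proof. by rewrite !mxE. Qed.

Lemma pt2K (y : 'rV[R]_2) : pt2 (y 0 0, y 0 1) = y.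
Proof. by apply/rowP; apply: forall_I2; rewrite pt2E. Qed.

Lemma pt3K (x : 'rV[R]_3) : pt3 (x 0 0, x 0 1, x 0 2) = x.
Proof. by apply: rV3P; rewrite pt3E. Qed.

Lemma measurable_ratball (q r : rat) : measurable (ball (ratr q : R) (ratr r : R) : set mR).
Proof. exact: measurable_ball. Qed.

Lemma near_rat (x e : R) : 0 < e -> exists q : rat, `|x - ratr q| < e.
Proof.
move=> e0; have [|q /itvP qx] := @rat_in_itvoo _ (x - e) (x + e).
  by rewrite ltrBlDr -addrA ltrDl addr_gt0.
by exists q; rewrite distrC real_ltr_distl ?num_real// !qx.
Qed.

Lemma ratr_small (e : R) : 0 < e -> exists2 r : rat, 0 < (ratr r : R) & ratr r < e.
Proof.
by move=> e0; have [q /itvP qx] := rat_in_itvoo e0; exists q; rewrite qx.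
Qed.

Lemma ratball_triangle (t e s : R) (q r : rat) : `|t - ratr q| < ratr r ->
  ratr r < e / 2 -> ball (ratr q : R) (ratr r : R) s -> ball t e s.
Proof.
rewrite /ball/= => h re b; rewrite -(subrKA (ratr q)) (le_lt_trans (ler_normD _ _))//.
by rewrite (splitr e) ltrD// (lt_trans _ re).
Qed.

Lemma open_pt2_measurable (U : set 'rV[R]_2) : open U ->
  measurable (pt2 @^-1` U : set (mR * mR)).
Proof.
move=> oU.
pose box r q1 q2 : set (mR * mR) :=
  (ball (ratr q1 : R) (ratr r : R)) `*` (ball (ratr q2 : R) (ratr r : R)).
have -> : pt2 @^-1` U = \bigcup_(r : rat) \bigcup_(q1 : rat) \bigcup_(q2 : rat)
    if `[< box r q1 q2 `<=` pt2 @^-1` U >] then box r q1 q2 else set0.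
  apply/seteqP; split=> [[t1 t2] Ut|[t1 t2] [r _ [q1 _ [q2 _]]]]; last first.
    by case: ifPn => // /asboolP; exact.
  have /nbhs_ballP[e /= e0 eU] := open_nbhs_nbhs (conj oU Ut).
  have [r r0 re] := ratr_small (divr_gt0 e0 (@ltr0n R 2)).
  have [q1 h1] := near_rat t1 r0; have [q2 h2] := near_rat t2 r0.
  exists r => //; exists q1 => //; exists q2 => //.
  rewrite asboolT; first by split; rewrite /ball/= distrC.
  move=> [s1 s2] [/= b1 b2]; apply: eU; split=> // i j.
  rewrite ord1; move: j; apply: forall_I2; rewrite !pt2E/=.
    exact: ratball_triangle h1 re b1.
  exact: ratball_triangle h2 re b2.
do 3![apply: bigcupT_measurable_rat => ?]; case: ifP => // _.
by apply: measurableX; exact: measurable_ratball.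
Qed.

Lemma open_pt3_measurable (U : set 'rV[R]_3) : open U ->
  measurable (pt3 @^-1` U : set (mR * mR * mR)).
Proof.
move=> oU.
pose box r q1 q2 q3 : set (mR * mR * mR) :=
  (ball (ratr q1 : R) (ratr r : R)) `*` (ball (ratr q2 : R) (ratr r : R))
  `*` (ball (ratr q3 : R) (ratr r : R)).
have -> : pt3 @^-1` U = \bigcup_(r : rat) \bigcup_(q1 : rat) \bigcup_(q2 : rat)
    \bigcup_(q3 : rat)
    if `[< box r q1 q2 q3 `<=` pt3 @^-1` U >] then box r q1 q2 q3 else set0.
  apply/seteqP; split=> [[[t1 t2] t3] Ut|[[t1 t2] t3] [r _ [q1 _ [q2 _ [q3 _]]]]]; last first.
    by case: ifPn => // /asboolP; exact.
  have /nbhs_ballP[e /= e0 eU] := open_nbhs_nbhs (conj oU Ut).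
  have [r r0 re] := ratr_small (divr_gt0 e0 (@ltr0n R 2)).
  have [q1 h1] := near_rat t1 r0; have [q2 h2] := near_rat t2 r0.
  have [q3 h3] := near_rat t3 r0.
  exists r => //; exists q1 => //; exists q2 => //; exists q3 => //.
  rewrite asboolT; first by do 2?split; rewrite /ball/= distrC.
  move=> [[s1 s2] s3] [/= [b1 b2] b3]; apply: eU; split=> // i j.
  rewrite ord1; move: j; apply: forall_I3; rewrite !pt3E/=.
  - exact: ratball_triangle h1 re b1.
  - exact: ratball_triangle h2 re b2.
  - exact: ratball_triangle h3 re b3.
do 4![apply: bigcupT_measurable_rat => ?]; case: ifP => // _.
by apply: measurableX; [apply: measurableX|]; exact: measurable_ratball.
Qed.

Lemma closed_pt2_measurable (U : set 'rV[R]_2) : closed U ->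
  measurable (pt2 @^-1` U : set (mR * mR)).
Proof.
move=> cU; rewrite -[U]setCK -preimage_setC; apply: measurableC.
by apply: open_pt2_measurable; exact: closed_openC.
Qed.

Lemma closed_pt3_measurable (U : set 'rV[R]_3) : closed U ->
  measurable (pt3 @^-1` U : set (mR * mR * mR)).
Proof.
move=> cU; rewrite -[U]setCK -preimage_setC; apply: measurableC.
by apply: open_pt3_measurable; exact: closed_openC.
Qed.

Lemma continuous_pt2_measurable (f : 'rV[R]_2 -> R) (D : set (mR * mR)) :
  continuous f -> measurable_fun D (f \o pt2 : mR * mR -> mR).
Proof.
move=> cf; apply: (@measurable_funS _ _ _ _ setT) => //.
apply: (measurability _ (RGenOpens.measurableE R)).
move=> _ [_ [a [b ->] <-]]; rewrite setTI comp_preimage.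
by apply: open_pt2_measurable; apply: open_comp => [x _|]; [exact: cf|exact: interval_open].
Qed.

Lemma continuous_pt3_measurable (f : 'rV[R]_3 -> R) (D : set (mR * mR * mR)) :
  continuous f -> measurable_fun D (f \o pt3 : mR * mR * mR -> mR).
Proof.
move=> cf; apply: (@measurable_funS _ _ _ _ setT) => //.
apply: (measurability _ (RGenOpens.measurableE R)).
move=> _ [_ [a [b ->] <-]]; rewrite setTI comp_preimage.
by apply: open_pt3_measurable; apply: open_comp => [x _|]; [exact: cf|exact: interval_open].
Qed.

End MeasurableCoordinates.


Section NullSets.
Context {dp : measure_display} {T : measurableType dp} {R : realType}.
Variable mu : {measure set T -> \bar R}.

Import HBNNSimple.

(* No measurability of f is required, as integrals of nonnegative functions are
   suprema of integrals of smaller simple functions. *)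
Lemma ge0_integral_null (D' D N : set T) (f : T -> \bar R) :
  measurable N -> mu N = 0%E -> D' `<=` D -> D `\` D' `<=` N ->
  (forall x, (0 <= f x)%E) ->
  (\int[mu]_(x in D) f x = \int[mu]_(x in D') f x)%E.
Proof.
move=> mN N0 D'D DN f0; apply/eqP; rewrite eq_le; apply/andP; split; last first.
  rewrite !ge0_integralE//; apply: ereal_sup_le => /= _ [h hf <-].
  exists h => //= x; rewrite (le_trans (hf x))//.
  rewrite /patch; case: ifPn => [/set_mem/D'D/mem_set ->//|_].
  by case: ifP.
rewrite !ge0_integralE//; apply: ge_ereal_sup => /= _ [h hf <-].
have mNC : measurable (~` N) by exact: measurableC.
apply: ereal_sup_ubound => /=; exists (proj_nnsfun h mNC) => [x|].
  rewrite -mrestrict /patch; case: ifPn => [/set_mem xN|_].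
    have := hf x; rewrite /patch; case: ifPn => [/set_mem Dx|xD].
      rewrite mem_set//; apply: contrapT => D'x; exact/xN/DN.
    by rewrite ifF//; apply/negbTE; apply: contra xD => /set_mem/D'D/mem_set.
  by case: ifP => // _; exact: f0.
rewrite -!integralT_nnsfun; apply: ae_eq_integral => //.
- exact/measurable_EFinP.
- exact/measurable_EFinP.
have hE x : ~ N x -> proj_nnsfun h mNC x = h x.
  by move=> xN; rewrite -mrestrict /patch mem_set.
by exists N; split=> // x; apply: contraPP => xN; apply => _; rewrite hE.
Qed.

Lemma integral_null (D' D N : set T) (f : T -> \bar R) :
  measurable N -> mu N = 0%E -> D' `<=` D -> D `\` D' `<=` N ->
  (\int[mu]_(x in D) f x = \int[mu]_(x in D') f x)%E.
Proof.
move=> mN N0 D'D DN; rewrite integralE [RHS]integralE.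
by congr (_ - _)%E; apply: (ge0_integral_null mN).
Qed.

End NullSets.

(* A measure on row vectors carried by a coordinate map p. *)
Section CoordinateIntegral.
Context {dp : measure_display} {T : measurableType dp} {R : realType} {n : nat}.
Variable mu : {measure set T -> \bar R}.
Variable p : T -> 'rV[R]_n.+1.
Hypothesis open_mp : forall U, open U -> measurable (p @^-1` U).
Hypothesis mu_bounded : forall U, bounded_set U -> measurable (p @^-1` U) ->
  (mu (p @^-1` U) < +oo)%E.
Hypothesis mu_open : forall U, open U -> U !=set0 -> (0 < mu (p @^-1` U))%E.
Hypothesis continuous_mp : forall f : 'rV[R]_n.+1 -> R, continuous f ->
  measurable_fun setT (f \o p).

Definition coordint (A : set 'rV[R]_n.+1) (f : 'rV[R]_n.+1 -> R) : R :=
  \int[mu]_(t in p @^-1` A) f (p t).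

Definition coordintegrable (A : set 'rV[R]_n.+1) (f : 'rV[R]_n.+1 -> R) : Prop :=
  measurable (p @^-1` A) /\ mu.-integrable (p @^-1` A) (EFin \o (f \o p)).

Lemma closed_mp U : closed U -> measurable (p @^-1` U).
Proof.
move=> cU; rewrite -[U]setCK -preimage_setC; apply: measurableC.
by apply: open_mp; exact: closed_openC.
Qed.

Lemma continuous_bounded_on (A : set 'rV[R]_n.+1) (f : 'rV[R]_n.+1 -> R) :
  bounded_set A -> continuous f -> exists M : R, forall x, A x -> `|f x| <= M.
Proof.
move=> [N [_ HN]] cf; pose B : set 'rV[R]_n.+1 := [set x | `|x| <= N + 1].
have cB : compact B.
  apply: bounded_closed_compact.
    by exists (N + 1); split=> [|M NM x /= xN]; [exact: num_real|exact/ltW/(le_lt_trans xN)].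
  rewrite (_ : B = (fun x => `|x|) @^-1` [set r | r <= N + 1])//.
  by apply: closed_comp => [x _|]; [exact: norm_continuous|exact: closed_le].
have /compact_bounded [M [_ HM]] : compact (f @` B).
  by apply: continuous_compact => //; exact: continuous_subspaceT.
exists (M + 1) => x Ax; apply: (HM (M + 1)); first by rewrite ltrDl.
by exists x => //=; apply: HN => //; rewrite ltrDl.
Qed.

Lemma coordintegrable_bounded (A : set 'rV[R]_n.+1) (f : 'rV[R]_n.+1 -> R) (M : R) :
  bounded_set A -> measurable (p @^-1` A) ->
  measurable_fun (p @^-1` A) (f \o p) -> (forall x, A x -> `|f x| <= M) ->
  coordintegrable A f.
Proof.
move=> bA mA mf fM; split=> //; apply: measurable_bounded_integrable => //.
  exact: mu_bounded.
exists M; split=> [|N MN t At]; first exact: num_real.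
by rewrite /= (le_trans (fM _ At))// ltW.
Qed.

Lemma coordintegrable_continuous (A : set 'rV[R]_n.+1) (f : 'rV[R]_n.+1 -> R) :
  bounded_set A -> measurable (p @^-1` A) -> continuous f -> coordintegrable A f.
Proof.
move=> bA mA cf; have [M fM] := continuous_bounded_on bA cf.
apply: (coordintegrable_bounded bA mA _ fM).
by apply: measurable_funTS; exact: continuous_mp.
Qed.

Lemma coordintegrableD A (f g : 'rV[R]_n.+1 -> R) : coordintegrable A f -> coordintegrable A g ->
  coordintegrable A (fun x => f x + g x).
Proof.
move=> [mA fi] [_ gi]; split=> //.
have := integrableD mA fi gi; apply: eq_integrable => // t _.
Qed.

Lemma coordintegrableZ A (c : R) f : coordintegrable A f ->
  coordintegrable A (fun x => c * f x).
Proof.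
move=> [mA fi]; split=> //.
by have := integrableZl mA c fi; apply: eq_integrable.
Qed.

Lemma coordintD A (f g : 'rV[R]_n.+1 -> R) : coordintegrable A f -> coordintegrable A g ->
  coordint A (fun x => f x + g x) = coordint A f + coordint A g.
Proof. by move=> [mA fi] [_ gi]; rewrite /coordint RintegralD. Qed.

Lemma coordintZ A (c : R) f : coordintegrable A f ->
  coordint A (fun x => c * f x) = c * coordint A f.
Proof. by move=> [mA fi]; rewrite /coordint RintegralZl. Qed.

Lemma coordintN A (f : 'rV[R]_n.+1 -> R) : coordintegrable A f ->
  coordint A (fun x => - f x) = - coordint A f.
Proof.
move=> fi; rewrite -mulN1r -coordintZ//; congr coordint.
by apply/funext => x; rewrite mulN1r.
Qed.

Lemma coordintB A (f g : 'rV[R]_n.+1 -> R) : coordintegrable A f -> coordintegrable A g ->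
  coordint A (fun x => f x - g x) = coordint A f - coordint A g.
Proof.
move=> fi gi; rewrite coordintD// ?coordintN//.
have := coordintegrableZ (-1) gi; congr coordintegrable.
by apply/funext => x; rewrite mulN1r.
Qed.

Lemma coordint0 A : coordint A (fun=> 0) = 0.
Proof. by rewrite /coordint /Rintegral integral0. Qed.

Lemma coordintegrable0 A : measurable (p @^-1` A) -> coordintegrable A (fun=> 0).
Proof. by move=> mA; split=> //; exact: integrable0. Qed.

Lemma coordint_sum A (I : Type) (s : seq I) (P : pred I) (f : I -> 'rV[R]_n.+1 -> R) :
  measurable (p @^-1` A) -> (forall i, P i -> coordintegrable A (f i)) ->
  coordintegrable A (fun x => \sum_(i <- s | P i) f i x) /\
  coordint A (fun x => \sum_(i <- s | P i) f i x) = \sum_(i <- s | P i) coordint A (f i).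
Proof.
move=> mA fi; elim: s => [|i s [IH1 IH2]].
  rewrite big_nil (_ : (fun _ => _) = fun=> 0); last first.
    by apply/funext => x; rewrite big_nil.
  by rewrite coordint0; split=> //; exact: coordintegrable0.
rewrite big_cons (_ : (fun _ => _) = fun x =>
  if P i then f i x + \sum_(i <- s | P i) f i x else \sum_(i <- s | P i) f i x).
  case Pi: (P i) => //; rewrite coordintD ?IH2//; last exact: fi.
  by split=> //; apply: coordintegrableD => //; exact: fi.
by apply/funext => x; rewrite big_cons.
Qed.

Lemma eq_coordint A (f g : 'rV[R]_n.+1 -> R) : (forall x, A x -> f x = g x) -> coordint A f = coordint A g.
Proof. by move=> fg; apply: eq_Rintegral => t /set_mem /fg. Qed.

Lemma coordint_ge0 A (f : 'rV[R]_n.+1 -> R) : (forall x, A x -> 0 <= f x) -> 0 <= coordint A f.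
Proof. by move=> f0; apply: Rintegral_ge0 => t; exact: f0. Qed.

Lemma coordint_null A A' N (f : 'rV[R]_n.+1 -> R) : measurable (p @^-1` N) -> mu (p @^-1` N) = 0%E ->
  A' `<=` A -> A `\` A' `<=` N -> coordint A f = coordint A' f.
Proof.
move=> mN N0 A'A AN; rewrite /coordint /Rintegral; congr fine.
by apply: (@integral_null _ _ _ mu _ _ (p @^-1` N)) => // t; [exact: A'A|exact: AN].
Qed.

Lemma coordint_eq0 A (f : 'rV[R]_n.+1 -> R) : bounded_set A -> measurable (p @^-1` A) -> continuous f ->
  (forall x, A x -> 0 <= f x) -> coordint A f = 0 ->
  forall x, interior A x -> f x = 0.
Proof.
move=> bA mA cf f0 If x Ax; apply/eqP; rewrite eq_le f0 ?andbT; last exact: interior_subset.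
rewrite leNgt; apply/negP => fx0.
have [_ fi] := coordintegrable_continuous bA mA cf.
pose U := interior A `&` f @^-1` `]f x / 2, +oo[.
have oU : open U.
  apply: openI; first exact: open_interior.
  by apply: open_comp => [z _|]; [exact: cf|exact: interval_open].
have Ux : U x by split=> //=; rewrite in_itv/= andbT ltr_pdivrMr// ltr_pMr// ltr1n.
have UA : U `<=` A by move=> z [/interior_subset].
have mU : measurable (p @^-1` U) by exact: open_mp.
have : (((f x / 2)%:E * mu (p @^-1` U)) <= \int[mu]_(t in p @^-1` A) (f (p t))%:E)%E.
  rewrite -integral_cst//.
  apply: (@le_trans _ _ (\int[mu]_(t in p @^-1` U) (f (p t))%:E)%E).
    apply: ge0_le_integral => //=.
    - by move=> t _; rewrite lee_fin divr_ge0// ltW.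
    - by apply/measurable_EFinP; apply: measurable_funTS; exact: continuous_mp.
    - by move=> t [_ /=]; rewrite in_itv/= andbT lee_fin => /ltW.
  apply: ge0_subset_integral => //.
  - by apply/measurable_EFinP; apply: measurable_funTS; exact: continuous_mp.
  - by move=> t At; rewrite lee_fin f0.
  - by move=> t; exact: UA.
rewrite -[(\int[mu]_(t in _) _)%E]fineK; last exact: integrable_fin_num.
rewrite [fine _]If leNgt => /negP; apply.
by rewrite mule_gt0 ?lte_fin ?divr_gt0//; apply: mu_open => //; exists x.
Qed.

End CoordinateIntegral.


Section LebesgueCoordinates.
Context {R : realType}.
Local Notation mR := (measurableTypeR R).
Local Notation lam := (@lebesgue_measure R).

Lemma leb2X (A B : set mR) : measurable A -> measurable B ->
  leb2 R (A `*` B) = (lam A * lam B)%E.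
Proof. exact: product_measure1E. Qed.

Lemma leb3X (A : set (mR * mR)) (B : set mR) : measurable A -> measurable B ->
  leb3 R (A `*` B) = (leb2 R A * lam B)%E.
Proof. exact: product_measure1E. Qed.

Lemma leb_cball_lty (M : R) : (lam (closed_ball (0%R : R) M) < +oo)%E.
Proof.
have [M0|M0] := leP 0 M; first by rewrite lebesgue_measure_closed_ball// ltry.
by rewrite closed_ball0 ?measure0// ltW.
Qed.

Lemma bounded_coords {n : nat} (U : set 'rV[R]_n.+1) : bounded_set U ->
  exists2 M : R, 0 < M & forall x, U x -> forall i, `|x 0 i| <= M.
Proof.
move=> [N [_ HN]]; exists (`|N| + 1) => [|x Ux i]; first by rewrite ltr_wpDl.
have := HN (`|N| + 1); rewrite (le_lt_trans (ler_norm _)) ?ltrDl// => /(_ isT _ Ux).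
apply: le_trans; rewrite [leRHS]/Num.norm/= mx_normrE.
by apply: (le_bigmax _ (fun ij => `|x ij.1 ij.2|) (0, i)).
Qed.

Lemma leb2_bounded (U : set 'rV[R]_2) : bounded_set U ->
  measurable (pt2 @^-1` U : set (mR * mR)) -> (leb2 R (pt2 @^-1` U) < +oo)%E.
Proof.
move=> /bounded_coords[M M0 UM] mU.
have mB : measurable (closed_ball (0%R : R) M : set mR) by exact: measurable_closed_ball.
apply: (@le_lt_trans _ _ (leb2 R (closed_ball (0%R : R) M `*` closed_ball (0%R : R) M))).
  apply: le_measure; rewrite ?inE//; first exact: measurableX.
  move=> t /UM tM; rewrite closed_ballE//; split=> /=; rewrite /closed_ball_/= sub0r normrN.
    by have := tM 0; rewrite pt2E.
  by have := tM 1; rewrite pt2E.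
by rewrite leb2X// lte_mul_pinfty ?leb_cball_lty// ge0_fin_numE ?leb_cball_lty.
Qed.

Lemma leb3_bounded (U : set 'rV[R]_3) : bounded_set U ->
  measurable (pt3 @^-1` U : set (mR * mR * mR)) -> (leb3 R (pt3 @^-1` U) < +oo)%E.
Proof.
move=> /bounded_coords[M M0 UM] mU.
have mB : measurable (closed_ball (0%R : R) M : set mR) by exact: measurable_closed_ball.
have B2 : (leb2 R (closed_ball (0%R : R) M `*` closed_ball (0%R : R) M) < +oo)%E.
  by rewrite leb2X// lte_mul_pinfty ?leb_cball_lty// ge0_fin_numE ?leb_cball_lty.
apply: (@le_lt_trans _ _ (leb3 R (closed_ball (0%R : R) M `*` closed_ball (0%R : R) M
    `*` closed_ball (0%R : R) M))).
  apply: le_measure; rewrite ?inE//; first by do 2?apply: measurableX.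
  move=> t /UM tM; rewrite closed_ballE//; do 2?split=> /=;
    rewrite /closed_ball_/= sub0r normrN.
  - by have := tM 0; rewrite pt3E.
  - by have := tM 1; rewrite pt3E.
  - by have := tM 2; rewrite pt3E.
rewrite leb3X//; last exact: measurableX.
by rewrite lte_mul_pinfty ?leb_cball_lty// ge0_fin_numE.
Qed.

Lemma leb_ball_gt0 (x e : R) : 0 < e -> (0 < lam (ball x e))%E.
Proof. by move=> e0; rewrite lebesgue_measure_ball ?ltW// lte_fin mulrn_wgt0. Qed.

Lemma leb2_open (U : set 'rV[R]_2) : open U -> U !=set0 ->
  (0 < leb2 R (pt2 @^-1` U))%E.
Proof.
move=> oU [x Ux]; have /nbhs_ballP[e /= e0 eU] := open_nbhs_nbhs (conj oU Ux).
have mB (y : R) : measurable (ball y e : set mR) by exact: measurable_ball.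
apply: (@lt_le_trans _ _ (leb2 R (ball (x 0 0) e `*` ball (x 0 1) e))).
  by rewrite leb2X// mule_gt0 ?leb_ball_gt0.
apply: le_measure; rewrite ?inE//; first exact: measurableX.
  exact: open_pt2_measurable.
move=> t [t1 t2]; apply: eU; split=> // i j; rewrite ord1.
by move: j; apply: forall_I2; rewrite pt2E.
Qed.

Lemma leb3_open (U : set 'rV[R]_3) : open U -> U !=set0 ->
  (0 < leb3 R (pt3 @^-1` U))%E.
Proof.
move=> oU [x Ux]; have /nbhs_ballP[e /= e0 eU] := open_nbhs_nbhs (conj oU Ux).
have mB (y : R) : measurable (ball y e : set mR) by exact: measurable_ball.
apply: (@lt_le_trans _ _ (leb3 R (ball (x 0 0) e `*` ball (x 0 1) e `*` ball (x 0 2) e))).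
  by rewrite leb3X// ?leb2X// ?mule_gt0 ?leb_ball_gt0//; exact: measurableX.
apply: le_measure; rewrite ?inE//; first by do 2?apply: measurableX.
  exact: open_pt3_measurable.
move=> t [[t1 t2] t3]; apply: eU; split=> // i j; rewrite ord1.
by move: j; apply: forall_I3; rewrite pt3E.
Qed.

Definition integ2 := @coordintegrable _ (mR * mR)%type R 1 (leb2 R) pt2.
Definition integ3 := @coordintegrable _ (mR * mR * mR)%type R 2 (leb3 R) pt3.

Lemma integ2_continuous A (f : 'rV[R]_2 -> R) : bounded_set A ->
  measurable (pt2 @^-1` A : set (mR * mR)) -> continuous f -> integ2 A f.
Proof.
apply: coordintegrable_continuous; first exact: leb2_bounded.
by move=> g; exact: continuous_pt2_measurable.
Qed.

Lemma integ3_continuous A (f : 'rV[R]_3 -> R) : bounded_set A ->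
  measurable (pt3 @^-1` A : set (mR * mR * mR)) -> continuous f -> integ3 A f.
Proof.
apply: coordintegrable_continuous; first exact: leb3_bounded.
by move=> g; exact: continuous_pt3_measurable.
Qed.

Lemma int2_eq0 A (f : 'rV[R]_2 -> R) : bounded_set A ->
  measurable (pt2 @^-1` A : set (mR * mR)) -> continuous f ->
  (forall x, A x -> 0 <= f x) -> int2 A f = 0 -> forall x, interior A x -> f x = 0.
Proof.
apply: coordint_eq0.
- exact: open_pt2_measurable.
- exact: leb2_bounded.
- exact: leb2_open.
- by move=> g; exact: continuous_pt2_measurable.
Qed.

Lemma int3_eq0 A (f : 'rV[R]_3 -> R) : bounded_set A ->
  measurable (pt3 @^-1` A : set (mR * mR * mR)) -> continuous f ->
  (forall x, A x -> 0 <= f x) -> int3 A f = 0 -> forall x, interior A x -> f x = 0.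
Proof.
apply: coordint_eq0.
- exact: open_pt3_measurable.
- exact: leb3_bounded.
- exact: leb3_open.
- by move=> g; exact: continuous_pt3_measurable.
Qed.

Section Null.

Lemma Ppoly_dot {n : nat} (m : 'rV[R]_n) : Ppoly 1 (fun x => dot m x).
Proof. by apply: Ppoly_sum => i _; apply: PpolyZ; exact: Ppoly_coord. Qed.

Lemma continuous_dot {n : nat} (m : 'rV[R]_n.+1) : continuous (dot m).
Proof. exact: Ppoly_continuous (Ppoly_dot m). Qed.

Lemma closed_plane {n : nat} (m : 'rV[R]_n.+1) c : closed [set x | dot m x = c].
Proof.
apply: (@closed_comp _ _ (dot m) [set c]) => [x _|]; first exact: continuous_dot.
exact: closed_eq.
Qed.

Lemma leb2_line_null (a b c : R) : (a != 0) || (b != 0) ->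
  measurable ([set t | a * t.1 + b * t.2 = c] : set (mR * mR)) /\
  leb2 R [set t | a * t.1 + b * t.2 = c] = 0%E.
Proof.
move=> ab0; set L := [set t | _].
have mL : measurable (L : set (mR * mR)).
  rewrite (_ : L = pt2 @^-1` [set y | dot (pt2 (a, b)) y = c]); last first.
    by apply/seteqP; split=> t /=; rewrite /dot sum_I2 !pt2E.
  by apply: closed_pt2_measurable; exact: closed_plane.
split=> //; have [b0|b0] := eqVneq b 0; last first.
  transitivity (\int[lam]_x (fun=> 0%E : \bar R) x)%E; last exact: integral0.
  apply: eq_integral => x _ /=.
  rewrite (_ : xsection L x = [set (c - a * x) / b]) ?lebesgue_measure_set1//.
  apply/seteqP; split=> [y /xsectionP /= <-|y /= ->].
    by rewrite addrAC subrr add0r mulrC mulKf.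
  apply/xsectionP; rewrite /L/=. by field.
have {ab0} a0 : a != 0 by move: ab0; rewrite b0 eqxx orbF.
rewrite (_ : L = [set c / a] `*` setT) ?leb2X ?lebesgue_measure_set1 ?mul0e//.
apply/seteqP; split=> [[t1 t2] /=|[t1 t2] [/= -> _]]; rewrite /L/= b0 mul0r addr0.
  by move=> <-; rewrite mulrC mulKf.
by field.
Qed.

Lemma leb3_plane_null (n : 'rV[R]_3) (c : R) : n != 0 ->
  measurable (pt3 @^-1` [set x | dot n x = c] : set (mR * mR * mR)) /\
  leb3 R (pt3 @^-1` [set x | dot n x = c]) = 0%E.
Proof.
move=> n0; set L := [set x | _].
have mL : measurable (pt3 @^-1` L : set (mR * mR * mR)).
  by apply: closed_pt3_measurable; exact: closed_plane.
split=> //; have [b0|b0] := eqVneq (n 0 2) 0; last first.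
  transitivity (\int[leb2 R]_x (fun=> 0%E : \bar R) x)%E; last exact: integral0.
  apply: eq_integral => x _ /=.
  rewrite (_ : xsection _ x = [set (c - n 0 0 * x.1 - n 0 1 * x.2) / n 0 2]).
    by rewrite lebesgue_measure_set1.
  apply/seteqP; split=> [y /xsectionP|y /= ->].
    by rewrite /L/= dot_I3 !pt3E/= => <-; field.
  by apply/xsectionP; rewrite /L/= dot_I3 !pt3E/=; field.
have ab0 : (n 0 0 != 0) || (n 0 1 != 0).
  apply: contraNT n0; rewrite negb_or !negbK => /andP[/eqP a /eqP b].
  by apply/eqP; apply: rV3P; rewrite mxE.
have [mM M0] := leb2_line_null c ab0.
rewrite (_ : pt3 @^-1` L = [set t | n 0 0 * t.1 + n 0 1 * t.2 = c] `*` setT).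
  by rewrite leb3X// M0 mul0e.
by apply/seteqP; split=> [t|t [/= h _]]; rewrite /L/= dot_I3 !pt3E b0 mul0r addr0.
Qed.

End Null.

End LebesgueCoordinates.


Section ChangeOfVariables.
Context {R : realType}.
Local Notation mR := (measurableTypeR R).
Local Notation lam := (@lebesgue_measure R).

Lemma measurable_affine (a b : R) : measurable_fun setT (fun s : mR => a * s + b : mR).
Proof.
by apply: measurable_funD; [exact: measurable_funM|exact: measurable_cst].
Qed.

Lemma affine_preimage_measure (a b : R) : a != 0 -> forall A : set mR, measurable A ->
  lam A = (`|a|%:E * lam ((fun s : mR => (a * s + b)%R) @^-1` A))%E.
Proof.
move=> a0.
pose m0 : {measure set mR -> \bar R} :=
  measure_function_pushforward__canonical__measure_function_Measure lam
    (measurable_affine a b).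
pose m : {measure set mR -> \bar R} := mscale (NngNum (normr_ge0 a)) m0.
move=> A mA; transitivity (m A) => //; move: A mA.
apply: lebesgue_measure_unique => _ [[x y]] _ <-.
rewrite [RHS](_ : _ = (`|a|%:E * lam ((fun s : mR => (a * s + b)%R) @^-1` `]x, y]))%E)//.
rewrite [[set` _]]/=.
have [a_gt0|a_lt0|/eqP] := ltgtP a 0; last by rewrite (negbTE a0).
  rewrite (_ : _ @^-1` _ = `[(y - b) / a, (x - b) / a[%classic); last first.
    apply/funext => s; rewrite /preimage/= !in_itv/=.
    by rewrite ler_ndivrMr// ltr_ndivlMr// lerBrDr ltrBlDr [s * a]mulrC andbC.
  rewrite !lebesgue_measure_itv/= !lte_fin ltr_ndivrMr// divfK// ltrBlDr subrK.
  case: ifP => _; last by rewrite mule0.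
  by rewrite ltr0_norm// -!EFinB -EFinM; congr EFin; field.
rewrite (_ : _ @^-1` _ = `](x - b) / a, (y - b) / a]%classic); last first.
  apply/funext => s; rewrite /preimage/= !in_itv/=.
  by rewrite ler_pdivlMr// ltr_pdivrMr// lerBrDr ltrBlDr [s * a]mulrC.
rewrite !lebesgue_measure_itv/= !lte_fin ltr_pdivrMr// divfK// ltrBlDr subrK.
case: ifP => _; last by rewrite mule0.
by rewrite gtr0_norm// -!EFinB -EFinM; congr EFin; field.
Qed.

Lemma affine_integral1 (a b : R) (f : mR -> \bar R) : a != 0 ->
  measurable_fun setT f -> (forall x, 0 <= f x)%E ->
  (`|a|%:E * \int[lam]_s f (a * s + b)%R = \int[lam]_s f s)%E.
Proof.
move=> a0 mf f0.
pose m0 : {measure set mR -> \bar R} :=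
  measure_function_pushforward__canonical__measure_function_Measure lam
    (measurable_affine a b).
transitivity (`|a|%:E * \int[m0]_s f s)%E.
  by rewrite (ge0_integral_pushforward (measurable_affine a b) lam measurableT mf)// preimage_setT.
rewrite -(ge0_integral_mscale _ _ (NngNum (normr_ge0 a)))//.
apply/esym/eq_measure_integral => A mA _.
exact: affine_preimage_measure.
Qed.

Lemma leb2_tonelli (f : mR * mR -> \bar R) : measurable_fun setT f ->
  (forall t, 0 <= f t)%E ->
  (\int[leb2 R]_t f t = \int[lam]_x \int[lam]_y f (x, y))%E.
Proof. by move=> mf f0; exact: (@fubini_tonelli1 _ _ mR mR R lam lam). Qed.

Lemma leb_swap (f : mR * mR -> \bar R) : measurable_fun setT f ->
  (forall t, 0 <= f t)%E ->
  (\int[lam]_x \int[lam]_y f (x, y) = \int[lam]_y \int[lam]_x f (x, y))%E.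
Proof. by move=> mf f0; exact: (@fubini_tonelli _ _ mR mR R lam lam). Qed.

Lemma leb2_sigma_finite : sigma_finite setT (leb2 R).
Proof.
pose B (n : nat) : set mR := closed_ball (0%R : R) n%:R.
have mB n : measurable (B n) by exact: measurable_closed_ball.
exists (fun n => B n `*` B n) => [|n]; last first.
  split; first exact: measurableX.
  by rewrite leb2X// lte_mul_pinfty ?leb_cball_lty// ge0_fin_numE ?leb_cball_lty.
apply/esym/seteqP; split=> // t _.
exists (Num.truncn (Num.max `|t.1| `|t.2|)).+1 => //.
have lt u : u <= Num.max `|t.1| `|t.2| ->
    u <= (Num.truncn (Num.max `|t.1| `|t.2|)).+1%:R.
  by move=> /le_trans; apply; apply/ltW/truncnS_gt.
split; rewrite /= /B closed_ballE ?ltr0n// /closed_ball_/= sub0r normrN;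
  by apply: lt; rewrite le_max lexx ?orbT.
Qed.

(* The library instance of sigma-finite products is shadowed by the one for
   subprobabilities. *)
Definition leb2_fun : set (mR * mR)%type -> \bar R := leb2 R.
HB.instance Definition _ := measure_function.Measure.copy leb2_fun (leb2 R).
HB.instance Definition _ :=
  @Measure_isSigmaFinite.Build _ _ _ leb2_fun leb2_sigma_finite.
Definition leb2_sf : {sigma_finite_measure set (mR * mR)%type -> \bar R} := leb2_fun.

Lemma leb3_tonelli (f : mR * mR * mR -> \bar R) : measurable_fun setT f ->
  (forall t, 0 <= f t)%E ->
  (\int[leb3 R]_t f t = \int[leb2 R]_x \int[lam]_z f (x, z))%E.
Proof. by move=> mf f0; exact: (@fubini_tonelli1 _ _ _ _ R leb2_sf lam). Qed.

Lemma leb3_tonelli3 (f : mR * mR * mR -> \bar R) : measurable_fun setT f ->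
  (forall t, 0 <= f t)%E ->
  (\int[leb3 R]_t f t = \int[lam]_x \int[lam]_y \int[lam]_z f ((x, y), z))%E.
Proof.
move=> mf f0; rewrite leb3_tonelli// (leb2_tonelli (f := fun x => \int[lam]_z f (x, z))%E)//.
  exact: measurable_fun_fubini_tonelli_F.
by move=> t; apply: integral_ge0.
Qed.

Lemma measurable_coords (a b e : R) :
  measurable_fun setT (fun t : mR * mR => a * t.1 + b * t.2 + e : mR).
Proof.
apply: measurable_funD; last exact: measurable_cst.
apply: measurable_funD; apply: measurable_funM; try exact: measurable_cst.
  exact: measurable_fst.
exact: measurable_snd.
Qed.

Lemma affine_ge0_integral2 (a b c d e g : R) (f : mR * mR -> \bar R) :
  a * d - b * c != 0 -> measurable_fun setT f -> (forall t, 0 <= f t)%E ->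
  (`|a * d - b * c|%:E *
     \int[leb2 R]_t f ((a * t.1 + b * t.2 + e)%R, (c * t.1 + d * t.2 + g)%R)
   = \int[leb2 R]_t f t)%E.
Proof.
move=> det0 mf f0.
have mf2 (a' b' e' c' d' g' : R) : measurable_fun setT (fun t : mR * mR =>
    f ((a' * t.1 + b' * t.2 + e')%R, (c' * t.1 + d' * t.2 + g')%R)).
  apply: measurableT_comp => //.
  by apply: measurable_fun_pair; exact: measurable_coords.
have mf1 (u v w z : R) : measurable_fun setT (fun s : mR => f (u * s + v, w * s + z)%R).
  apply: measurableT_comp => //.
  by apply: measurable_fun_pair; exact: measurable_affine.
have int0 (h : mR -> mR * mR) : (0 <= \int[lam]_s f (h s))%E by exact: integral_ge0.
have m0 (r : R) x y : (0 <= x)%E -> (0 <= y)%E ->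
    (r%:E * (x * y) = (r%:E * x) * y)%E by rewrite muleA.
have [a0|a0] := eqVneq a 0; last first.
  rewrite (leb2_tonelli (mf2 a b e c d g))// (leb2_tonelli mf)//.
  rewrite (leb_swap (mf2 a b e c d g))//=.
  pose h (s y : R) := f (s, c * ((s - b * y - e) / a) + d * y + g)%R.
  have step1 y : (\int[lam]_x f (a * x + b * y + e, c * x + d * y + g)%R =
      `|a^-1|%:E * \int[lam]_s h s y)%E.
    have mhy : measurable_fun setT (fun s : mR => h s y).
      have -> : (fun s : mR => h s y) = fun s : mR => f (1 * s + 0,
          (c / a) * s + (d * y + g - c * (b * y + e) / a))%R.
        by apply/funext => s; rewrite /h; congr (f (_, _)); [rewrite mul1r addr0|field].
      exact: mf1.
    rewrite -(@affine_integral1 a (b * y + e) (fun s => h s y))//; last first.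
      by move=> s; exact: f0.
    rewrite muleA -EFinM -normrM mulVf// normr1 mul1e.
    apply: eq_integral => x _; rewrite /h addrA; congr (f (_, _)).
    by congr (_ + _ + _); congr (_ * _); field.
  under eq_integral do rewrite step1.
  have mh : measurable_fun setT (fun t : mR * mR => h t.1 t.2).
    have -> : (fun t : mR * mR => h t.1 t.2) = fun t : mR * mR => f (1 * t.1 + 0 * t.2 + 0,
        (c / a) * t.1 + (d - c * b / a) * t.2 + (g - c * e / a))%R.
      apply/funext => t; rewrite /h; congr (f (_, _)); last by field.
      by rewrite mul1r mul0r !addr0.
    exact: mf2.
  rewrite ge0_integralZl//; first last.
    by move=> y _; exact: int0.
    by apply: (@measurable_fun_fubini_tonelli_G _ _ mR mR R lam _ mh) => t; exact: f0.
  have mh' : measurable_fun setT (fun t : mR * mR => h t.2 t.1) :=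
    measurableT_comp mh (measurable_fun_pair measurable_snd measurable_fst).
  rewrite (leb_swap mh'); last by move=> t; exact: f0.
  have detE : a * d - b * c = a * (d - c * b / a) by field.
  have det1 : d - c * b / a != 0.
    by apply: contra_neq det0 => h0; rewrite detE h0 mulr0.
  have step2 s : (\int[lam]_y h s y = `|(d - c * b / a)^-1|%:E * \int[lam]_y f (s, y))%E.
    rewrite -(@affine_integral1 (d - c * b / a) (c * ((s - e) / a) + g) (fun y => f (s, y)))//; last first.
      exact: measurable_fun_pair2.
    rewrite muleA -EFinM -normrM mulVf// normr1 mul1e.
    by apply: eq_integral => y _; rewrite /h; congr (f (_, _)); field.
  under eq_integral do rewrite step2.
  rewrite ge0_integralZl//; last exact: (@measurable_fun_fubini_tonelli_F _ _ mR mR R lam _ mf f0).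
  rewrite !muleA -!EFinM -!normrM (_ : _ * _ = 1) ?normr1 ?mul1e//.
  by rewrite detE mulrAC mulfK// mulfV.
have b0 : b != 0 by apply: contra_neq det0 => ->; rewrite a0; ring.
have c0 : c != 0 by apply: contra_neq det0 => ->; rewrite a0; ring.
rewrite (leb2_tonelli (mf2 a b e c d g))// (leb2_tonelli mf)//.
pose h (x s : R) := f (s, c * x + d * ((s - e) / b) + g)%R.
have step1 x : (\int[lam]_y f (a * x + b * y + e, c * x + d * y + g)%R =
    `|b^-1|%:E * \int[lam]_s h x s)%E.
  have mhx : measurable_fun setT (h x : mR -> _).
    have -> : h x = fun s : mR => f (1 * s + 0,
        (d / b) * s + (c * x + g - d * e / b))%R.
      by apply/funext => s; rewrite /h; congr (f (_, _)); [rewrite mul1r addr0|field].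
    exact: mf1.
  rewrite -(@affine_integral1 b e (h x))//; last first.
    by move=> s; exact: f0.
  rewrite muleA -EFinM -normrM mulVf// normr1 mul1e.
  apply: eq_integral => y _; rewrite /h a0; congr (f (_, _)); first by ring.
  by congr (_ + _ + _); congr (_ * _); field.
under eq_integral do rewrite step1.
have mh : measurable_fun setT (fun t : mR * mR => h t.1 t.2).
  have -> : (fun t : mR * mR => h t.1 t.2) = fun t : mR * mR => f (0 * t.1 + 1 * t.2 + 0,
      c * t.1 + (d / b) * t.2 + (g - d * e / b))%R.
    apply/funext => t; rewrite /h; congr (f (_, _)); last by field.
    by rewrite mul1r mul0r addr0 add0r.
  exact: mf2.
rewrite ge0_integralZl//; first last.
  by move=> x _; exact: int0.
  by apply: (@measurable_fun_fubini_tonelli_F _ _ mR mR R lam _ mh) => t; exact: f0.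
rewrite (leb_swap mh); last by move=> t; exact: f0.
have step2 s : (\int[lam]_x h x s = `|c^-1|%:E * \int[lam]_y f (s, y))%E.
  rewrite -(@affine_integral1 c (d * ((s - e) / b) + g) (fun y => f (s, y)))//; last first.
    exact: measurable_fun_pair2.
  rewrite muleA -EFinM -normrM mulVf// normr1 mul1e.
  by apply: eq_integral => y _; rewrite /h addrA.
under eq_integral do rewrite step2.
rewrite ge0_integralZl//; last exact: (@measurable_fun_fubini_tonelli_F _ _ mR mR R lam _ mf f0).
rewrite !muleA -!EFinM -!normrM (_ : _ * _ = - 1) ?normrN1 ?mul1e//.
by rewrite a0 mul0r sub0r !mulNr mulrAC mulfK// mulfV.
Qed.

Lemma rotate_ge0_integral3 (f : mR * mR * mR -> \bar R) :
  measurable_fun setT f -> (forall t, 0 <= f t)%E ->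
  (\int[leb3 R]_t f ((t.1.2, t.2), t.1.1) = \int[leb3 R]_t f t)%E.
Proof.
move=> mf f0.
have mrot : measurable_fun setT (fun t : mR * mR * mR => f ((t.1.2, t.2), t.1.1)).
  apply: measurableT_comp => //; apply: measurable_fun_pair; first apply: measurable_fun_pair.
  - by apply: measurableT_comp; [exact: measurable_snd|exact: measurable_fst].
  - exact: measurable_snd.
  - by apply: measurableT_comp; [exact: measurable_fst|exact: measurable_fst].
have mg : measurable_fun setT (fun t : mR * mR => \int[lam]_z f ((t.2, z), t.1))%E.
  by apply: (@measurable_fun_fubini_tonelli_F _ _ (mR * mR)%type mR R lam _ mrot) => t; exact: f0.
have mh (y : mR) : measurable_fun setT (fun t : mR * mR => f ((y, t.2), t.1)).
  apply: measurableT_comp => //; apply: measurable_fun_pair; last exact: measurable_fst.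
  by apply: measurable_fun_pair; [exact: measurable_cst|exact: measurable_snd].
apply: etrans (leb3_tonelli3 mrot (fun t => f0 _)) _.
apply: esym; apply: etrans (leb3_tonelli3 mf f0) _; apply: esym.
apply: etrans (leb_swap mg _) _ => [t|]; first exact: integral_ge0.
apply: eq_integral => y _; exact: (leb_swap (mh y) (fun t => f0 _)).
Qed.

End ChangeOfVariables.


Section Crossings.
Context {R : realType}.

Lemma locally_constant (D : R -> R) : (forall t, \forall t' \near t, D t' = D t) ->
  forall a b, D a = D b.
Proof.
move=> loc a b; apply: is_derive_0_is_cst => t.
apply: near_eq_is_derive (is_derive_cst (D t) t 1).
by apply: filterS (loc t) => t' ->.
Qed.

Lemma near_side (z t : R) : z != t ->
  \forall t' \near t, t' != z /\ (t' < z) = (t < z).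
Proof.
rewrite neq_lt => /orP[zt|tz].
  have : nbhs t [set x | z < x] by apply: open_nbhs_nbhs; split=> //; exact: open_gt.
  by apply: filterS => t' /= zt'; rewrite gt_eqF// (lt_gtF zt) (lt_gtF zt').
have : nbhs t [set x | x < z] by apply: open_nbhs_nbhs; split=> //; exact: open_lt.
by apply: filterS => t' /= tz'; rewrite lt_eqF// tz tz'.
Qed.

(* Along a line, membership in a set changes only at finitely many crossings,
   where s tells whether the line leaves (1) or enters (-1) the set. *)
Lemma count_crossings (I : finType) (P : pred I) (z s : I -> R) (k : R -> Prop) :
  (forall i, P i -> s i = 1 \/ s i = -1) ->
  (forall i j, P i -> P j -> z i = z j -> i = j) ->
  (forall i, P i -> \forall t \near z i,
     (s i * (t - z i) < 0 -> k t) /\ (0 < s i * (t - z i) -> ~ k t)) ->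
  (forall t : R, (forall i, P i -> z i != t) -> \forall t' \near t, k t' <-> k t) ->
  (exists M, forall t, M < t -> ~ k t) ->
  forall t : R, (forall i, P i -> z i != t) ->
    (`[< k t >])%:R = \sum_(i | P i) s i * (t < z i)%R%:R.
Proof.
move=> s1 zinj kz knz [M kM] t0 t0z.
pose kap (t : R) : R := if [pick i | P i && (z i == t)] is Some i then (s i == -1)%R%:R
                  else (`[< k t >])%:R.
have kapN (t : R) : (forall i, P i -> z i != t) -> kap t = (`[< k t >])%:R.
  by rewrite /kap => zt; case: pickP => // i /andP[/zt /negbTE ->].
have kapE i : P i -> kap (z i) = (s i == -1)%R%:R.
  rewrite /kap => Pi; case: pickP => [j /andP[Pj /eqP]|/(_ i)]; last by rewrite Pi eqxx.
  by move/zinj => ->.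
pose D (t : R) : R := \sum_(i | P i) s i * (t < z i)%R%:R - kap t.
have loc (t : R) : \forall t' \near t, D t' = D t.
  have side : \forall t' \near t, forall i, z i != t -> t' != z i /\ (t' < z i) = (t < z i).
    have side1 (i : I) : \forall t' \near t, z i != t -> t' != z i /\ (t' < z i) = (t < z i).
      have [->|zit] := eqVneq (z i) t; first exact: (@filterE _ (nbhs t) (nbhs_filter t)).
      by apply: filterS (near_side zit) => t' h _.
    exact: (@filter_forall R I _ (nbhs t) (nbhs_filter t) side1).
  have [[i [Pi zi]]|nz] := pselect (exists i, P i /\ z i = t); last first.
    have zt i : P i -> z i != t.
      by move=> Pi; apply/eqP => zit; apply: nz; exists i.
    apply: filterS2 side (knz t zt) => t' sd kk.
    rewrite /D (kapN t zt) kapN; last by move=> i /zt /sd[+ _]; rewrite eq_sym.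
    congr (_ - _).
      by apply: eq_bigr => i /zt /sd[_ ->].
    by rewrite (propext kk).
  have zt j : P j -> j != i -> z j != t.
    by move=> Pj; apply: contra_neq => zjt; apply: zinj; rewrite ?zi.
  have kzi := kz i Pi; rewrite zi in kzi; apply: filterS2 side kzi => t' sd [kl kr].
  have [->//|t't] := eqVneq t' t.
  have kapt : kap t = (s i == -1)%R%:R by rewrite -zi kapE.
  rewrite /D !(bigD1 i Pi)/= zi ltxx mulr0 add0r kapt kapN; last first.
    move=> j Pj; have [->|ji] := eqVneq j i; first by rewrite zi eq_sym.
    by have [+ _] := sd _ (zt j Pj ji); rewrite eq_sym.
  have -> : \sum_(j | P j && (j != i)) s j * (t' < z j)%R%:R =
            \sum_(j | P j && (j != i)) s j * (t < z j)%R%:R.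
    by apply: eq_bigr => j /andP[Pj ji]; have [_ ->] := sd _ (zt j Pj ji).
  suff -> : (`[< k t' >])%:R = s i * (t' < t)%R%:R + (s i == -1)%R%:R :> R by ring.
  have m11 : (1 == -1 :> R) = false.
    by apply: gt_eqF; lra.
  move: t't; rewrite neq_lt => /orP[t't|tt'].
    rewrite t't mulr1; have [si|si] := s1 i Pi; rewrite si ?eqxx ?m11.
      by rewrite asboolT ?addr0//; apply: kl; rewrite si mul1r subr_lt0.
    by rewrite asboolF ?addNr//; apply: kr; rewrite si mulN1r oppr_gt0 subr_lt0.
  rewrite (lt_gtF tt') mulr0 add0r; have [si|si] := s1 i Pi; rewrite si ?eqxx ?m11.
    by rewrite asboolF//; apply: kr; rewrite si mul1r subr_gt0.
  by rewrite asboolT//; apply: kl; rewrite si mulN1r oppr_lt0 subr_gt0.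
pose T := Num.max M (\big[Num.max/M]_(i | P i) z i) + 1.
have Tz i : P i -> z i < T.
  move=> Pi; rewrite /T (le_lt_trans _ (ltr_pwDr ltr01 (lexx _)))// le_max.
  by rewrite (le_bigmax_cond _ z Pi) orbT.
have MT : M < T.
  by rewrite /T (le_lt_trans _ (ltr_pwDr ltr01 (lexx _)))// le_max lexx.
have DT : D T = 0.
  rewrite /D big1 => [|i /Tz /lt_gtF ->]; last by rewrite mulr0.
  rewrite kapN => [|i /Tz /lt_eqF ->//].
  by rewrite asboolF ?subr0//; exact: kM.
have := locally_constant loc t0 T; rewrite DT => /eqP.
by rewrite subr_eq0 => /eqP ->; rewrite kapN.
Qed.

End Crossings.


Section LineIntegral.
Context {R : realType}.
Local Notation mR := (measurableTypeR R).
Local Notation lam := (@lebesgue_measure R).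

Lemma integral_derivative (a b : R) (g g' : R -> R) : a <= b ->
  (forall t : R, is_derive t (1 : R) g (g' t)) -> continuous g' ->
  (\int[lam]_(t in `[a, b]) (g' t)%:E = (g b - g a)%:E)%E.
Proof.
move=> ab gd cg'; have cg : continuous g.
  move=> t; apply: differentiable_continuous; apply/derivable1_diffP.
  by have [] := gd t.
move: ab; rewrite le_eqVlt => /predU1P[->|ab].
  by rewrite set_itv1 integral_set1 subrr.
rewrite EFinB; apply: continuous_FTC2 => //.
- exact: continuous_subspaceT.
- split.
  + by move=> t _; have [] := gd t.
  + exact/cvg_at_right_filter/cg.
  + exact/cvg_at_left_filter/cg.
- by move=> t _; rewrite derive1E; have [_ ->] := gd t.
Qed.

Lemma line_integral (I : finType) (P : pred I) (z s : I -> R) (k : R -> Prop)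
    (g g' : R -> R) (M : R) :
  (forall t : R, is_derive t (1 : R) g (g' t)) -> continuous g' ->
  (forall t : R, (forall i, P i -> z i != t) ->
    (`[< k t >])%:R = \sum_(i | P i) s i * (t < z i)%R%:R) ->
  (forall i, P i -> - M < z i) -> (forall t, k t -> - M < t) ->
  measurable ([set t | k t] : set mR) ->
  (\int[lam]_(t in [set t | k t]) (g' t)%:E = (\sum_(i | P i) s i * g (z i))%:E)%E.
Proof.
move=> gd cg' count zM kM mk.
have mg' : measurable_fun setT (g' : mR -> mR) by exact: continuous_measurable_fun.
pose Iv (i : I) : set mR := `[- M, z i]%classic.
have ints i : P i -> lam.-integrable (Iv i) (EFin \o g').
  move=> Pi; apply: continuous_compact_integrable; first exact: segment_compact.
  exact: continuous_subspaceT.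
pose F (i : I) : R -> \bar R := if P i then ((fun t => (s i * g' t)%:E) \_ (Iv i)) else cst 0%E.
have intF i : lam.-integrable setT (F i).
  rewrite /F; case: ifPn => Pi; last exact: integrable0.
  have mI : measurable (Iv i) by exact: measurable_itv.
  have h : lam.-integrable (Iv i) (fun t => (s i * g' t)%:E).
    have := integrableZl mI (s i) (ints i Pi).
    by apply: (@eq_integrable _ _ _ lam _ mI).
  exact: ((integrable_mkcond _ mI).1 h).
have IF i : P i -> (\int[lam]_t F i t = (s i * g (z i) - s i * g (- M))%:E)%E.
  move=> Pi; rewrite /F Pi -integral_mkcond.
  transitivity ((s i)%:E * \int[lam]_(t in (Iv i)) (g' t)%:E)%E.
    by rewrite -integralZl//; [exact: measurable_itv|exact: ints].
  by rewrite (integral_derivative _ gd cg') ?ltW ?zM// -EFinM mulrBr.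
rewrite integral_mkcond.
transitivity (\int[lam]_t (\sum_i F i t))%E.
  apply: ae_eq_integral => //.
  - apply/(measurable_restrictT _ _).1 => //.
    by apply/measurable_EFinP; exact: measurable_funTS.
  - by apply: emeasurable_sum => i; have /measurable_int := intF i.
  have cz : countable (z @` [set` P]).
    by apply: finite_set_countable; exact: finite_image.
  exists (z @` [set` P]); split.
  - by apply: countable_measurable => // r; exact: measurable_set1.
  - exact: countable_lebesgue_measure0.
  move=> t /=; apply: contra_notP => nt _.
  have zt i : P i -> z i != t.
    by move=> Pi; apply/eqP => zit; apply: nt; exists i.
  have -> : (\sum_i F i t = \sum_(i | P i) ((fun t => (s i * g' t)%:E) \_ (Iv i)) t)%E.
    by rewrite [RHS]big_mkcond; apply: eq_bigr => i _; rewrite /F; case: (P i).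
  rewrite /patch.
  have [tM|tM] := leP (- M) t; last first.
    rewrite big1 => [|i Pi].
      by rewrite memNset// => /kM; rewrite ltNge ltW.
    by rewrite memNset// /Iv/= in_itv/= leNgt tM.
  have kE : (if t \in [set t | k t] then (g' t)%:E else 0%E) = ((`[< k t >])%:R * g' t)%:E.
    case: ifPn => [/set_mem kt|]; first by rewrite asboolT// mul1r.
    by move=> /negP kt; rewrite asboolF ?mul0r// => kt'; apply: kt; exact: mem_set.
  rewrite kE count// mulr_suml -sumEFin; apply: eq_bigr => i Pi.
  have -> : (t \in Iv i) = (t < z i).
    apply/idP/idP => [/set_mem|tz]; last first.
      by apply/mem_set; rewrite /Iv/= in_itv/= tM ltW.
    by rewrite /Iv/= in_itv/= tM/= le_eqVlt eq_sym (negbTE (zt i Pi)).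
  by case: (t < z i); rewrite ?mulr1// mulr0 mul0r.
rewrite integral_sum//.
have -> : (\sum_i \int[lam]_t F i t = \sum_(i | P i) \int[lam]_t F i t)%E.
  rewrite [RHS]big_mkcond; apply: eq_bigr => i _; case: ifPn => // Pi.
  by rewrite /F (negbTE Pi) integral0.
rewrite (eq_bigr _ IF) sumEFin sumrB -mulr_suml.
have -> : \sum_(i | P i) s i = 0; last by rewrite mul0r subr0.
have := count (- M); rewrite asboolF; last by move=> /kM; rewrite ltxx.
move=> /(_ (fun i Pi => negbT (gt_eqF (zM i Pi)))) /= h; apply: etrans (esym h).
by apply: eq_bigr => i Pi; rewrite zM// mulr1.
Qed.

End LineIntegral.


Section AffinePlane.
Context {R : realType}.
Local Notation mR := (measurableTypeR R).

Definition affine2 (a b c d e g : R) (t : mR * mR) : mR * mR :=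
  (a * t.1 + b * t.2 + e, c * t.1 + d * t.2 + g).

Lemma measurable_affine2 (a b c d e g : R) :
  measurable_fun setT (affine2 a b c d e g).
Proof. by apply: measurable_fun_pair; exact: measurable_coords. Qed.

Lemma affine2_null (a b c d e g : R) (N : set (mR * mR)) :
  a * d - b * c != 0 -> measurable N -> leb2 R N = 0%E ->
  measurable (affine2 a b c d e g @^-1` N) /\
  leb2 R (affine2 a b c d e g @^-1` N) = 0%E.
Proof.
move=> det0 mN N0.
have mS : measurable (affine2 a b c d e g @^-1` N).
  by rewrite -[_ @^-1` _]setTI; exact: measurable_affine2.
split=> //; have mI : measurable_fun setT (EFin \o \1_N : mR * mR -> \bar R).
  by apply/measurable_EFinP; exact: measurable_indic.
have I0 t : (0 <= (EFin \o \1_N : mR * mR -> \bar R) t)%E by rewrite lee_fin indicE; case: (_ \in _).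
have := affine_ge0_integral2 e g det0 mI I0.
rewrite [RHS]integral_indic// setIT N0.
have -> : (\int[leb2 R]_t (EFin \o \1_N) ((a * t.1 + b * t.2 + e)%R, (c * t.1 + d * t.2 + g)%R)
    = leb2 R (affine2 a b c d e g @^-1` N))%E.
  by rewrite -[X in leb2 R X]setIT -integral_indic.
by move/eqP; rewrite mule_eq0 eqe normr_eq0 (negbTE det0)/= => /eqP.
Qed.

Lemma affine_integral2 (a b c d e g : R) (h : mR * mR -> R) :
  a * d - b * c != 0 -> (leb2 R).-integrable setT (EFin \o h) ->
  (leb2 R).-integrable setT (EFin \o (h \o affine2 a b c d e g)) /\
  (\int[leb2 R]_t (h (affine2 a b c d e g t))%:E =
   `|a * d - b * c|^-1%:E * \int[leb2 R]_t (h t)%:E)%E.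
Proof.
move=> det0 hi; set S := affine2 a b c d e g; set k := `|_|.
have k0 : k != 0 by rewrite normr_eq0.
have mh : measurable_fun setT (EFin \o h : mR * mR -> \bar R) by exact: measurable_int hi.
have mhS : measurable_fun setT (EFin \o (h \o S) : mR * mR -> \bar R).
  by apply: (measurableT_comp mh); exact: measurable_affine2.
have inv (f : mR * mR -> \bar R) : measurable_fun setT f -> (forall t, 0 <= f t)%E ->
    (\int[leb2 R]_t f (S t) = k^-1%:E * \int[leb2 R]_t f t)%E.
  move=> mf f0; rewrite -(affine_ge0_integral2 e g det0 mf f0) muleA -EFinM.
  by rewrite mulVf// mul1e.
have hSi : (leb2 R).-integrable setT (EFin \o (h \o S)).
  apply/integrableP; split=> //.
  have -> : (\int[leb2 R]_t `|(EFin \o (h \o S)) t| =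
      k^-1%:E * \int[leb2 R]_t `|(EFin \o h) t|)%E.
    by rewrite -inv//; exact: measurableT_comp.
  have /integrableP[_ hoo] := hi.
  by rewrite lte_mul_pinfty// lee_fin invr_ge0 normr_ge0.
split=> //; rewrite integralE [in RHS]integralE muleBr//.
  have Hp := inv _ (measurable_funepos mh) (fun t => funepos_ge0 _ t).
  have Hn := inv _ (measurable_funeneg mh) (fun t => funeneg_ge0 _ t).
  rewrite -Hp -Hn; congr (_ - _)%E; apply: eq_integral => t _.
    by rewrite !funeposE.
  by rewrite !funenegE.
by apply: fin_num_adde_defr; exact: integrable_pos_fin_num.
Qed.

End AffinePlane.

Section Faces.
Context {R : realType}.

Record facetted (K : set 'rV[R]_3) (J : finType) (o : J -> 'rV[R]_3)
    (A : J -> 'M[R]_(2, 3)) (U : J -> set 'rV[R]_2) (n : J -> 'rV[R]_3) : Prop :=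
  Facetted {
    fct_bounded : bounded_set K;
    fct_closed : closed K;
    fct_boundary : forall x, boundary K x ->
      exists j, exists2 y, U j y & x = o j + y *m A j;
    fct_sub : forall j y, U j y -> K (o j + y *m A j);
    fct_Ubounded : forall j, bounded_set (U j);
    fct_Uclosed : forall j, closed (U j);
    fct_lines : forall j, exists (m : nat) (a : 'I_m -> 'rV[R]_2) (b : 'I_m -> R),
      (forall i, a i != 0) /\
      forall y, U j y -> ~ interior (U j) y -> exists i, dot (a i) y = b i;
    fct_frame : forall j, A j *m (A j)^T = 1%:M;
    fct_disj : forall i j y y', i != j -> interior (U i) y -> U j y' ->
      o i + y *m A i != o j + y' *m A j;
    fct_normal : forall j, n j = cross (row 0 (A j)) (row 1 (A j)) \/
                           n j = - cross (row 0 (A j)) (row 1 (A j));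
    fct_side : forall j y, interior (U j) y -> \forall x \near (o j + y *m A j),
      (dot (x - (o j + y *m A j)) (n j) < 0 -> K x) /\
      (0 < dot (x - (o j + y *m A j)) (n j) -> ~ K x)
  }.

Section FaceProjection.
Variables (o : 'rV[R]_3) (A : 'M[R]_(2, 3)).
Let D := cross (row 0 A) (row 1 A) 0 2.
Hypothesis D0 : D != 0.

(* The planar coordinates of the point of the plane of the face that lies over a
   point of the first coordinate plane. *)
Definition face_over : R * R -> R * R :=
  affine2 (A 1 1 / D) (- A 1 0 / D) (- A 0 1 / D) (A 0 0 / D)
    ((o 0 1 * A 1 0 - o 0 0 * A 1 1) / D) ((o 0 0 * A 0 1 - o 0 1 * A 0 0) / D).

Lemma face_DE : D = A 0 0 * A 1 1 - A 0 1 * A 1 0.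
Proof. by rewrite /D crossE !mxE. Qed.

Lemma face_det : A 1 1 / D * (A 0 0 / D) - - A 1 0 / D * (- A 0 1 / D) = D^-1.
Proof.
rewrite (_ : _ - _ = (A 0 0 * A 1 1 - A 0 1 * A 1 0) / D ^+ 2); last by field.
by rewrite -face_DE; field.
Qed.

Lemma face_det_neq0 : A 1 1 / D * (A 0 0 / D) - - A 1 0 / D * (- A 0 1 / D) != 0.
Proof. by rewrite face_det invr_neq0. Qed.

Lemma chart_coord (y : 'rV[R]_2) i :
  (o + y *m A) 0 i = o 0 i + (y 0 0 * A 0 i + y 0 1 * A 1 i).
Proof. by rewrite !mxE sum_I2. Qed.

Lemma face_overK x : ((o + pt2 (face_over x) *m A) 0 0 = x.1) *
                     ((o + pt2 (face_over x) *m A) 0 1 = x.2).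
Proof.
rewrite !chart_coord !pt2E /face_over /affine2/=.
split.
  rewrite (_ : _ + _ = o 0 0 + ((x.1 - o 0 0) * (A 0 0 * A 1 1 - A 0 1 * A 1 0)) / D).
    by rewrite -face_DE mulfK// subrKC.
  by field.
rewrite (_ : _ + _ = o 0 1 + ((x.2 - o 0 1) * (A 0 0 * A 1 1 - A 0 1 * A 1 0)) / D).
  by rewrite -face_DE mulfK// subrKC.
by field.
Qed.

Lemma face_over_chart (y : 'rV[R]_2) :
  pt2 (face_over ((o + y *m A) 0 0, (o + y *m A) 0 1)) = y.
Proof.
apply/rowP; apply: forall_I2; rewrite pt2E /face_over /affine2/= !chart_coord.
  rewrite (_ : _ + _ = (y 0 0 * (A 0 0 * A 1 1 - A 0 1 * A 1 0)) / D).
    by rewrite -face_DE mulfK.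
  by field.
rewrite (_ : _ + _ = (y 0 1 * (A 0 0 * A 1 1 - A 0 1 * A 1 0)) / D).
  by rewrite -face_DE mulfK.
by field.
Qed.

Lemma face_over_integral (U : set 'rV[R]_2) (f : 'rV[R]_2 -> R) :
  bounded_set U -> closed U -> continuous f ->
  let h x := if pt2 (face_over x) \in U then f (pt2 (face_over x)) else 0 in
  (leb2 R).-integrable setT (EFin \o h) /\
  (\int[leb2 R]_x (h x)%:E = (`|D| * int2 U f)%:E)%E.
Proof.
move=> bU cU cf h; have mU := closed_pt2_measurable cU.
have [_ fi] := integ2_continuous bU mU cf.
have /(integrable_mkcond _ mU) fi' := fi.
pose h0 t := if pt2 t \in U then f (pt2 t) else 0.
have h0E : EFin \o h0 = ((EFin \o (f \o pt2)) \_ (pt2 @^-1` U)).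
  apply/funext => t; rewrite /h0 /patch/=.
  have -> : (t \in pt2 @^-1` U) = (pt2 t \in U) by apply/idP/idP; rewrite !inE.
  by case: ifP.
have h0i : (leb2 R).-integrable setT (EFin \o h0) by rewrite h0E.
have [hi hE] := affine_integral2 ((o 0 1 * A 1 0 - o 0 0 * A 1 1) / D)
  ((o 0 0 * A 0 1 - o 0 1 * A 0 0) / D) face_det_neq0 h0i.
split; first exact: hi.
apply: etrans hE _; rewrite face_det normfV invrK EFinM; congr (_ * _)%E.
rewrite (_ : (fun t => _) = EFin \o h0)// h0E -integral_mkcond.
by rewrite /int2 /Rintegral fineK//; exact: integrable_fin_num.
Qed.

End FaceProjection.

Lemma continuous_rV {T : topologicalType} {d : nat} (a : T -> 'rV[R]_d) :
  (forall i, continuous (fun x => a x 0 i)) -> continuous a.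
Proof.
move=> ca x B [P Pa PB].
have : \forall y \near x, forall i, P 0 i (a y 0 i).
  by apply: filter_forall => i; exact: ca (Pa 0 i).
by apply: filterS => y Py; apply: PB => i j; rewrite ord1.
Qed.

Lemma Ppoly_affine {d e : nat} (o : 'rV[R]_e) (M : 'M[R]_(d, e)) i :
  Ppoly 1 (fun y => (o + y *m M) 0 i).
Proof.
rewrite (_ : (fun _ => _) = fun y : 'rV_d => o 0 i + \sum_j y 0 j * M j i); last first.
  by apply/funext => y; rewrite !mxE.
by apply: Ppoly_step => j; exact: Ppoly_cst.
Qed.

Lemma continuous_affine {d e : nat} (o : 'rV[R]_e) (M : 'M[R]_(d.+1, e)) :
  continuous (fun y : 'rV[R]_d.+1 => o + y *m M).
Proof.
by apply: continuous_rV => i; exact: Ppoly_continuous (Ppoly_affine o M i).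
Qed.

Lemma derivable_line {d : nat} (f : 'rV[R]_d.+1 -> R) (p : R -> 'rV[R]_d.+1) v (t : R) :
  (forall a b, p (a + b) = a *: v + p b) ->
  differentiable f (p t) -> is_derive t (1 : R) (f \o p) ('D_v f (p t)).
Proof.
move=> pl df.
have E : (fun h : R => h^-1 *: (((f \o p) \o shift t) (h *: 1) - (f \o p) t)) =
         (fun h : R => h^-1 *: ((f \o shift (p t)) (h *: v) - f (p t))).
  by apply/funext => h; rewrite /= [h *: 1]mulr1 pl.
have dv : derivable f (p t) v by exact: diff_derivable.
apply: DeriveDef; first by rewrite /derivable E.
by rewrite /derive E.
Qed.

End Faces.


Section VerticalSlices.
Context {R : realType}.
Local Notation mR := (measurableTypeR R).
Local Notation lam := (@lebesgue_measure R).
Variables (K : set 'rV[R]_3) (J : finType) (o : J -> 'rV[R]_3)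
  (A : J -> 'M[R]_(2, 3)) (U : J -> set 'rV[R]_2) (n : J -> 'rV[R]_3).
Hypothesis fK : facetted K o A U n.
Variable f : 'rV[R]_3 -> R.
Hypothesis df : forall x, differentiable f x.
Hypothesis cpf : continuous (partial 2 f).

Let ch j y := o j + y *m A j.
Let D j := cross (row 0 (A j)) (row 1 (A j)) 0 2.
Let over j (x : R * R) : 'rV[R]_2 := pt2 (face_over (o j) (A j) x).

Lemma normal_vertical j : (n j 0 2 == 0) = (D j == 0).
Proof.
by have [->|->] := fct_normal fK j; rewrite // mxE oppr_eq0.
Qed.

Lemma normal_D j : Num.sg (n j 0 2) * `|D j| = n j 0 2.
Proof.
have -> : `|D j| = `|n j 0 2|.
  by have [->|->] := fct_normal fK j; rewrite // [in RHS]mxE normrN.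
by rewrite -numEsg.
Qed.

Lemma normal_neq0 j : n j != 0.
Proof.
have u1 := frame_normal_unit (fct_frame fK j).
have n1 : dot (n j) (n j) = 1.
  by have [->|->] := fct_normal fK j; rewrite // dotNl dotNr opprK.
by apply/eqP => n0; move/eqP: n1; rewrite n0 dot0l eq_sym oner_eq0.
Qed.

Lemma dot_normal_chart j y : dot (n j) (ch j y) = dot (n j) (o j).
Proof.
have h := mulmx_frame_normal (A j) y.
by rewrite /ch dotDr; have [->|->] := fct_normal fK j;
  rewrite ?dotNl [dot _ (y *m _)]dotC h ?oppr0 addr0.
Qed.

(* The base points over which the vertical line misses the boundaries of the
   faces and the faces that are vertical. *)
Definition generic_base (x : R * R) : Prop :=
  (forall j, D j != 0 -> U j (over j x) -> interior (U j) (over j x)) /\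
  (forall j, D j == 0 -> n j 0 0 * x.1 + n j 0 1 * x.2 != dot (n j) (o j)).

Lemma ae_generic_base : {ae leb2 R, forall x, generic_base x}.
Proof.
have FF : Filter (almost_everywhere (leb2 R)) by exact: ae_filter_ringOfSetsType.
have ae1 j : {ae leb2 R, forall x, D j != 0 -> U j (over j x) -> interior (U j) (over j x)}.
  have [D0|D0] := eqVneq (D j) 0; first exact: (@filterE _ _ FF).
  have [m [a [b [a0 lU]]]] := fct_lines fK j.
  have aei i : {ae leb2 R, forall x, dot (a i) (over j x) != b i}.
    have ai : (a i 0 0 != 0) || (a i 0 1 != 0).
      apply: contraNT (a0 i); rewrite negb_or !negbK => /andP[/eqP a1 /eqP a2].
      by apply/eqP/rowP; apply: forall_I2; rewrite mxE.
    have [mL L0] := leb2_line_null (b i) ai.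
    have [mS S0] := affine2_null ((o j 0 1 * A j 1 0 - o j 0 0 * A j 1 1) / D j)
      ((o j 0 0 * A j 0 1 - o j 0 1 * A j 0 0) / D j) (face_det_neq0 D0) mL L0.
    exists (face_over (o j) (A j) @^-1` [set t | a i 0 0 * t.1 + a i 0 1 * t.2 = b i]).
    split; [exact: mS|exact: S0|].
    move=> x /negP; rewrite negbK => /eqP.
    by rewrite /over /dot sum_I2 !pt2E.
  have := @filter_forall _ _ _ _ FF aei; apply: (@filterS _ _ FF) => x aex _ Ux.
  apply: contrapT => /(lU _ Ux)[i /eqP]; apply/negP; exact: aex.
have ae2 j : {ae leb2 R, forall x, D j == 0 ->
    n j 0 0 * x.1 + n j 0 1 * x.2 != dot (n j) (o j)}.
  have [D0|D0] := boolP (D j == 0); last exact: (@filterE _ _ FF).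
  have n01 : (n j 0 0 != 0) || (n j 0 1 != 0).
    move: D0; rewrite -normal_vertical => /eqP n2.
    apply: contraNT (normal_neq0 j); rewrite negb_or !negbK => /andP[/eqP a1 /eqP a2].
    by apply/eqP; apply: rV3P; rewrite mxE.
  have [mL L0] := leb2_line_null (dot (n j) (o j)) n01.
  exists [set t | n j 0 0 * t.1 + n j 0 1 * t.2 = dot (n j) (o j)]; split=> // x /=.
  by apply: contra_notP => h _; apply/eqP.
have := @filterI _ _ FF _ _ (@filter_forall _ _ _ _ FF ae1) (@filter_forall _ _ _ _ FF ae2).
by apply: (@filterS _ _ FF) => x [].
Qed.

Lemma slice_integral (x : R * R) : generic_base x ->
  (\int[lam]_(z in [set z | K (pt3 (x, z))]) (partial 2 f (pt3 (x, z)))%:E =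
   (\sum_(j | (D j != 0) && (over j x \in U j))
      Num.sg (n j 0 2) * f (ch j (over j x)))%:E)%E.
Proof.
move=> [gU gD]; pose l z : 'rV[R]_3 := pt3 (x, z).
have lD a b : l (a + b) = a *: delta_mx 0 2 + l b.
  by apply: rV3P; rewrite !(mxE, pt3E)/=; rewrite ?mulr0 ?mulr1 ?add0r.
have cl : continuous l.
  move=> t; rewrite (_ : l = fun z => z *: delta_mx 0 2 + l 0).
    apply: cvgD; last exact: cvg_cst.
    exact: scalel_continuous.
  by apply/funext => z; rewrite -{1}[z]addr0 lD.
pose P j := (D j != 0) && (over j x \in U j).
pose z j := ch j (over j x) 0 2.
have lz j : P j -> l (z j) = ch j (over j x).
  move=> /andP[D0 _]; apply: rV3P; rewrite pt3E//=.
    by rewrite /ch (face_overK _ D0).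
  by rewrite /ch (face_overK _ D0).
have PU j : P j -> U j (over j x) by move=> /andP[_ /set_mem].
have PI j : P j -> interior (U j) (over j x).
  by move=> Pj; apply: gU => //; [case/andP: Pj|exact: PU].
have [M M0 KM] := bounded_coords (fct_bounded fK).
have kM t : K (l t) -> `|t| <= M by move=> /KM/(_ 2); rewrite pt3E.
have -> : (\sum_(j | P j) Num.sg (n j 0 2) * f (ch j (over j x))) =
          \sum_(j | P j) Num.sg (n j 0 2) * (f \o l) (z j).
  by apply: eq_bigr => j Pj; rewrite /= lz.
apply: (@line_integral _ J P z (fun j => Num.sg (n j 0 2)) (fun t => K (l t))
  (f \o l) (fun t => partial 2 f (l t)) (M + 1)).
- move=> t; exact: derivable_line.
- by move=> t; apply: continuous_comp; [exact: cl|exact: cpf].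
- apply: count_crossings.
  + move=> j /andP[]; rewrite -normal_vertical => n0 _.
    by case: sgrP n0 => [//|_ _|_ _]; [left|right].
  + move=> i j Pi Pj zij; apply/eqP; apply: contraT => ij.
    have := fct_disj fK ij (PI i Pi) (PU j Pj).
    by rewrite -/(ch i _) -/(ch j _) -!lz// zij eqxx.
  + move=> j Pj.
    have n2 : n j 0 2 != 0 by rewrite normal_vertical; case/andP: Pj.
    have := fct_side fK (PI j Pj); rewrite -/(ch j _) -(lz j Pj) => /(cl (z j)).
    apply: (@filterS _ _ (nbhs_filter (z j))) => t [h1 h2].
    have E : dot (l t - l (z j)) (n j) = Num.sg (n j 0 2) * (t - z j) * `|n j 0 2|.
      rewrite -{1}(subrK (z j) t) lD addrK dotZl dotC dot_delta.
      by rewrite {1}[n j 0 2]numEsg; ring.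
    split=> h; [apply: h1|apply: h2]; rewrite E.
      by rewrite nmulr_rlt0// normr_gt0.
    by rewrite mulr_gt0// normr_gt0.
  + move=> t tz.
    have nb : ~ boundary K (l t).
      move=> /(fct_boundary fK)[j [y Uy ly]].
      have [D0|D0] := eqVneq (D j) 0.
        have := gD j; rewrite D0 eqxx => /(_ isT) /eqP; apply.
        rewrite -(dot_normal_chart j y) /ch -ly dot_I3 !pt3E.
        have /eqP -> : n j 0 2 == 0 by rewrite normal_vertical D0.
        by rewrite mul0r addr0.
      have yE : y = over j x.
        rewrite -[y](face_over_chart (o j) D0) -ly !pt3E.
        by case: (x).
      have Pj : P j by rewrite /P D0 -yE mem_set.
      have := tz j Pj; rewrite /z -yE /ch -ly pt3E.
      by rewrite eqxx.
    have [Kl|Kl] := pselect (closure K (l t)).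
      have /(cl t) : nbhs (l t) (interior K).
        apply: open_nbhs_nbhs; split; first exact: open_interior.
        by apply: contrapT => iK; apply: nb.
      apply: (@filterS _ _ (nbhs_filter t)) => t' /interior_subset Kt'; split=> // _.
      by rewrite ((closure_id K).1 (fct_closed fK)).
    have /(cl t) : nbhs (l t) (~` closure K).
      by apply: open_nbhs_nbhs; split=> //; apply: closed_openC; exact: closed_closure.
    apply: (@filterS _ _ (nbhs_filter t)) => t' nKt'.
    by split=> /subset_closure Kt'; [case: (nKt' Kt')|case: (Kl Kt')].
  + by exists M => t Mt /kM; rewrite leNgt (lt_le_trans Mt)// ler_norm.
- move=> j Pj; have := fct_sub fK (PU j Pj); rewrite -/(ch j _) -lz// => /kM.
  by rewrite ler_norml => /andP[h _]; lra.
- by move=> t /kM; rewrite ler_norml => /andP[h _]; lra.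
- apply: closed_measurable; apply: (closed_comp (f := l)) => [t _|]; first exact: cl.
  exact: fct_closed fK.
Qed.

Lemma divergence_last :
  int3 K (partial 2 f) = \sum_j int2 (U j) (fun y => f (ch j y) * n j 0 2).
Proof.
have mK := closed_pt3_measurable (fct_closed fK).
have [_ fi] := integ3_continuous (fct_bounded fK) mK cpf.
have fin3 := integrable_fin_num mK fi.
have /(integrable_mkcond _ mK) fi' := fi.
have cf : continuous f by move=> x; apply: differentiable_continuous.
have cfch j : continuous (fun y => f (ch j y)).
  move=> y; apply: continuous_comp; last exact: cf.
  exact: continuous_affine.
pose T j x : R := if (D j != 0) && (over j x \in U j)
  then Num.sg (n j 0 2) * f (ch j (over j x)) else 0.
have TI j : (leb2 R).-integrable setT (EFin \o T j) /\
    (\int[leb2 R]_x (T j x)%:E = (int2 (U j) (fun y => f (ch j y) * n j 0 2))%:E)%E.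
  have [D0|D0] := eqVneq (D j) 0.
    have -> : T j = fun=> 0 by apply/funext => x; rewrite /T D0 eqxx.
    have /eqP n2 : n j 0 2 == 0 by rewrite normal_vertical D0.
    have -> : (fun y => f (ch j y) * n j 0 2) = fun=> 0.
      by apply/funext => y; rewrite n2 mulr0.
    split; first exact: integrable0.
    by rewrite integral0; congr EFin; exact/esym/(coordint0 (leb2 R) pt2 (U j)).
  have csg : continuous (fun y => Num.sg (n j 0 2) * f (ch j y)).
    move=> y; apply: (@continuous_comp _ _ _ (fun y => f (ch j y)) ( *%R _)).
      exact: cfch.
    exact: mulrl_continuous.
  have Uc : closed (U j) by exact: fct_Uclosed fK _.
  have [hi hE] := face_over_integral (o j) D0 (fct_Ubounded fK j) Uc csg.
  have TE : T j = fun x : R * R => if pt2 (face_over (o j) (A j) x) \in U j then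
      Num.sg (n j 0 2) * f (ch j (pt2 (face_over (o j) (A j) x))) else 0.
    by apply/funext => x; rewrite /T D0.
  rewrite TE; split; first exact: hi.
  apply: etrans hE _; congr EFin.
  have Ui g : continuous g -> integ2 (U j) g.
    apply: integ2_continuous; first exact: fct_Ubounded fK _.
    exact: closed_pt2_measurable Uc.
  have -> : (fun y => f (ch j y) * n j 0 2) =
      (fun y => `|D j| * (Num.sg (n j 0 2) * f (ch j y))).
    by apply/funext => y; rewrite mulrA [_ * Num.sg _]mulrC normal_D mulrC.
  exact/esym/(coordintZ _ (Ui _ csg)).
rewrite /int3 /Rintegral.
have -> : (\int[leb3 R]_(t in pt3 @^-1` K) (partial 2 f (pt3 t))%:E =
    \int[leb2 R]_x (\sum_j T j x)%:E)%E.
  rewrite integral_mkcond -[LHS](@integral12_prod_meas1 _ _ _ _ R (@leb2_sf R) lam _ fi').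
  apply: ae_eq_integral => //.
  - exact: (@measurable_fubini_F _ _ _ _ R (@leb2_sf R) lam _ fi').
  - apply/measurable_EFinP; apply: measurable_sum => j.
    by apply/measurable_EFinP; have /measurable_int := (TI j).1.
  have FF : Filter (almost_everywhere (leb2 R)) by exact: ae_filter_ringOfSetsType.
  apply: (@filterS _ _ FF _ _ _ ae_generic_base) => x gx _.
  rewrite /fubini_F.
  transitivity (\int[lam]_(z in [set z | K (pt3 (x, z))]) (partial 2 f (pt3 (x, z)))%:E)%E.
    rewrite [RHS]integral_mkcond; apply: eq_integral => z _.
    rewrite /patch/=.
    have -> : ((x, z) \in pt3 @^-1` K) = (z \in [set z | K (pt3 (x, z))]).
      by apply/idP/idP; rewrite !inE.
    by [].
  by rewrite (slice_integral gx) big_mkcond.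
have -> : (\int[leb2 R]_x (\sum_j T j x)%:E = \sum_j \int[leb2 R]_x (T j x)%:E)%E.
  rewrite -integral_sum//; last by move=> j; exact: (TI j).1.
  by apply: eq_integral => x _; rewrite sumEFin.
by rewrite (eq_bigr _ (fun j _ => (TI j).2)) sumEFin.
Qed.

End VerticalSlices.


Section CoordinateRotation.
Context {R : realType}.
Local Notation mR := (measurableTypeR R).

Definition rot_mx : 'M[R]_3 := \matrix_(i, j) (i == j + 1)%:R.
Definition rotV_mx : 'M[R]_3 := \matrix_(i, j) (i == j + 2)%:R.

Lemma rotE m (x : 'M[R]_(m, 3)) i j : (x *m rot_mx) i j = x i (j + 1).
Proof.
rewrite mxE (bigD1 (j + 1))//= big1 => [|k /negbTE kj]; rewrite mxE ?eqxx ?mulr1 ?addr0//.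
by rewrite kj mulr0.
Qed.

Lemma rotVE m (x : 'M[R]_(m, 3)) i j : (x *m rotV_mx) i j = x i (j + 2).
Proof.
rewrite mxE (bigD1 (j + 2))//= big1 => [|k /negbTE kj]; rewrite mxE ?eqxx ?mulr1 ?addr0//.
by rewrite kj mulr0.
Qed.

Lemma I3_addE : ((1 + 1 = 2 :> 'I_3) * (1 + 2 = 0 :> 'I_3)) *
  ((2 + 1 = 0 :> 'I_3) * (2 + 2 = 1 :> 'I_3)).
Proof. by do !split; exact: val_inj. Qed.

Lemma I3_addK (i : 'I_3) : i + 1 + 2 = i /\ i + 2 + 1 = i.
Proof.
by split; rewrite -addrA ?I3_addE ?addr0.
Qed.

Lemma rotVK m (x : 'M[R]_(m, 3)) : x *m rotV_mx *m rot_mx = x.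
Proof. by apply/matrixP => i j; rewrite rotE rotVE (I3_addK j).1. Qed.

Lemma cross_rotV (u v : 'rV[R]_3) :
  cross (u *m rotV_mx) (v *m rotV_mx) = cross u v *m rotV_mx.
Proof.
by apply: rV3P; rewrite rotVE !crossE !rotVE ?add0r ?I3_addE !crossE.
Qed.

Lemma dot_rot (u v : 'rV[R]_3) : dot (u *m rot_mx) (v *m rot_mx) = dot u v.
Proof. by rewrite !dot_I3 !rotE ?add0r ?I3_addE; ring. Qed.

Lemma continuous_rot : continuous (fun x : 'rV[R]_3 => x *m rot_mx).
Proof.
rewrite (_ : (fun _ => _) = fun x : 'rV[R]_3 => 0 + x *m rot_mx).
  exact: continuous_affine.
by apply/funext => x; rewrite add0r.
Qed.

Lemma int3_rot (K : set 'rV[R]_3) (f : 'rV[R]_3 -> R) : closed K -> continuous f ->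
  int3 ((fun x => x *m rot_mx) @^-1` K) (fun x => f (x *m rot_mx)) = int3 K f.
Proof.
move=> cK cf; rewrite /int3 /Rintegral; congr fine.
have rotpt (t : R * R * R) : pt3 t *m rot_mx = pt3 ((t.1.2, t.2), t.1.1).
  by apply: rV3P; rewrite rotE ?add0r ?I3_addE !pt3E.
pose H := (fun t => (f (pt3 t))%:E) \_ (pt3 @^-1` K).
have mH : measurable_fun setT (H : mR * mR * mR -> \bar R).
  apply/(measurable_restrictT _ _).1; first exact: closed_pt3_measurable.
  by apply/measurable_EFinP; exact: continuous_pt3_measurable.
rewrite [LHS]integral_mkcond [RHS]integral_mkcond -/H.
transitivity (\int[leb3 R]_t H ((t.1.2, t.2), t.1.1))%E.
  apply: eq_integral => t _; rewrite /H /patch/= rotpt.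
  have -> : (t \in pt3 @^-1` ((fun x => x *m rot_mx) @^-1` K)) =
      ((t.1.2, t.2, t.1.1) \in pt3 @^-1` K).
    by apply/idP/idP; rewrite !inE/= rotpt.
  by [].
rewrite [LHS]integralE [RHS]integralE; congr (_ - _)%E.
  rewrite -[RHS]rotate_ge0_integral3//; last exact: measurable_funepos.
  by apply: eq_integral => t _; rewrite !funeposE.
rewrite -[RHS]rotate_ge0_integral3//; last exact: measurable_funeneg.
by apply: eq_integral => t _; rewrite !funenegE.
Qed.

Lemma partial_rot (f : 'rV[R]_3 -> R) k x :
  partial k (fun z => f (z *m rot_mx)) x = partial (k + 2) f (x *m rot_mx).
Proof.
have dE : delta_mx 0 k *m rot_mx = delta_mx 0 (k + 2) :> 'rV[R]_3.
  apply/rowP => j; rewrite rotE !mxE !eqxx/=; congr ((_ : bool)%:R).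
  by apply/eqP/eqP => [<-|->]; rewrite ?(I3_addK j).1 ?(I3_addK k).2.
have E : (fun h : R => h^-1 *: (((fun z => f (z *m rot_mx)) \o shift x) (h *: delta_mx 0 k)
              - f (x *m rot_mx))) =
    (fun h : R => h^-1 *: ((f \o shift (x *m rot_mx)) (h *: delta_mx 0 (k + 2))
              - f (x *m rot_mx))).
  by apply/funext => h; rewrite /= mulmxDl -scalemxAl dE.
by rewrite /partial /derive E.
Qed.

Lemma facetted_rot (K : set 'rV[R]_3) (J : finType) (o : J -> 'rV[R]_3)
    (A : J -> 'M[R]_(2, 3)) (U : J -> set 'rV[R]_2) (n : J -> 'rV[R]_3) :
  facetted K o A U n ->
  facetted ((fun x => x *m rot_mx) @^-1` K) (fun j => o j *m rotV_mx)
    (fun j => A j *m rotV_mx) U (fun j => n j *m rotV_mx).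
Proof.
move=> fK.
have chE j y : (o j *m rotV_mx + y *m (A j *m rotV_mx)) *m rot_mx = o j + y *m A j.
  by rewrite mulmxDl mulmxA !rotVK.
have rotK (x : 'rV[R]_3) : x *m rot_mx *m rotV_mx = x.
  by apply/rowP => j; rewrite rotVE rotE (I3_addK j).2.
split.
- have [M M0 KM] := bounded_coords (fct_bounded fK).
  exists M; split=> [|N MN x Kx]; first exact: num_real.
  move=> /=.
  rewrite [leLHS]/Num.norm/= mx_normrE; apply/bigmax_leP; split=> [|[i j] _].
    by rewrite ltW// (lt_trans M0).
  rewrite /= ord1 (le_trans _ (ltW MN))//.
  by have := KM _ Kx (j + 2); rewrite rotE (I3_addK j).2.
- by apply: closed_comp => [x _|]; [exact: continuous_rot|exact: fct_closed fK].
- move=> x [cx ix].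
  have [j [y Uy xE]] : exists j, exists2 y, U j y & x *m rot_mx = o j + y *m A j.
    apply: (fct_boundary fK); split.
      move=> B /continuous_rot /cx[z [Kz Bz]].
      by exists (z *m rot_mx).
    move=> iK; apply: ix; have /continuous_rot : nbhs (x *m rot_mx) (interior K).
      by apply: open_nbhs_nbhs; split=> //; exact: open_interior.
    by apply: (@filterS _ _ (nbhs_filter x)) => z; exact: interior_subset.
  by exists j, y => //; rewrite -[x]rotK xE mulmxDl -mulmxA.
- by move=> j y Uy; rewrite /preimage/= chE; exact: (fct_sub fK).
- exact: fct_Ubounded fK.
- exact: fct_Uclosed fK.
- exact: fct_lines fK.
- move=> j; rewrite -(fct_frame fK j); apply/matrixP => i k.
  by rewrite mxE [RHS]mxE !sum_I3 ![_^T _ _]mxE !rotVE ?add0r ?I3_addE; ring.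
- move=> i j y y' ij Ui Uj; have := fct_disj fK ij Ui Uj.
  by apply: contra => /eqP e; rewrite -!chE e.
- move=> j; rewrite !row_mul cross_rotV.
  by have [->|->] := fct_normal fK j; [left|right; rewrite mulNmx].
- move=> j y Uy; have := fct_side fK Uy; rewrite -{1}chE => /continuous_rot H.
  apply: (@filterS _ _ (nbhs_filter _) _ _ _ H) => x [H1 H2]; rewrite /preimage/=.
  by rewrite -dot_rot mulmxBl rotVK chE.
Qed.

Lemma differentiable_rot (f : 'rV[R]_3 -> R) : (forall x, differentiable f x) ->
  forall x, differentiable (fun z => f (z *m rot_mx)) x.
Proof.
move=> df x; apply: (@differentiable_comp _ _ _ _ (mulmxr rot_mx) f) => //.
apply: linear_differentiable; exact: continuous_rot.
Qed.

(* The slicing argument in the last coordinate direction, transported to the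
   other directions by the cyclic permutation of the coordinates. *)
Theorem divergence_facetted (K : set 'rV[R]_3) (J : finType) (o : J -> 'rV[R]_3)
    (A : J -> 'M[R]_(2, 3)) (U : J -> set 'rV[R]_2) (n : J -> 'rV[R]_3)
    (f : 'rV[R]_3 -> R) (i : 'I_3) :
  facetted K o A U n -> (forall x, differentiable f x) -> continuous (partial i f) ->
  int3 K (partial i f) = \sum_j int2 (U j) (fun y => f (o j + y *m A j) * n j 0 i).
Proof.
pose P (i : 'I_3) := forall K (J : finType) (o : J -> 'rV[R]_3) A U n f,
  @facetted R K J o A U n -> (forall x, differentiable f x) -> continuous (partial i f) ->
  int3 K (partial i f) = \sum_j int2 (U j) (fun y => f (o j + y *m A j) * n j 0 i).
have step k : P k -> P (k + 2).
  move=> Pk {}K {}J {}o {}A {}U {}n {}f fK df cpf.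
  have := Pk _ _ _ _ _ _ _ (facetted_rot fK) (differentiable_rot df).
  have pE : partial k (fun z => f (z *m rot_mx)) = fun z => partial (k + 2) f (z *m rot_mx).
    by apply/funext => z; rewrite partial_rot.
  rewrite pE int3_rot//; last exact: fct_closed fK.
  move=> ->; last first.
    by move=> x; apply: continuous_comp; [exact: continuous_rot|exact: cpf].
  apply: eq_bigr => j _; congr int2; apply/funext => y.
  by rewrite mulmxDl mulmxA !rotVK rotVE.
have P2 : P 2 by move=> *; exact: divergence_last.
have P1 : P 1 by have := step _ P2; rewrite I3_addE.
have P0 : P 0 by have := step _ P1; rewrite I3_addE.
by move: i K J o A U n f; apply: forall_I3.
Qed.

End CoordinateRotation.



Section Polyhedra.
Context {R : realType}.

Lemma polyhedron_props {d : nat} (U : set 'rV[R]_d.+1) : polyhedron U ->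
  [/\ closed U, bounded_set U, connected (interior U), interior U !=set0
    & closure (interior U) = U].
Proof.
move=> [D [[oD cD nD bD iD] _] ->]; rewrite iD; split=> //.
  exact: closed_closure.
case: bD => M [Mr HM]; exists M; split=> // N MN x cx.
apply/ler_addgt0Pr => e e0.
have [y [Dy /= xy]] := cx _ (nbhsx_ballx x e e0).
have := HM _ MN y Dy; rewrite /=; move: xy; rewrite -ball_normE/= => xy yN.
rewrite -[x](subrK y) addrC (le_trans (ler_normD _ _))// lerD// ltW//.
Qed.

Lemma polyhedron_boundary {d : nat} (U : set 'rV[R]_d.+1) : polyhedron U ->
  exists (m : nat) (a : 'I_m -> 'rV[R]_d.+1) (b : 'I_m -> R),
    (forall i, a i != 0) /\
    forall y, U y -> ~ interior U y -> exists i, dot (a i) y = b i.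
Proof.
move=> [D [_ [m [P [cP DP]]]] ->].
pose k i := sval (cid (cP i)).
pose a i : 'I_(k i) -> 'rV[R]_d.+1 := sval (cid (svalP (cid (cP i)))).
pose b i : 'I_(k i) -> R := sval (cid (svalP (cid (svalP (cid (cP i)))))).
have Hb i : P i = [set x | forall j, dot (a i j) x <= b i j].
  exact: svalP (cid (svalP (cid (svalP (cid (cP i)))))).
clearbody b; clearbody a; clearbody k.
pose T : finType := {i : 'I_m & 'I_(k i)}.
pose c (t : T) := if a (tag t) (tagged t) == 0 then delta_mx 0 0 else a (tag t) (tagged t).
exists #|T|, (fun i => c (enum_val i)), (fun i => b _ (tagged (enum_val i))); split=> [i|y].
  rewrite /c; case: ifPn => // _; apply/eqP => /matrixP/(_ 0 0)/eqP.
  by rewrite !mxE !eqxx oner_eq0.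
rewrite DP => -[i _ Piy] niy; apply: contrapT => H; apply: niy.
have : nbhs y (P i).
  rewrite Hb; rewrite Hb/= in Piy.
  have : \forall x \near y, forall j, dot (a i j) x <= b i j.
    apply: (@filter_forall _ _ _ (nbhs y) (nbhs_filter y)) => j.
    have := Piy j; rewrite le_eqVlt => /orP[/eqP e|lt].
      have [a0|a0] := eqVneq (a i j) 0.
        apply: nearW => x; rewrite a0 dot0l.
        by move: e; rewrite a0 dot0l => <-.
      exfalso; apply: H; exists (enum_rank (Tagged (fun i => 'I_(k i)) j : T)).
      by rewrite enum_rankK /c/= (negbTE a0).
    have : nbhs y (dot (a i j) @^-1` [set z | z < b i j]).
      by apply: continuous_dot; apply: open_nbhs_nbhs; split=> //; exact: open_lt.
    by apply: (@filterS _ _ (nbhs_filter y)) => x /= /ltW.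
  by [].
by apply: (@filterS _ _ (nbhs_filter y)) => x Px; exists i.
Qed.

Lemma segment_in_closed {d : nat} (K : set 'rV[R]_d.+1) (a b : 'rV[R]_d.+1) :
  closed K ->
  (forall t, 0 <= t -> t <= 1 -> K (a + t *: (b - a)) -> interior K (a + t *: (b - a))) ->
  K a -> K b.
Proof.
move=> cK nb Ka.
pose c (t : R) := Num.min (Num.max t 0) 1.
have c0 : c 0 = 0 by rewrite /c maxxx min_l.
have c1 : c 1 = 1 by rewrite /c max_l// minxx.
have cc : continuous c.
  move=> t.
  have cm : {for t, continuous (fun t : R => Num.max t 0 : R^o)}.
    by apply: (@continuous_max R R (fun t => t) (fun=> 0) t); [exact: cvg_id|exact: cvg_cst].
  by apply: (@continuous_min R R (fun t => Num.max t 0) (fun=> 1) t cm); exact: cvg_cst.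
have c01 t : 0 <= c t /\ c t <= 1.
  by rewrite /c ge_min lexx orbT le_min ler01 le_max lexx orbT.
pose p t := a + c t *: (b - a).
have cp : continuous p.
  move=> t; apply: cvgD; first exact: cvg_cst.
  by apply: cvgZr_tmp; exact: cc.
pose D t : R := if `[< K (p t) >] then 1 else 0.
have locD t : \forall t' \near t, D t' = D t.
  rewrite /D; have [Kt|Kt] := asboolP (K (p t)).
    have : nbhs (p t) K by have [? ?] := c01 t; exact: nb.
    by move=> /cp; apply: (@filterS _ _ (nbhs_filter t)) => t' /= ?; rewrite asboolT.
  have : nbhs (p t) (~` K) by apply: open_nbhs_nbhs; split=> //; exact: closed_openC.
  by move=> /cp; apply: (@filterS _ _ (nbhs_filter t)) => t' /= ?; rewrite asboolF.
have := locally_constant locD 0 1; rewrite /D /p c0 c1 scale0r addr0 scale1r asboolT//.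
rewrite addrC subrK.
by have [//|_ /eqP] := asboolP (K b); rewrite oner_eq0.
Qed.

End Polyhedra.



Section FaceSides.
Context {R : realType} {Th : mesh R} {Omega : set 'rV[R]_3}.
Hypothesis conf : conforming_polyhedral Th Omega.
Local Notation cells := 'I_(ncell Th).
Local Notation faces := 'I_(nface Th).
Implicit Types (K : cells) (F : faces).

Lemma cell_polyhedron K : polyhedron (cell K).
Proof. by case: conf => -[]. Qed.

Lemma fdom_polyhedron F : polyhedron (fdom F).
Proof. by have [[_ _ _ /(_ F)[]]] := conf. Qed.

Lemma frameF F : frame F *m (frame F)^T = 1%:M.
Proof. by have [[_ _ _ /(_ F)[]]] := conf. Qed.

Lemma face_normal_unit F : dot (face_normal F) (face_normal F) = 1.
Proof. exact: (frame_normal_unit (frameF F)). Qed.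

Lemma chart_normal F y y' : dot (chart F y - chart F y') (face_normal F) = 0.
Proof.
rewrite /chart opprD addrACA subrr add0r -mulmxBl.
exact: (mulmx_frame_normal (frame F)).
Qed.

Lemma chart_project F x : dot (x - forig F) (face_normal F) = 0 ->
  chart F ((x - forig F) *m (frame F)^T) = x.
Proof.
by move=> /(frame_project (frameF F)); rewrite /chart => <-; rewrite addrC subrK.
Qed.

Lemma chartK F y : (chart F y - forig F) *m (frame F)^T = y.
Proof. by rewrite /chart addrC addKr mulmx_frameK// frameF. Qed.

Lemma continuous_chart F : continuous (chart F).
Proof. exact: continuous_affine. Qed.

Lemma closed_face F : closed (face F).
Proof.
have [cU _ _ _ _] := polyhedron_props (fdom_polyhedron F).
rewrite (_ : face F = [set x | dot (face_normal F) x = dot (face_normal F) (forig F)] `&`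
    (fun x => (- (forig F *m (frame F)^T)) + x *m (frame F)^T) @^-1` fdom F).
  apply: closedI; first exact: closed_plane.
  by apply: closed_comp => // x _; exact: continuous_affine.
apply/seteqP; split=> x /=.
  move=> [y Uy <-]; split; last by rewrite addrC -mulmxBl chartK.
  apply/eqP; rewrite -subr_eq0 -dotBr dotC.
  by have := chart_normal F y 0; rewrite /chart mul0mx addr0 => ->.
move=> [/eqP]; rewrite -subr_eq0 -dotBr dotC => /eqP /chart_project e.
by rewrite addrC -mulmxBl => Uy; exists ((x - forig F) *m (frame F)^T).
Qed.

Lemma nbhs_shift (z m : 'rV[R]_3) (B : set 'rV[R]_3) : nbhs z B ->
  exists2 t : R, 0 < t & B (z + t *: m).
Proof.
move=> Bz; have cs : continuous (fun t : R => z + t *: m).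
  move=> t; apply: cvgD; first exact: cvg_cst.
  by apply: cvgZr_tmp; exact: cvg_id.
have : nbhs ((fun t : R => z + t *: m) 0) B by rewrite scale0r addr0.
move=> /cs /nbhs_ballP[e /= e0 eB]; exists (e / 2); first by rewrite divr_gt0.
apply: (eB (e / 2)); rewrite /ball/= sub0r normrN gtr0_norm ?divr_gt0//.
by rewrite ltr_pdivrMr// mulr_natr mulr2n ltrDl.
Qed.

Definition face_side K F y n := \forall z \near chart F y,
  (dot (z - chart F y) n < 0 -> cell K z) /\ (0 < dot (z - chart F y) n -> ~ cell K z).

Lemma near_boundary_plane K F y : on_bd (cell K) F -> interior (fdom F) y ->
  \forall z \near chart F y, boundary (cell K) z ->
    dot (z - chart F y) (face_normal F) = 0.
Proof.
move=> bF Uy; have [_ [bK _ disj]] := conf.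
have : \forall z \near chart F y, forall F', F' != F -> ~ face F' z.
  apply: (@filter_forall _ _ _ (nbhs (chart F y)) (nbhs_filter _)) => F'.
  have [->|F'F] := eqVneq F' F; first by apply: nearW.
  have nF : (~` face F') (chart F y).
    move=> Fx; have : (relint F `&` face F') (chart F y) by split=> //; exists y.
    by rewrite disj// eq_sym.
  have : nbhs (chart F y) (~` face F').
    by apply: open_nbhs_nbhs; split=> //; apply: closed_openC; exact: closed_face.
  by apply: (@filterS _ _ (nbhs_filter _)) => z + _.
apply: (@filterS _ _ (nbhs_filter _)) => z zF; rewrite bK => -[F' _ zF'].
have [e|/zF/(_ zF')//] := eqVneq F' F.
by move: zF'; rewrite e => -[y' _ <-]; exact: chart_normal.
Qed.

Lemma exists_face_side K F y : on_bd (cell K) F -> interior (fdom F) y ->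
  exists2 n, n = face_normal F \/ n = - face_normal F & face_side K F y n.
Proof.
move=> bF Uy; set n0 := face_normal F; set x0 := chart F y.
have n1 : dot n0 n0 = 1 := face_normal_unit F.
have [cK _ _ _ iK] := polyhedron_props (cell_polyhedron K).
have /nbhs_ballP[e /= e0 eB] := near_boundary_plane bF Uy.
have ballE z : ball x0 e z = (`|x0 - z| < e) by rewrite -ball_normE.
have pm n : n = n0 \/ n = - n0 -> dot n n = 1 /\ forall z, dot z n0 = 0 -> dot z n = 0.
  by move=> [->|->]; rewrite ?dotNl ?dotNr ?opprK; split=> // z zn; rewrite ?dotNr zn ?oppr0.
have half n a b : n = n0 \/ n = - n0 -> ball x0 e a -> ball x0 e b ->
    0 < dot (a - x0) n -> 0 < dot (b - x0) n -> cell K a -> cell K b.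
  move=> nE ba bb an bn; apply: segment_in_closed => // t t0 t1 Kp.
  apply: contrapT => iKp; set p := a + t *: (b - a) in Kp iKp *.
  have bp : ball x0 e p.
    rewrite ballE; have -> : x0 - p = (1 - t) *: (x0 - a) + t *: (x0 - b).
      by rewrite /p; apply/rowP => j; rewrite !mxE; ring.
    rewrite (le_lt_trans (ler_normD _ _))// !normrZ (ger0_norm t0) ger0_norm ?subr_ge0//.
    move: ba bb; rewrite !ballE; move: (`|_|) (`|_|) => u v ue ve.
    have [->|t0'] := eqVneq t 0; first by rewrite subr0 mul1r mul0r addr0.
    have tp : 0 < t by rewrite lt_def t0'.
    have h1 : 0 <= (1 - t) * (e - u) by rewrite mulr_ge0 ?subr_ge0// ltW.
    have h2 : 0 < t * (e - v) by rewrite mulr_gt0 ?subr_gt0.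
    by nra.
  have := eB p bp (conj (subset_closure Kp) iKp) => /(pm _ nE).2.
  have -> : p - x0 = (1 - t) *: (a - x0) + t *: (b - x0).
    by rewrite /p; apply/rowP => j; rewrite !mxE; ring.
  rewrite dotDl !dotZl => /eqP; apply/negP; rewrite gt_eqF//.
  have [->|t0'] := eqVneq t 0; first by rewrite subr0 mul1r mul0r addr0.
  apply: ltr_wpDl; first by rewrite mulr_ge0 ?subr_ge0// ltW.
  by rewrite mulr_gt0// lt_def t0'.
have Bx0 : nbhs x0 (ball x0 e) := nbhsx_ballx x0 e e0.
have bx0 : boundary (cell K) x0.
  by have /asboolP := bF; apply; exists y => //; exact: interior_subset.
have oB : open (ball x0 e) by exact: ball_open.
have [q [bq Kq qn]] : exists q, [/\ ball x0 e q, cell K q & dot (q - x0) n0 != 0].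
  have : closure (interior (cell K)) x0 by rewrite iK; apply: cK; exact: bx0.1.
  move=> /(_ _ Bx0)[q [Kq bq]].
  have [q0|] := eqVneq (dot (q - x0) n0) 0; last first.
    by move=> ?; exists q; split=> //; exact: interior_subset.
  have : nbhs q (interior (cell K) `&` ball x0 e).
    by apply: open_nbhs_nbhs; split=> //; apply: openI => //; exact: open_interior.
  move=> /(nbhs_shift n0)[t t0 [Kt Bt]]; exists (q + t *: n0); split=> //.
    exact: interior_subset.
  by rewrite addrAC dotDl q0 add0r dotZl n1 mulr1 gt_eqF.
have [m mE qm] : exists2 m, m = n0 \/ m = - n0 & 0 < dot (q - x0) m.
  have [lt|gt|/eqP] := ltgtP (dot (q - x0) n0) 0; last by rewrite (negbTE qn).
    by exists (- n0); [right|rewrite dotNr oppr_gt0].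
  by exists n0; [left|].
have NmE : - m = n0 \/ - m = - n0.
  by case: mE => ->; [right|left; rewrite opprK].
exists (- m) => //.
apply/nbhs_ballP; exists e => //= z bz; rewrite dotNr oppr_lt0 oppr_gt0; split=> zm.
  exact: (half m q).
move=> Kz; have [_] := bx0; apply; apply/nbhs_ballP; exists e => //= z' bz'.
have off (z'' : 'rV[R]_3) : ball x0 e z'' -> dot (z'' - x0) m != 0 -> cell K z''.
  move=> bz''; rewrite neq_lt => /orP[lt|gt]; last exact: (half m q).
  by apply: (half (- m) z) => //; rewrite dotNr oppr_gt0.
have [z0|] := eqVneq (dot (z' - x0) m) 0; last exact: off.
apply: cK => B Bz'; have : nbhs z' (B `&` ball x0 e).
  by apply: filterI => //; apply: open_nbhs_nbhs.
move=> /(nbhs_shift m)[t t0 [Bt bt]]; exists (z' + t *: m); split=> //.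
apply: off => //; rewrite addrAC dotDl z0 add0r dotZl (pm _ mE).1 mulr1.
by rewrite gt_eqF.
Qed.

Lemma face_side_opp K F y n : dot n n = 1 -> face_side K F y n -> face_side K F y (- n) -> False.
Proof.
move=> n1 h1 h2; have [t t0 [[_ H1] [H2 _]]] := nbhs_shift n (@filterI _ _ (nbhs_filter _) _ _ h1 h2).
move: H1 H2; rewrite addrAC subrr add0r dotNr dotZl n1 mulr1 oppr_lt0.
by move=> /(_ t0) H1 /(_ t0).
Qed.

Lemma face_side_near K F y n : n = face_normal F \/ n = - face_normal F ->
  face_side K F y n -> \forall y' \near y, face_side K F y' n.
Proof.
move=> nE /nbhs_interior h.
have : nbhs y (chart F @^-1` (interior [set z |
    (dot (z - chart F y) n < 0 -> cell K z) /\ (0 < dot (z - chart F y) n -> ~ cell K z)])).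
  exact: continuous_chart h.
apply: (@filterS _ _ (nbhs_filter _)) => y' h'.
apply: (@filterS _ _ (nbhs_filter _) _ _ _ h') => z /=.
have -> // : dot (z - chart F y) n = dot (z - chart F y') n.
have yy : dot (chart F y' - chart F y) n = 0.
  by case: nE => ->; rewrite ?dotNr chart_normal ?oppr0.
by rewrite -[RHS]addr0 -yy -dotDl addrA subrK.
Qed.

Lemma face_side_constant K F y y' n : n = face_normal F \/ n = - face_normal F ->
  on_bd (cell K) F -> interior (fdom F) y -> interior (fdom F) y' ->
  face_side K F y n -> face_side K F y' n.
Proof.
move=> nE bF Uy Uy' h.
have [_ _ cU _ _] := polyhedron_props (fdom_polyhedron F).
have n1 : dot n n = 1.
  by case: nE => ->; rewrite ?dotNl ?dotNr ?opprK face_normal_unit.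
have NnE : - n = face_normal F \/ - n = - face_normal F.
  by case: nE => ->; [right|left; rewrite opprK].
have op m : m = face_normal F \/ m = - face_normal F -> open [set y | face_side K F y m].
  by move=> mE; rewrite openE => z; exact: face_side_near.
have -> // : face_side K F y' n = (interior (fdom F) `&` [set y | face_side K F y n]) y'.
  by rewrite /setI/=; apply/propext; split=> [|[]].
rewrite (cU (interior (fdom F) `&` [set y | face_side K F y n])) //.
- by exists y.
- by exists [set y | face_side K F y n] => //; exact: op.
exists (~` [set y | face_side K F y (- n)]).
  by apply: open_closedC; exact: op.
rewrite predeqE => z; split=> -[Uz hz]; split=> //.
  by move=> hz'; exact: face_side_opp hz hz'.
have [m mE hm] := exists_face_side bF Uz.
have [mn|mn] : m = n \/ m = - n.
  by case: mE => ->; case: nE => ->; rewrite ?opprK; [left|right|right|left].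
- by rewrite /= -mn.
- by exfalso; apply: hz; rewrite /= -mn.
Qed.

Lemma is_outward_normal_side K F y n : is_outward_normal (cell K) F n ->
  interior (fdom F) y -> face_side K F y (- n) -> False.
Proof.
move=> [nE out] Uy h.
have n1 : dot n n = 1.
  by case: nE => ->; rewrite ?dotNl ?dotNr ?opprK face_normal_unit.
have cs : continuous (fun t : R => chart F y + t *: n).
  move=> t; apply: cvgD; first exact: cvg_cst.
  by apply: cvgZr_tmp; exact: cvg_id.
have h0 : nbhs ((fun t : R => chart F y + t *: n) 0) [set z |
    (dot (z - chart F y) (- n) < 0 -> cell K z) /\ (0 < dot (z - chart F y) (- n) -> ~ cell K z)].
  by rewrite scale0r addr0.
move: h0 => /cs/nbhs_ballP[e /= e0 eB].
have xF : relint F (chart F y) by exists y.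
have [t [[tK _] [t0 te]]] : exists t : R, (~ cell K (chart F y + t *: n) /\
    cell K (chart F y - t *: n)) /\ 0 < t /\ t < e.
  apply: (@filter_ex _ (0 : R)^'+).
  near=> t; split; last split; [|near: t; exact: nbhs_right_gt|near: t; exact: nbhs_right_lt].
  by near: t; exact: out.
have bt : ball (0 : R) e t by rewrite /ball/= sub0r normrN gtr0_norm.
have [+ _] := eB t bt; rewrite addrAC subrr add0r dotNr dotZl n1 mulr1 oppr_lt0.
by move=> /(_ t0).
Unshelve. all: by end_near. Qed.

Lemma side_is_outward_normal K F n : n = face_normal F \/ n = - face_normal F ->
  (forall y, interior (fdom F) y -> face_side K F y n) -> is_outward_normal (cell K) F n.
Proof.
move=> nE h; split=> // _ [y Uy <-].
have n1 : dot n n = 1.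
  by case: nE => ->; rewrite ?dotNl ?dotNr ?opprK face_normal_unit.
have cs : continuous (fun t : R => chart F y + t *: n).
  move=> t; apply: cvgD; first exact: cvg_cst.
  by apply: cvgZr_tmp; exact: cvg_id.
have h0 : nbhs ((fun t : R => chart F y + t *: n) 0) [set z |
    (dot (z - chart F y) n < 0 -> cell K z) /\ (0 < dot (z - chart F y) n -> ~ cell K z)].
  by rewrite scale0r addr0; exact: h.
move: h0 => /cs/nbhs_ballP[e /= e0 eB].
near=> t.
have t0 : 0 < t by near: t; exact: nbhs_right_gt.
have te : t < e by near: t; exact: nbhs_right_lt.
have bt : ball (0 : R) e t by rewrite /ball/= sub0r normrN gtr0_norm.
have bNt : ball (0 : R) e (- t) by rewrite /ball/= sub0r opprK gtr0_norm.
have Es s : dot (chart F y + s *: n - chart F y) n = s.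
  by rewrite addrAC subrr add0r dotZl n1 mulr1.
have [_ +] := eB _ bt; have [+ _] := eB _ bNt; rewrite !Es oppr_lt0 scaleNr.
by move=> /(_ t0) ? /(_ t0).
Unshelve. all: by end_near. Qed.

Lemma nrm_side K F : on_bd (cell K) F ->
  (nrm K F = face_normal F \/ nrm K F = - face_normal F) /\
  forall y, interior (fdom F) y -> face_side K F y (nrm K F).
Proof.
move=> bF; have [_ _ _ [y0 Uy0] _] := polyhedron_props (fdom_polyhedron F).
have [n nE hn] := exists_face_side bF Uy0.
have hn' y : interior (fdom F) y -> face_side K F y n.
  by move=> Uy; exact: face_side_constant hn.
have on := side_is_outward_normal nE hn'.
have onrm : is_outward_normal (cell K) F (nrm K F) by apply: (@xgetPex _ 0 [set n | is_outward_normal (cell K) F n]); exists n.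
have -> : nrm K F = n; last by [].
have [//|mn] : nrm K F = n \/ nrm K F = - n.
  by case: onrm.1 => ->; case: nE => ->; rewrite ?opprK; [left|right|right|left].
by exfalso; apply: (is_outward_normal_side onrm Uy0); rewrite mn opprK.
Qed.

End FaceSides.



Section MeshGeometry.
Context {R : realType} {Th : mesh R} {Omega : set 'rV[R]_3}.
Hypothesis conf : conforming_polyhedral Th Omega.
Local Notation cells := 'I_(ncell Th).
Local Notation faces := 'I_(nface Th).
Implicit Types (K : cells) (F : faces).

Lemma nrmE K F : on_bd (cell K) F -> nrm K F = face_normal F \/ nrm K F = - face_normal F.
Proof. by move=> /(nrm_side conf)[]. Qed.

Lemma nrm_unit K F : on_bd (cell K) F -> dot (nrm K F) (nrm K F) = 1.
Proof.
by move=> /nrmE[->|->]; rewrite ?dotNl ?dotNr ?opprK (face_normal_unit conf).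
Qed.

Lemma exists_relint F : exists y, interior (fdom F) y.
Proof. by have [_ _ _ [y Uy] _] := polyhedron_props (fdom_polyhedron conf F); exists y. Qed.

Lemma on_bd_face (D : set 'rV[R]_3) F y : on_bd D F -> fdom F y -> boundary D (chart F y).
Proof. by move=> /asboolP bF Fy; apply: bF; exists y. Qed.

Lemma closed_cell K : closed (cell K).
Proof. by have [] := polyhedron_props (cell_polyhedron conf K). Qed.

Lemma interior_cell_disjoint K K' x : interior (cell K) x -> interior (cell K') x -> K = K'.
Proof.
move=> Kx Kx'; have [[_ _ disj _] _] := conf; apply/eqP/negPn/negP => /disj.
by move/seteqP => [/(_ x) + _]; apply.
Qed.

Lemma nrm_inj K K' F : on_bd (cell K) F -> on_bd (cell K') F -> nrm K F = nrm K' F -> K = K'.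
Proof.
move=> bF bF' e; have [y Uy] := exists_relint F.
have [_ /(_ y Uy) h] := nrm_side conf bF; have [_ /(_ y Uy)] := nrm_side conf bF'.
rewrite -e => h'.
have n1 := nrm_unit bF.
have [t t0] := nbhs_shift (- nrm K F) (nbhs_interior (@filterI _ _ (nbhs_filter _) _ _ h h')).
set z := _ + _ => /= nz.
have dz : dot (z - chart F y) (nrm K F) < 0.
  by rewrite /z addrAC subrr add0r dotZl dotNl n1 mulrN1 oppr_lt0.
have nz' : nbhs z [set z | dot (z - chart F y) (nrm K F) < 0].
  apply: open_nbhs_nbhs; split=> //.
  rewrite (_ : [set _ | _] = dot (nrm K F) @^-1` [set s | s < dot (nrm K F) (chart F y)]).
    by apply: open_comp => [x _|]; [exact: continuous_dot|exact: open_lt].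
  by apply/seteqP; split=> x /=; rewrite (dotC (x - _)) dotBr subr_lt0.
have H := @filterI _ _ (nbhs_filter z) _ _ nz nz'.
apply: (interior_cell_disjoint (x := z)); apply: (@filterS _ _ (nbhs_filter z) _ _ _ H).
- by move=> x [[[+ _] _] /= d]; apply.
- by move=> x [[_ [+ _]] /= d]; apply.
Qed.

Lemma nrm_opp K K' F : on_bd (cell K) F -> on_bd (cell K') F -> K != K' ->
  nrm K' F = - nrm K F.
Proof.
move=> bF bF' KK'; have : nrm K' F != nrm K F.
  by apply: contra KK' => /eqP e; apply/eqP/(nrm_inj bF bF').
by have [->|->] := nrmE bF; have [->|->] := nrmE bF'; rewrite ?opprK ?eqxx.
Qed.

Lemma on_bd_two K K' K'' F : on_bd (cell K) F -> on_bd (cell K') F -> on_bd (cell K'') F ->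
  K != K' -> K'' = K \/ K'' = K'.
Proof.
move=> bF bF' bF'' KK'; have [->|ne] := eqVneq K'' K; [by left|right].
apply: (nrm_inj bF'' bF'); rewrite (nrm_opp bF bF')// (nrm_opp bF bF'')//.
by rewrite eq_sym.
Qed.

Lemma relint_on_bd K K' F y : on_bd (cell K) F -> interior (fdom F) y -> K' != K ->
  cell K' (chart F y) -> on_bd (cell K') F.
Proof.
move=> bF Uy KK' Kx'; have [_ [bdE _ disj]] := conf.
have [_ _ _ _ iK] := polyhedron_props (cell_polyhedron conf K).
have bx := on_bd_face bF (interior_subset Uy).
have : boundary (cell K') (chart F y).
  split; first exact: subset_closure.
  move=> ix; have : closure (interior (cell K)) (chart F y).
    by rewrite iK; apply: (closed_cell (K := K)); exact: bx.1.
  have : nbhs (chart F y) (interior (cell K')).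
    by apply: open_nbhs_nbhs; split=> //; exact: open_interior.
  move=> + cl => /cl[z [Kz Kz']].
  by move: KK'; rewrite (interior_cell_disjoint Kz Kz') eqxx.
rewrite bdE => -[F' /= bF' F'x].
have [<-//|F'F] := eqVneq F' F.
have : (relint F `&` face F') (chart F y) by split=> //; exists y.
by rewrite disj// eq_sym.
Qed.

Hypothesis polO : polyhedral_domain Omega.

Lemma interior_cell_sub K : interior (cell K) `<=` Omega.
Proof.
have [[_ _ _ _ iO] _] := polO; rewrite -[X in _ `<=` X]iO.
have [[_ cO _ _] _] := conf.
by apply: interiorS; rewrite cO => x Kx; exists K.
Qed.

Lemma interior_face F : ~~ on_bd Omega F ->
  exists K K', [/\ K != K', on_bd (cell K) F & on_bd (cell K') F].
Proof.
have [[oO _ _ _ iO] _] := polO; have [[_ cO _ _] [bdE exK _]] := conf.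
have [_ _ _ _ iF] := polyhedron_props (fdom_polyhedron conf F).
have [K bF] := exK F => nbd.
have [cK _ _ _ _] := polyhedron_props (cell_polyhedron conf K).
have [y [Uy Oy]] : exists y, interior (fdom F) y /\ Omega (chart F y).
  apply: contrapT => H; move/asboolP: nbd; apply => _ [y Fy <-]; split.
    by rewrite cO; exists K => //; apply: cK; exact: (on_bd_face bF Fy).1.
  rewrite (interior_id _).1// => Oy.
  have : nbhs y (chart F @^-1` Omega).
    by apply: (continuous_chart (F := F)); apply: open_nbhs_nbhs; split.
  rewrite -iF in Fy => /Fy[z [Uz Oz]]; apply: H; by exists z.
suff [K' KK' Kx'] : exists2 K', K' != K & cell K' (chart F y).
  exists K, K'; split=> //; first by rewrite eq_sym.
  exact: relint_on_bd bF Uy KK' Kx'.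
apply: contrapT => H.
have N1 : \forall z \near chart F y, forall K', K' != K -> ~ cell K' z.
  apply: (@filter_forall _ _ _ (nbhs (chart F y)) (nbhs_filter _)) => K'.
  have [->|K'K] := eqVneq K' K; first by apply: nearW.
  have : nbhs (chart F y) (~` cell K').
    apply: open_nbhs_nbhs; split=> [|Kx']; last by apply: H; exists K'.
    by apply: closed_openC; exact: closed_cell.
  by apply: (@filterS _ _ (nbhs_filter _)) => z + _.
have N2 : nbhs (chart F y) Omega by exact: open_nbhs_nbhs.
have [_ /(_ y Uy) N3] := nrm_side conf bF.
have [t t0 [[Oz zK] [_ zK']]] := nbhs_shift (nrm K F)
  (@filterI _ _ (nbhs_filter _) _ _ (@filterI _ _ (nbhs_filter _) _ _ N2 N1) N3).
have : closure Omega (chart F y + t *: nrm K F) by exact: subset_closure.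
rewrite cO => -[K' _ Kz]; have [e|/zK//] := eqVneq K' K.
rewrite e in Kz; apply: zK' Kz.
by rewrite addrAC subrr add0r dotZl (nrm_unit bF) mulr1.
Qed.

Lemma cell_facetted K :
  facetted (cell K) (fun j : {F | on_bd (cell K) F} => forig (val j))
    (fun j => frame (val j)) (fun j => fdom (val j)) (fun j => nrm K (val j)).
Proof.
have [_ [bdE _ disj]] := conf.
have [cK bK _ _ _] := polyhedron_props (cell_polyhedron conf K).
split=> //.
- move=> x; rewrite bdE => -[F /= bF [y Fy <-]].
  by exists (exist _ F bF), y.
- by move=> [F bF] y Fy/=; apply: cK; exact: (on_bd_face bF Fy).1.
- by move=> [F bF]/=; have [] := polyhedron_props (fdom_polyhedron conf F).
- by move=> [F bF]/=; have [] := polyhedron_props (fdom_polyhedron conf F).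
- by move=> [F bF]/=; exact: polyhedron_boundary (fdom_polyhedron conf F).
- by move=> [F bF]/=; exact: frameF conf F.
- move=> [F bF] [F' bF'] y y' /= FF' Uy Fy'; apply/eqP => e.
  have : (relint F `&` face F') (chart F y) by split; [exists y|exists y'].
  by rewrite disj.
- by move=> [F bF]/=; exact: nrmE.
- by move=> [F bF] y /= Uy; exact: (nrm_side conf bF).2.
Qed.

Theorem divergence_cell K (f : 'rV[R]_3 -> R) (i : 'I_3) :
  (forall x, differentiable f x) -> continuous (partial i f) ->
  int3 (cell K) (partial i f) =
    \sum_(F | on_bd (cell K) F) int2 (fdom F) (fun y => f (chart F y) * nrm K F 0 i).
Proof.
by move=> df cf; rewrite (divergence_facetted (cell_facetted K) df cf) (big_sub (on_bd (cell K))).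
Qed.

End MeshGeometry.



Section PolynomialFunctions.
Context {R : realType}.

Definition polyf {d : nat} (f : 'rV[R]_d -> R) : Prop := exists k, Ppoly k f.
Definition polyv {d : nat} (v : 'rV[R]_d -> 'rV[R]_3) : Prop :=
  forall i, polyf (fun x => v x 0 i).

Section Ring.
Context {d : nat}.
Implicit Types (f g : 'rV[R]_d -> R) (u v : 'rV[R]_d -> 'rV[R]_3).

Lemma Ppoly_polyf k f : Ppoly k f -> polyf f. Proof. by exists k. Qed.

Lemma Pvec_polyv k v : Pvec k v -> polyv v. Proof. by move=> vk i; exists k. Qed.

Lemma polyf_cst (c : R) : polyf (fun _ : 'rV[R]_d => c).
Proof. by exists 0%N; exact: Ppoly_cst. Qed.

Lemma polyfD f g : polyf f -> polyf g -> polyf (fun x => f x + g x).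
Proof.
move=> [k fk] [l gl]; exists (maxn k l).
by apply: PpolyD; [apply: Ppoly_le fk|apply: Ppoly_le gl]; rewrite ?leq_maxl ?leq_maxr.
Qed.

Lemma polyfM f g : polyf f -> polyf g -> polyf (fun x => f x * g x).
Proof. by move=> [k fk] [l gl]; exists (k + l)%N; exact: PpolyM. Qed.

Lemma polyfZ (c : R) f : polyf f -> polyf (fun x => c * f x).
Proof. by move=> [k fk]; exists k; exact: PpolyZ. Qed.

Lemma polyfN f : polyf f -> polyf (fun x => - f x).
Proof. by move=> [k fk]; exists k; exact: PpolyN. Qed.

Lemma polyfB f g : polyf f -> polyf g -> polyf (fun x => f x - g x).
Proof. by move=> pf pg; apply: polyfD => //; exact: polyfN. Qed.

Lemma polyf_sum (I : Type) (s : seq I) (P : pred I) (f : I -> 'rV[R]_d -> R) :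
  (forall i, P i -> polyf (f i)) -> polyf (fun x => \sum_(i <- s | P i) f i x).
Proof.
move=> pf; elim: s => [|i s IH].
  by have := polyf_cst 0; congr polyf; apply/funext => x; rewrite big_nil.
have [Pi|Pi] := boolP (P i).
  have := polyfD (pf i Pi) IH; congr polyf.
  by apply/funext => x; rewrite big_cons Pi.
by move: IH; congr polyf; apply/funext => x; rewrite big_cons (negbTE Pi).
Qed.

Lemma polyf_dot u v : polyv u -> polyv v -> polyf (fun x => dot (u x) (v x)).
Proof. by move=> pu pv; apply: polyf_sum => i _; apply: polyfM. Qed.

Lemma polyv_cst (c : 'rV[R]_3) : polyv (fun _ : 'rV[R]_d => c).
Proof. by move=> i; exact: polyf_cst. Qed.

Lemma polyf_eqf f g : (forall x, f x = g x) -> polyf f -> polyf g.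
Proof. by move=> /funext ->. Qed.

Lemma polyvD u v : polyv u -> polyv v -> polyv (fun x => u x + v x).
Proof.
move=> pu pv i; apply: polyf_eqf (polyfD (pu i) (pv i)) => x; by rewrite !mxE.
Qed.

Lemma polyvN u : polyv u -> polyv (fun x => - u x).
Proof. by move=> pu i; apply: polyf_eqf (polyfN (pu i)) => x; rewrite !mxE. Qed.

Lemma polyvB u v : polyv u -> polyv v -> polyv (fun x => u x - v x).
Proof. by move=> pu pv; apply: polyvD => //; exact: polyvN. Qed.

Lemma polyvZ f v : polyf f -> polyv v -> polyv (fun x => f x *: v x).
Proof. by move=> pf pv i; apply: polyf_eqf (polyfM pf (pv i)) => x; rewrite !mxE. Qed.

Lemma polyv_cross u v : polyv u -> polyv v -> polyv (fun x => cross (u x) (v x)).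
Proof.
move=> pu pv i.
have := polyfB (polyfM (pu (i + 1)) (pv (i + 2))) (polyfM (pu (i + 2)) (pv (i + 1))).
by apply: polyf_eqf => x; rewrite mxE.
Qed.

Lemma polyv_tang n v : polyv v -> polyv (fun x => tang n (v x)).
Proof.
move=> pv; apply: (polyv_cross (polyv_cst n)).
exact: (polyv_cross pv (polyv_cst n)).
Qed.

End Ring.

Section Calculus.
Context {d : nat}.
Implicit Types (f g : 'rV[R]_d.+1 -> R).

Lemma polyf_partial i f : polyf f -> polyf (partial i f).
Proof. by move=> [k fk]; exists k.-1; exact: Ppoly_partial. Qed.

Lemma polyf_diff f x : polyf f -> differentiable f x.
Proof. by move=> [k]; exact: Ppoly_diff. Qed.

Lemma polyf_continuous f : polyf f -> continuous f.
Proof. by move=> [k]; exact: Ppoly_continuous. Qed.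

Lemma polyf_eq0 f (D : set 'rV[R]_d.+1) : polyf f -> interior D !=set0 ->
  (forall x, D x -> f x = 0) -> forall x, f x = 0.
Proof. by move=> [k fk] D0 /(Ppoly_eq0 fk D0) -> x. Qed.

Lemma polyf_comp {e : nat} f (a : 'rV[R]_e -> 'rV[R]_d.+1) :
  (forall i, Ppoly 1 (fun y => a y 0 i)) -> polyf f -> polyf (fun y => f (a y)).
Proof. by move=> pa [k fk]; exists k; exact: Ppoly_comp. Qed.

End Calculus.

Lemma polyv_curl (v : 'rV[R]_3 -> 'rV[R]_3) : polyv v -> polyv (curl v).
Proof.
move=> pv i; have := polyfB (polyf_partial (i + 1) (pv (i + 2)))
                            (polyf_partial (i + 2) (pv (i + 1))).
by apply: polyf_eqf => x; rewrite mxE.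
Qed.

Lemma polyv_grad (p : 'rV[R]_3 -> R) : polyf p -> polyv (grad p).
Proof. by move=> pp i; apply: polyf_eqf (polyf_partial i pp) => x; rewrite mxE. Qed.

Lemma polyf_divg (v : 'rV[R]_3 -> 'rV[R]_3) : polyv v -> polyf (divg v).
Proof. by move=> pv; apply: polyf_sum => i _; exact: polyf_partial. Qed.

Lemma polyv_comp {e : nat} (v : 'rV[R]_3 -> 'rV[R]_3) (a : 'rV[R]_e -> 'rV[R]_3) :
  (forall i, Ppoly 1 (fun y => a y 0 i)) -> polyv v -> polyv (fun y => v (a y)).
Proof. by move=> pa pv i; exact: (polyf_comp pa (pv i)). Qed.

Lemma divg_scale p v x : polyf p -> polyv v ->
  divg (fun x => p x *: v x) x = p x * divg v x + dot (grad p x) (v x).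
Proof.
move=> pp pv; rewrite /divg mulr_sumr -big_split; apply: eq_bigr => i _ /=.
have -> : (fun z => (p z *: v z) 0 i) = fun z => p z * v z 0 i.
  by apply/funext => z; rewrite mxE.
apply: (etrans (partialM i (polyf_diff x pp) (polyf_diff x (pv i)))).
by rewrite addrC mxE.
Qed.

Lemma divg_cross u v x : polyv u -> polyv v ->
  divg (fun x => cross (u x) (v x)) x = dot (curl u x) (v x) - dot (u x) (curl v x).
Proof.
move=> pu pv.
have E i : partial i (fun z => cross (u z) (v z) 0 i) x =
    (partial i (fun z => u z 0 (i + 1)) x * v x 0 (i + 2) +
     u x 0 (i + 1) * partial i (fun z => v z 0 (i + 2)) x) -
    (partial i (fun z => u z 0 (i + 2)) x * v x 0 (i + 1) +
     u x 0 (i + 2) * partial i (fun z => v z 0 (i + 1)) x).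
  have -> : (fun z => cross (u z) (v z) 0 i) =
      fun z => u z 0 (i + 1) * v z 0 (i + 2) - u z 0 (i + 2) * v z 0 (i + 1).
    by apply/funext => z; rewrite mxE.
  transitivity (partial i (fun z => u z 0 (i + 1) * v z 0 (i + 2)) x -
      partial i (fun z => u z 0 (i + 2) * v z 0 (i + 1)) x).
    by apply: partialB; apply: polyf_diff; apply: polyfM.
  by congr (_ - _); apply: partialM; apply: polyf_diff.
rewrite /divg sum_I3 !E !dot_I3 !mxE ?add0r ?I3_addE.
set a := partial _ _ _; set b := partial _ _ _; set c := partial _ _ _.
set a' := partial _ _ _; set b' := partial _ _ _; set c' := partial _ _ _.
by ring.
Qed.

End PolynomialFunctions.



Section MeshIntegrals.
Context {R : realType} {Th : mesh R} {Omega : set 'rV[R]_3}.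
Hypothesis conf : conforming_polyhedral Th Omega.
Local Notation cells := 'I_(ncell Th).
Local Notation faces := 'I_(nface Th).
Local Notation mR := (measurableTypeR R).
Implicit Types (K : cells) (F : faces).

Lemma cell_integ K (f : 'rV[R]_3 -> R) : continuous f -> integ3 (cell K) f.
Proof.
have [cK bK _ _ _] := polyhedron_props (cell_polyhedron conf K).
by apply: integ3_continuous => //; exact: closed_pt3_measurable.
Qed.

Lemma face_integ F (f : 'rV[R]_2 -> R) : continuous f -> integ2 (fdom F) f.
Proof.
have [cK bK _ _ _] := polyhedron_props (fdom_polyhedron conf F).
by apply: integ2_continuous => //; exact: closed_pt2_measurable.
Qed.

Lemma int3D K (f g : 'rV[R]_3 -> R) : polyf f -> polyf g ->
  int3 (cell K) (fun x => f x + g x) = int3 (cell K) f + int3 (cell K) g.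
Proof.
by move=> /polyf_continuous cf /polyf_continuous cg; apply: coordintD; exact: cell_integ.
Qed.

Lemma int3B K (f g : 'rV[R]_3 -> R) : polyf f -> polyf g ->
  int3 (cell K) (fun x => f x - g x) = int3 (cell K) f - int3 (cell K) g.
Proof.
by move=> /polyf_continuous cf /polyf_continuous cg; apply: coordintB; exact: cell_integ.
Qed.

Lemma int3Z K c (f : 'rV[R]_3 -> R) : polyf f ->
  int3 (cell K) (fun x => c * f x) = c * int3 (cell K) f.
Proof. by move=> /polyf_continuous cf; apply: coordintZ; exact: cell_integ. Qed.

Lemma int2D F (f g : 'rV[R]_2 -> R) : polyf f -> polyf g ->
  int2 (fdom F) (fun x => f x + g x) = int2 (fdom F) f + int2 (fdom F) g.
Proof.
by move=> /polyf_continuous cf /polyf_continuous cg; apply: coordintD; exact: face_integ.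
Qed.

Lemma int2B F (f g : 'rV[R]_2 -> R) : polyf f -> polyf g ->
  int2 (fdom F) (fun x => f x - g x) = int2 (fdom F) f - int2 (fdom F) g.
Proof.
by move=> /polyf_continuous cf /polyf_continuous cg; apply: coordintB; exact: face_integ.
Qed.

Lemma int2Z F c (f : 'rV[R]_2 -> R) : polyf f ->
  int2 (fdom F) (fun x => c * f x) = c * int2 (fdom F) f.
Proof. by move=> /polyf_continuous cf; apply: coordintZ; exact: face_integ. Qed.

Lemma int3_nonneg_eq0 K (f : 'rV[R]_3 -> R) : polyf f -> (forall x, cell K x -> 0 <= f x) ->
  int3 (cell K) f = 0 -> forall x, f x = 0.
Proof.
move=> pf f0 i0; have [cK bK _ nK iK] := polyhedron_props (cell_polyhedron conf K).
apply: (polyf_eq0 (D := interior (cell K)) pf); first by rewrite (interior_id _).1//; exact: open_interior.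
by apply: int3_eq0 i0 => //; [exact: closed_pt3_measurable|exact: polyf_continuous].
Qed.

Lemma int3_pos_eq0 K (f : 'rV[R]_3 -> R) : polyf f -> (forall x, 0 <= f x) ->
  int3 (cell K) f = 0 -> forall x, f x = 0.
Proof. by move=> pf f0; apply: int3_nonneg_eq0 => // x _. Qed.

Lemma int2_pos_eq0 F (f : 'rV[R]_2 -> R) : polyf f -> (forall x, 0 <= f x) ->
  int2 (fdom F) f = 0 -> forall x, f x = 0.
Proof.
move=> pf f0 i0; have [cK bK _ nK iK] := polyhedron_props (fdom_polyhedron conf F).
apply: (polyf_eq0 (D := interior (fdom F)) pf); first by rewrite (interior_id _).1//; exact: open_interior.
by apply: int2_eq0 i0 => //; [exact: closed_pt2_measurable|exact: polyf_continuous].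
Qed.

Lemma int3_dot_eq0 K (v : 'rV[R]_3 -> 'rV[R]_3) : polyv v ->
  int3 (cell K) (fun x => dot (v x) (v x)) = 0 -> forall x, v x = 0.
Proof.
move=> pv /(int3_pos_eq0 (polyf_dot pv pv) (fun x => dotvv_ge0 _)) h x.
exact/dotvv_eq0/h.
Qed.

Lemma int2_dot_eq0 F (v : 'rV[R]_2 -> 'rV[R]_3) : polyv v ->
  int2 (fdom F) (fun x => dot (v x) (v x)) = 0 -> forall x, v x = 0.
Proof.
move=> pv /(int2_pos_eq0 (polyf_dot pv pv) (fun x => dotvv_ge0 _)) h x.
exact/dotvv_eq0/h.
Qed.

Lemma chart_poly F i : Ppoly 1 (fun y => chart F y 0 i).
Proof. exact: Ppoly_affine. Qed.

Lemma polyf_chart F (f : 'rV[R]_3 -> R) : polyf f -> polyf (fun y => f (chart F y)).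
Proof. by move=> pf; exact: (polyf_comp (chart_poly F) pf). Qed.

Lemma polyv_chart F (v : 'rV[R]_3 -> 'rV[R]_3) : polyv v -> polyv (fun y => v (chart F y)).
Proof. by move=> pf; exact: (polyv_comp (chart_poly F) pf). Qed.

Lemma interior_cell_null K : exists N, [/\ measurable (pt3 @^-1` N : set (mR * mR * mR)),
  leb3 R (pt3 @^-1` N) = 0%E & cell K `\` interior (cell K) `<=` N].
Proof.
have [_ [bdE _ _]] := conf.
pose P F := [set x | dot (face_normal F) x = dot (face_normal F) (forig F)].
have [N [mN N0 PN]] : exists N, [/\ measurable (pt3 @^-1` N : set (mR * mR * mR)),
    leb3 R (pt3 @^-1` N) = 0%E & forall F, F \in enum faces -> P F `<=` N].
  elim: (enum faces) => [|F s [N [mN N0 PN]]].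
    by exists set0; split=> //; rewrite preimage_set0.
  have [mP P0] : measurable (pt3 @^-1` P F : set (mR * mR * mR)) /\
      leb3 R (pt3 @^-1` P F) = 0%E.
    apply: leb3_plane_null; apply/eqP => n0.
    by have /eqP := face_normal_unit conf F; rewrite n0 dot0l eq_sym oner_eq0.
  exists (N `|` P F); rewrite preimage_setU; split; first exact: measurableU.
    by rewrite measureU0.
  move=> F'; rewrite inE => /predU1P[->|/PN h] x Px; [by right|left; exact: h].
exists N; split=> // x [Kx iKx].
have : boundary (cell K) x by split=> //; exact: subset_closure.
rewrite bdE => -[F _ [y _ <-]]; apply: (PN F); first by rewrite mem_enum.
apply/eqP; rewrite -subr_eq0 -dotBr dotC.
by have := chart_normal F y 0; rewrite /chart mul0mx addr0 => ->.
Qed.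

Lemma int3_interior K (f : 'rV[R]_3 -> R) :
  int3 (cell K) f = int3 (interior (cell K)) f.
Proof.
have [N [mN N0 KN]] := interior_cell_null K.
by apply: coordint_null KN => //; exact: interior_subset.
Qed.

Lemma gauss K (v : 'rV[R]_3 -> 'rV[R]_3) : polyv v -> int3 (cell K) (divg v) =
  \sum_(F | on_bd (cell K) F) int2 (fdom F) (fun y => dot (v (chart F y)) (nrm K F)).
Proof.
move=> pv.
have mK : measurable (pt3 @^-1` cell K : set (mR * mR * mR)).
  by apply: closed_pt3_measurable; exact: (closed_cell conf).
have [_ E] := coordint_sum (index_enum 'I_3) (P := xpredT) mK
  (fun i _ => cell_integ K (polyf_continuous (polyf_partial i (pv i)))).
apply: (etrans E); clear E.
transitivity (\sum_i \sum_(F | on_bd (cell K) F)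
    int2 (fdom F) (fun y => v (chart F y) 0 i * nrm K F 0 i)).
  apply: eq_bigr => i _; apply: (divergence_cell conf) => // [x|]; first exact: polyf_diff.
  by apply: polyf_continuous; exact: polyf_partial.
rewrite exchange_big; apply: eq_bigr => F bF.
have mF : measurable (pt2 @^-1` fdom F : set (mR * mR)).
  by have [? _ _ _ _] := polyhedron_props (fdom_polyhedron conf F); exact: closed_pt2_measurable.
have pi i : polyf (fun y => v (chart F y) 0 i * nrm K F 0 i).
  by apply: polyfM; [exact: (polyf_chart F (pv i))|exact: polyf_cst].
have [_ /esym] := coordint_sum (index_enum 'I_3) (P := xpredT) mF
  (fun i _ => face_integ F (polyf_continuous (pi i))).
exact.
Qed.

Lemma green_div K (p : 'rV[R]_3 -> R) v : polyf p -> polyv v ->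
  int3 (cell K) (fun x => p x * divg v x) + int3 (cell K) (fun x => dot (grad p x) (v x)) =
  \sum_(F | on_bd (cell K) F) int2 (fdom F) (fun y => p (chart F y) * dot (v (chart F y)) (nrm K F)).
Proof.
move=> pp pv; rewrite -int3D; first last.
- by apply: polyf_dot => //; exact: polyv_grad.
- by apply: polyfM => //; exact: polyf_divg.
transitivity (int3 (cell K) (divg (fun x => p x *: v x))).
  by congr int3; apply/funext => x; rewrite divg_scale.
rewrite gauss; last exact: polyvZ.
by apply: eq_bigr => F _; congr int2; apply/funext => y; rewrite dotZl.
Qed.

Lemma green_curl K (u v : 'rV[R]_3 -> 'rV[R]_3) : polyv u -> polyv v ->
  int3 (cell K) (fun x => dot (curl u x) (v x)) - int3 (cell K) (fun x => dot (u x) (curl v x)) =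
  \sum_(F | on_bd (cell K) F)
    int2 (fdom F) (fun y => dot (cross (nrm K F) (u (chart F y))) (v (chart F y))).
Proof.
move=> pu pv; rewrite -int3B; first last.
- by apply: polyf_dot => //; exact: polyv_curl.
- by apply: polyf_dot => //; exact: polyv_curl.
transitivity (int3 (cell K) (divg (fun x => cross (u x) (v x)))).
  by congr int3; apply/funext => x; rewrite divg_cross.
rewrite gauss; last exact: polyv_cross.
by apply: eq_bigr => F _; congr int2; apply/funext => y; rewrite dotC -dot_crossA.
Qed.

End MeshIntegrals.



Section FiniteDimension.
Context {R : realType}.

Section Span.
Context {V : lmodType R}.
Implicit Types (S : set V) (s : seq V) (x y : V).

Definition inspan s x := exists c : nat -> R, x = \sum_(i < size s) c i *: s`_i.

Definition findim S := exists s, forall x, S x -> inspan s x.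

Definition subspace S := S 0 /\ forall a x y, S x -> S y -> S (a *: x + y).

Lemma findim_sub S T : T `<=` S -> findim S -> findim T.
Proof. by move=> TS [s Ss]; exists s => x /TS; exact: Ss. Qed.

Lemma inspan_cat s t x y : inspan s x -> inspan t y -> inspan (s ++ t) (x + y).
Proof.
move=> [c ->] [c' ->]; exists (fun i => if (i < size s)%N then c i else c' (i - size s)%N).
rewrite size_cat big_split_ord/=; congr (_ + _); apply: eq_bigr => i _.
  by rewrite ltn_ord nth_cat ltn_ord.
by rewrite ltnNge leq_addr/= nth_cat ltnNge leq_addr/= addKn.
Qed.

Lemma findimD S T : findim S -> findim T ->
  findim [set z | exists x y, [/\ S x, T y & z = x + y]].
Proof.
move=> [s Ss] [t Tt]; exists (s ++ t) => _ [x [y [Sx Ty ->]]].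
by apply: inspan_cat; [exact: Ss|exact: Tt].
Qed.

Lemma findim0 : findim [set 0].
Proof. by exists [::] => x ->; exists (fun=> 0); rewrite big_ord0. Qed.

Lemma findim_sum (I : Type) (r : seq I) (S : I -> set V) : (forall i, findim (S i)) ->
  findim [set z | exists2 x : I -> V, forall i, S i (x i) & z = \sum_(i <- r) x i].
Proof.
move=> fS; elim: r => [|i r IH].
  by apply: findim_sub findim0 => _ [x _ ->]; rewrite big_nil.
apply: findim_sub (findimD (fS i) IH) => _ [x Sx ->]; rewrite big_cons.
by exists (x i), (\sum_(j <- r) x j); split=> //; exists x.
Qed.

Lemma subspace_sum S (I : Type) (r : seq I) (c : I -> R) (x : I -> V) : subspace S ->
  (forall i, S (x i)) -> S (\sum_(i <- r) c i *: x i).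
Proof.
by move=> [S0 SD] Sx; elim: r => [|i r IH]; rewrite ?big_nil// big_cons; exact: SD.
Qed.

Lemma findim_basis S : subspace S -> findim S ->
  exists (n : nat) (e : 'I_n -> V), (forall i, S (e i)) /\
    forall x, S x -> exists c : 'rV[R]_n, x = \sum_i c 0 i *: e i.
Proof.
move=> sS [s Ss]; set n := size s.
pose comb (c : 'rV[R]_n) := \sum_(i < n) c 0 i *: s`_i.
pose Q r := `[< exists2 A : 'M[R]_(r, n), row_free A & forall i, S (comb (row i A)) >].
have Q0 : Q 0%N.
  by apply/asboolP; exists 0 => [|[]//]; rewrite /row_free mxrank0.
have Qn r : Q r -> (r <= n)%N.
  by move=> /asboolP[A /eqP rA _]; have := rank_leq_col A; rewrite rA.
have exQ : exists r, Q r by exists 0%N.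
case: (ex_maxnP exQ Qn) => r /asboolP[A fA SA] maxr.
exists r, (fun i => comb (row i A)); split=> // x Sx.
have [c xE] := Ss x Sx; pose cx : 'rV[R]_n := \row_i c i.
have {}xE : x = comb cx by rewrite xE; apply: eq_bigr => i _; rewrite mxE.
have : (cx <= A)%MS.
  apply: contrapT => cA; have /maxr : Q r.+1.
    apply/asboolP; rewrite -addn1; exists (col_mx A cx).
      rewrite /row_free eqn_leq rank_leq_row /=.
      have : (A < col_mx A cx)%MS.
        rewrite ltmxE -addsmxE addsmxSl/=; apply/negP => h; apply: cA.
        by apply: submx_trans h; rewrite -?addsmxE addsmxSr.
      move=> /rank_ltmx; have /eqP -> := fA => lt.
      by apply: leq_trans lt; rewrite addn1.
    move=> i; case: (split_ordP i) => j ->; first by rewrite rowKu.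
    by rewrite rowKd row_id -xE.
  by rewrite ltnn.
move=> /submxP[D cD]; exists D; rewrite xE cD /comb.
under [RHS]eq_bigr do rewrite scaler_sumr.
rewrite exchange_big; apply: eq_bigr => i _ /=; rewrite mxE scaler_suml.
by apply: eq_bigr => j _; rewrite scalerA !mxE.
Qed.

Lemma bilinear_solve S (B : V -> V -> R) (L : V -> R) : subspace S -> findim S ->
  (forall a x y z, S x -> S y -> S z -> B (a *: x + y) z = a * B x z + B y z) ->
  (forall a x y z, S x -> S y -> S z -> B z (a *: x + y) = a * B z x + B z y) ->
  (forall a x y, S x -> S y -> L (a *: x + y) = a * L x + L y) ->
  (forall x, S x -> (forall y, S y -> B x y = 0) -> x = 0) ->
  exists2 x, S x & forall y, S y -> B x y = L y.
Proof.
move=> sS fS Bl Br Ll inj; have [n [e [Se span]]] := findim_basis sS fS.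
have S0 := sS.1.
have lsum (f : V -> R) (c : 'rV[R]_n) : (forall a x y, S x -> S y -> f (a *: x + y) = a * f x + f y) ->
    f (\sum_i c 0 i *: e i) = \sum_i c 0 i * f (e i).
  move=> fl; have f0 : f 0 = 0.
    by have := fl (-1) 0 0 S0 S0; rewrite scaler0 addr0 mulN1r addNr.
  elim: (index_enum _) => [|i r IH]; rewrite ?big_nil// !big_cons fl ?IH//.
  exact: subspace_sum.
have comb (c : 'rV[R]_n) : S (\sum_i c 0 i *: e i) by exact: subspace_sum.
pose M : 'M[R]_n := \matrix_(i, j) B (e i) (e j).
pose l : 'rV[R]_n := \row_j L (e j).
have ME (c : 'rV[R]_n) j : (c *m M) 0 j = B (\sum_i c 0 i *: e i) (e j).
  rewrite mxE (lsum (B^~ (e j)))//; last by move=> *; exact: Bl.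
  by apply: eq_bigr => i _; rewrite mxE.
have ker (c : 'rV[R]_n) : c *m M = 0 -> \sum_i c 0 i *: e i = 0.
  move=> cM; apply: inj => // y /span[d ->].
  rewrite (lsum (B (\sum_i c 0 i *: e i))); last by move=> *; apply: Br.
  by apply: big1 => j _; rewrite -ME cM mxE mulr0.
have kT (c : 'rV[R]_n) : c *m M = 0 -> c *m M^T = 0.
  move=> /ker c0; apply/rowP => j; rewrite !mxE.
  have B0 : B (e j) 0 = 0.
    by have := Br (-1) 0 0 (e j) S0 S0 (Se j); rewrite scaler0 addr0 mulN1r addNr.
  rewrite -[RHS]B0 -c0 (lsum (B (e j))); last by move=> *; apply: Br.
  by apply: eq_bigr => i _; rewrite !mxE.
have sub : (kermx M <= kermx M^T)%MS.
  apply/rV_subP => c /sub_kermxP cM; apply/sub_kermxP; exact: kT.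
have eqk : (kermx M^T <= kermx M)%MS.
  by rewrite -(mxrank_leqif_sup sub) !mxrank_ker mxrank_tr.
have : (l <= M)%MS.
  rewrite submxE; apply/eqP/rowP => j; rewrite [RHS]mxE.
  pose c := row j (cokermx M)^T.
  have cM : c *m M = 0.
    apply/sub_kermxP; apply: submx_trans eqk; apply: (submx_trans (row_sub j _)).
    by apply/sub_kermxP; rewrite -trmx_mul mulmx_coker trmx0.
  have : L (\sum_i c 0 i *: e i) = 0.
    rewrite (ker c cM); have := Ll (-1) 0 0 S0 S0.
    by rewrite scaler0 addr0 mulN1r addNr.
  by rewrite lsum// => <-; rewrite mxE; apply: eq_bigr => i _; rewrite !mxE mulrC.
move=> /submxP[c lc]; exists (\sum_i c 0 i *: e i) => // y /span[d ->].
rewrite (lsum (B _)); last by move=> *; apply: Br.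
by rewrite lsum//; apply: eq_bigr => j _; rewrite -ME -lc mxE.
Qed.

End Span.

Lemma findim_image {V W : lmodType R} (f : V -> W) (S : set V) :
  (forall a x y, f (a *: x + y) = a *: f x + f y) -> findim S -> findim (f @` S).
Proof.
move=> fl [s Ss]; exists (map f s) => _ [x Sx <-]; have [c ->] := Ss x Sx.
exists c; rewrite size_map.
have f0 : f 0 = 0.
  by have := fl (-1) 0 0; rewrite scaler0 addr0 scaleN1r addNr.
transitivity (\sum_(i < size s) c i *: f s`_i).
  by elim: (index_enum _) => [|i r IH]; rewrite ?big_nil// !big_cons fl IH.
by apply: eq_bigr => i _; rewrite (nth_map 0).
Qed.

Lemma findim_Ppoly {d : nat} k : findim [set f : 'rV[R]_d -> R | Ppoly k f].
Proof.
elim: k => [|k IH].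
  exists [:: (fun=> 1) : 'rV[R]_d -> R] => f /Ppoly0E ->; exists (fun=> f 0).
  by rewrite big_ord1; apply/funext => x; exact: (esym (mulr1 _)).
pose m i (f : 'rV[R]_d -> R) (x : 'rV[R]_d) := x 0 i * f x.
have fm (i : 'I_d) : findim (m i @` [set f : 'rV[R]_d -> R | Ppoly k f]).
  apply: findim_image => // a f g; apply/funext => x.
  change (x 0 i * (a * f x + g x) = a * (x 0 i * f x) + x 0 i * g x).
  by ring.
have f0 : findim (range (fun (c : R) (_ : 'rV[R]_d) => c)).
  exists [:: (fun=> 1) : 'rV[R]_d -> R] => _ [c _ <-]; exists (fun=> c).
  by rewrite big_ord1; apply/funext => x; exact: (esym (mulr1 _)).
apply: findim_sub (findimD f0 (findim_sum (index_enum 'I_d) fm)) => f /Ppoly_split[g gk ->].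
exists (fun=> f 0), (\sum_i m i (g i)); split.
- by exists (f 0).
- by exists (fun i => m i (g i)) => // i; exists (g i) => //; exact: gk.
by apply/funext => x; rewrite fct_sumE.
Qed.

Lemma findim_Pvec {d : nat} k : findim [set v : 'rV[R]_d -> 'rV[R]_3 | Pvec k v].
Proof.
pose m i (f : 'rV[R]_d -> R) (x : 'rV[R]_d) : 'rV[R]_3 := f x *: delta_mx 0 i.
have fm (i : 'I_3) : findim (m i @` [set f : 'rV[R]_d -> R | Ppoly k f]).
  apply: findim_image; last exact: findim_Ppoly.
  move=> a f g; apply/funext => x.
  change ((a * f x + g x) *: delta_mx 0 i =
          a *: (f x *: delta_mx 0 i) + g x *: delta_mx 0 i :> 'rV[R]_3).
  by rewrite scalerDl scalerA.
apply: findim_sub (findim_sum (index_enum 'I_3) fm) => v vk.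
exists (fun i => m i (fun x => v x 0 i)) => [i|].
  by exists (fun x => v x 0 i) => //; exact: vk.
apply/funext => x; rewrite fct_sumE /m; apply/rowP => j.
rewrite summxE (bigD1 j)//= big1 => [|i ij]; rewrite !mxE.
  by rewrite !eqxx mulr1 addr0.
by rewrite [j == i]eq_sym (negbTE ij) andbF mulr0.
Qed.

Lemma findim_family {I : finType} {V : lmodType R} (S : I -> set V) :
  (forall i, findim (S i)) -> findim [set x : I -> V | forall i, S i (x i)].
Proof.
move=> fS; pose m i (x : V) : I -> V := fun j => if j == i then x else 0.
have fm i : findim (m i @` S i).
  apply: findim_image => // a x y; apply/funext => j.
  change ((if j == i then a *: x + y else 0) =
          a *: (if j == i then x else 0) + (if j == i then y else 0)).
  by case: ifP; rewrite ?scaler0 ?addr0.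
apply: findim_sub (findim_sum (index_enum I) fm) => x Sx.
exists (fun i => m i (x i)) => [i|]; first by exists (x i).
apply/funext => j; rewrite fct_sumE /m (bigD1 j)//= eqxx big1 ?addr0// => i ij.
by rewrite eq_sym (negbTE ij).
Qed.

Lemma findim_pair {V W : lmodType R} (S : set V) (T : set W) :
  findim S -> findim T -> findim [set z : V * W | S z.1 /\ T z.2].
Proof.
move=> fS fT.
have f1 : findim ((fun x => (x, 0) : V * W) @` S).
  apply: findim_image => // a x y.
  by change ((a *: x + y, 0) = (a *: x + y, a *: 0 + 0) :> V * W); rewrite scaler0 addr0.
have f2 : findim ((fun x => (0, x) : V * W) @` T).
  apply: findim_image => // a x y.
  by change ((0, a *: x + y) = (a *: 0 + 0, a *: x + y) :> V * W); rewrite scaler0 addr0.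
apply: findim_sub (findimD f1 f2) => -[x y] [/= Sx Ty].
exists (x, 0), (0, y); split; [by exists x|by exists y|].
by change ((x, y) = (x + 0, 0 + y)); rewrite add0r addr0.
Qed.

End FiniteDimension.



Section TangentialSpace.
Context {R : realType}.

Lemma Pvec_le {d : nat} k l (v : 'rV[R]_d -> 'rV[R]_3) : (k <= l)%N -> Pvec k v -> Pvec l v.
Proof. by move=> kl vk i; exact: Ppoly_le kl (vk i). Qed.

Lemma Ppoly_eqf {d : nat} k (f g : 'rV[R]_d -> R) : (forall x, f x = g x) -> Ppoly k f -> Ppoly k g.
Proof. by move=> /funext ->. Qed.

Lemma Pvec_lin {d : nat} k a (u v : 'rV[R]_d -> 'rV[R]_3) : Pvec k u -> Pvec k v ->
  Pvec k (fun x => a *: u x + v x).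
Proof.
by move=> pu pv i; apply: Ppoly_eqf (PpolyD (PpolyZ a (pu i)) (pv i)) => x; rewrite !mxE.
Qed.

Lemma Pvec0 {d : nat} k : Pvec k (fun _ : 'rV[R]_d => 0).
Proof. by move=> i; apply: Ppoly_eqf (Ppoly_cst k 0) => x; rewrite mxE. Qed.

Lemma Pvec_mul {d : nat} k (v : 'rV[R]_d -> 'rV[R]_3) (A : 'M[R]_3) : Pvec k v ->
  Pvec k (fun x => v x *m A).
Proof.
move=> pv i; apply: Ppoly_eqf (Ppoly_sum (index_enum 'I_3) (P := xpredT)
  (fun j _ => PpolyZ (A j i) (pv j))) => x.
by rewrite mxE; apply: eq_bigr => j _; rewrite mulrC.
Qed.

Lemma Pvec_cross {d : nat} k n (v : 'rV[R]_d -> 'rV[R]_3) : Pvec k v ->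
  Pvec k (fun x => cross n (v x)).
Proof.
move=> pv i; apply: Ppoly_eqf (PpolyB (PpolyZ (n 0 (i + 1)) (pv (i + 2)))
  (PpolyZ (n 0 (i + 2)) (pv (i + 1)))) => x.
by rewrite mxE.
Qed.

Lemma Pvec_tang {d : nat} k n (v : 'rV[R]_d -> 'rV[R]_3) : Pvec k v ->
  Pvec k (fun x => tang n (v x)).
Proof.
move=> pv; have : Pvec k (fun x => cross n (- cross n (v x))).
  apply: Pvec_cross => i; apply: Ppoly_eqf (PpolyN (Pvec_cross n pv i)) => x.
  by rewrite [RHS]mxE.
by congr Pvec; apply/funext => x; rewrite /tang -crossC.
Qed.

Lemma Pvec_grad_frame {d : nat} k (f : 'rV[R]_d.+1 -> R) (A : 'M[R]_(d.+1, 3)) : Ppoly k f ->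
  Pvec k.-1 (fun y => grad f y *m A).
Proof.
move=> pf i; apply: Ppoly_eqf (Ppoly_sum (index_enum 'I_d.+1) (P := xpredT)
  (fun j _ => PpolyZ (A j i) (Ppoly_partial j pf))) => x.
by rewrite mxE; apply: eq_bigr => j _; rewrite mxE mulrC.
Qed.

Context {Th : mesh R} {Omega : set 'rV[R]_3}.
Hypothesis conf : conforming_polyhedral Th Omega.
Local Notation faces := 'I_(nface Th).
Implicit Types (F : faces).

Lemma MtF_Pvec k F mu : MtF k F mu -> Pvec k.+1 mu.
Proof.
move=> [p [q [pp hq /funext ->]]]; apply: Pvec_tang => i.
have := PpolyD (Ppoly_le (leqnSn k) (pp i))
  (Pvec_grad_frame (frame F) (Phomog_poly hq) i).
by apply: Ppoly_eqf => x; rewrite [RHS]mxE.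
Qed.

Lemma MtF_polyv k F mu : MtF k F mu -> polyv mu.
Proof. by move=> /MtF_Pvec; exact: Pvec_polyv. Qed.

Lemma MtF_normal k F mu y : MtF k F mu -> dot (mu y) (face_normal F) = 0.
Proof. by move=> [p [q [_ _ ->]]]; exact: dot_tangn. Qed.

Lemma MtF_lin k F a mu nu : MtF k F mu -> MtF k F nu -> MtF k F (fun y => a *: mu y + nu y).
Proof.
move=> [p [q [pp hq /funext muE]]] [p' [q' [pp' hq' /funext nuE]]].
exists (fun y => a *: p y + p' y), (fun y => a * q y + q' y); split.
- exact: Pvec_lin.
- by apply: PhomogD => //; exact: PhomogZ.
move=> y; rewrite muE nuE -tangZ -tangD; congr tang.
have -> : grad (fun y => a * q y + q' y) y = a *: grad q y + grad q' y.
  apply/rowP => i; rewrite !mxE.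
  have dq : differentiable q y := Ppoly_diff y (Phomog_poly hq).
  have dq' : differentiable q' y := Ppoly_diff y (Phomog_poly hq').
  transitivity (partial i (fun y => a * q y) y + partial i q' y).
    by apply: partialD => //; apply: Ppoly_diff; apply: PpolyZ (Phomog_poly hq).
  by congr (_ + _); exact: partialZ.
by rewrite mulmxDl -scalemxAl scalerDr addrACA.
Qed.

Lemma grad_cst {d : nat} (c : R) (y : 'rV[R]_d.+1) : grad (fun=> c) y = 0.
Proof. by apply/rowP => i; rewrite !mxE partial_cst. Qed.

Lemma MtF_tang k F (p : 'rV[R]_2 -> 'rV[R]_3) : Pvec k p ->
  MtF k F (fun y => tang (face_normal F) (p y)).
Proof.
move=> pp; exists p, (fun=> 0); split=> // [|y]; first exact: Phomog0.
by rewrite grad_cst mul0mx addr0.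
Qed.

Lemma MtF0 k F : MtF k F (fun=> 0).
Proof. by have := MtF_tang F (Pvec0 k); congr MtF; apply/funext => y; rewrite tang0. Qed.

Lemma Pvec_chart k F (v : 'rV[R]_3 -> 'rV[R]_3) : Pvec k v -> Pvec k (fun y => v (chart F y)).
Proof. by move=> pv i; exact: (Ppoly_comp (chart_poly F) (pv i)). Qed.

Lemma grad_chart F (f : 'rV[R]_3 -> R) y : differentiable f (chart F y) ->
  grad (fun y => f (chart F y)) y = grad f (chart F y) *m (frame F)^T.
Proof.
move=> df; apply/rowP => j; rewrite !mxE.
have E : (fun h : R => h^-1 *: (((fun y => f (chart F y)) \o shift y) (h *: delta_mx 0 j)
              - f (chart F y))) =
    (fun h : R => h^-1 *: ((f \o shift (chart F y)) (h *: (delta_mx 0 j *m frame F))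
              - f (chart F y))).
  apply/funext => h; rewrite /= /chart mulmxDl -scalemxAl.
  by congr (_ *: (f _ - _)); rewrite addrCA.
transitivity ('D_(delta_mx 0 j *m frame F) f (chart F y)).
  by rewrite /partial /derive E.
rewrite derive_partial//; apply: eq_bigr => i _.
by rewrite -rowE !mxE mulrC.
Qed.

Lemma MtF_grad k F (phi : 'rV[R]_3 -> R) : Ppoly k.+2 phi ->
  MtF k F (fun y => tang (face_normal F) (grad phi (chart F y))).
Proof.
move=> pphi; have := Ppoly_comp (chart_poly F) pphi.
move=> /Ppoly_homog_split[f1 [f2 [pf1 hf2 fE]]].
exists (fun y => grad f1 y *m frame F), f2; split=> //.
  exact: (Pvec_grad_frame (frame F) pf1).
move=> y; rewrite -mulmxDl.
have -> : grad f1 y + grad f2 y = grad (fun y => phi (chart F y)) y.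
  rewrite fE; apply/rowP => i; rewrite !mxE; apply/esym.
  apply: partialD; first exact: Ppoly_diff pf1.
  exact: Ppoly_diff (Phomog_poly hf2).
rewrite grad_chart; last exact: Ppoly_diff pphi.
by rewrite -(tang_frame (frameF conf F)) -/(face_normal F) [RHS]tang_id ?dot_tangn// (face_normal_unit conf).
Qed.

Lemma MtF_subspace k F : subspace [set mu | MtF k F mu].
Proof. by split=> [|a x y]; [exact: MtF0|exact: MtF_lin]. Qed.

Lemma MtF_findim k F : findim [set mu | MtF k F mu].
Proof. by apply: findim_sub (findim_Pvec k.+1) => mu; exact: MtF_Pvec. Qed.

Definition is_PM k F (v mu : 'rV[R]_2 -> 'rV[R]_3) :=
  MtF k F mu /\ forall eta, MtF k F eta ->
    int2 (fdom F) (fun y => dot (mu y - v y) (eta y)) = 0.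

Lemma int2_dot_lin F a (u v w : 'rV[R]_2 -> 'rV[R]_3) : polyv u -> polyv v -> polyv w ->
  int2 (fdom F) (fun y => dot (a *: u y + v y) (w y)) =
  a * int2 (fdom F) (fun y => dot (u y) (w y)) + int2 (fdom F) (fun y => dot (v y) (w y)).
Proof.
move=> pu pv pw; rewrite -(int2Z conf); last exact: polyf_dot.
rewrite -(int2D conf); [|by apply: polyfZ; exact: polyf_dot|exact: polyf_dot].
by congr int2; apply/funext => y; rewrite dotDl dotZl.
Qed.

Lemma is_PM_unique k F v mu mu' : polyv v -> is_PM k F v mu -> is_PM k F v mu' -> mu = mu'.
Proof.
move=> pv [Mmu Hmu] [Mmu' Hmu']; apply/funext => y; apply/eqP; rewrite -subr_eq0; apply/eqP.
have Md : MtF k F (fun y => mu y - mu' y).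
  by have := MtF_lin (-1) Mmu' Mmu; congr MtF; apply/funext => z; rewrite scaleN1r addrC.
have pmu := MtF_polyv Mmu; have pmu' := MtF_polyv Mmu'; have pd := MtF_polyv Md.
move: y; apply: (int2_dot_eq0 conf pd).
have := Hmu _ Md; have := Hmu' _ Md.
move=> h' h; rewrite -[RHS](subrr 0) -[X in _ = X - _]h -[X in _ = _ - X]h'.
rewrite -(int2B conf); [|by apply: polyf_dot => //; exact: polyvB..].
by congr int2; apply/funext => y; rewrite -dotBl opprB addrA subrK.
Qed.

Lemma PMP k F v : polyv v -> is_PM k F v (PM k F v).
Proof.
move=> pv; apply: (@xgetPex _ (fun=> 0) [set mu | is_PM k F v mu]).
pose B (x y : 'rV[R]_2 -> 'rV[R]_3) := int2 (fdom F) (fun z => dot (x z) (y z)).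
have Bl a (x y z : 'rV[R]_2 -> 'rV[R]_3) : MtF k F x -> MtF k F y -> MtF k F z ->
    B (a *: x + y) z = a * B x z + B y z.
  by move=> /MtF_polyv px /MtF_polyv py /MtF_polyv pz; exact: int2_dot_lin.
have BC (x y : 'rV[R]_2 -> 'rV[R]_3) : B x y = B y x.
  by congr int2; apply/funext => z; rewrite dotC.
have [|||x Mx xE] := @bilinear_solve _ _ [set mu | MtF k F mu] B (B v)
    (MtF_subspace k F) (MtF_findim k F) Bl.
- by move=> a x y z Mx My Mz; rewrite ![B z _]BC; exact: Bl.
- move=> a x y /MtF_polyv px /MtF_polyv py; rewrite ![B v _]BC; exact: int2_dot_lin.
- by move=> x Mx h; apply/funext; apply: (int2_dot_eq0 conf (MtF_polyv Mx)); exact: h.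
exists x; split=> // eta Meta; have := xE eta Meta => /eqP; rewrite -subr_eq0 => /eqP <-.
have pe := MtF_polyv Meta; rewrite /B -(int2B conf); first last.
- exact: polyf_dot.
- by apply: polyf_dot => //; exact: MtF_polyv Mx.
by congr int2; apply/funext => y; rewrite dotBl.
Qed.

Lemma PM_MtF k F v : MtF k F (PM k F v).
Proof. by rewrite /PM; case: xgetP => [mu _ [//]|_]; exact: MtF0. Qed.

Lemma PM_id k F mu : MtF k F mu -> PM k F mu = mu.
Proof.
move=> Mmu; have pm := MtF_polyv Mmu; apply: (is_PM_unique pm (PMP k F pm)).
split=> // eta _; transitivity (int2 (fdom F) (fun=> 0)); last exact: coordint0.
by congr int2; apply/funext => y; rewrite subrr dot0l.
Qed.

Lemma PM_lin k F a u v : polyv u -> polyv v ->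
  PM k F (fun y => a *: u y + v y) = fun y => a *: PM k F u y + PM k F v y.
Proof.
move=> pu pv; have puv : polyv (fun y => a *: u y + v y).
  exact: (polyvD (polyvZ (polyf_cst a) pu) pv).
apply: (is_PM_unique puv (PMP k F puv)).
have [Mu Hu] := PMP k F pu; have [Mv Hv] := PMP k F pv; split; first exact: MtF_lin.
move=> eta Me; have pe := MtF_polyv Me.
have pPu := MtF_polyv Mu; have pPv := MtF_polyv Mv.
have := int2_dot_lin F a (polyvB pPu pu) (polyvB pPv pv) pe.
rewrite Hu// Hv// mulr0 addr0 => h; rewrite -[RHS]h; congr int2; apply/funext => y.
by congr dot; rewrite scalerBr opprD addrACA.
Qed.

End TangentialSpace.



Section Energy.
Context {R : realType} {Th : mesh R} {Omega : set 'rV[R]_3}.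
Hypothesis conf : conforming_polyhedral Th Omega.
Local Notation cells := 'I_(ncell Th).
Local Notation faces := 'I_(nface Th).
Implicit Types (K : cells) (F : faces).

Lemma int3_ge0 (A : set 'rV[R]_3) f : (forall x, A x -> 0 <= f x) -> 0 <= int3 A f.
Proof. by move=> h; exact: (coordint_ge0 (leb3 R) pt3 h). Qed.

Lemma int2_ge0 (A : set 'rV[R]_2) f : (forall x, A x -> 0 <= f x) -> 0 <= int2 A f.
Proof. by move=> h; exact: (coordint_ge0 (leb2 R) pt2 h). Qed.

Lemma eq_ipT (phi psi : bscal Th) : (forall K x, phi K x = psi K x) -> ipT phi = ipT psi.
Proof. by move=> e; congr ipT; apply/funext => K; apply/funext => x. Qed.

Lemma eq_ipdT (phi psi : cells -> fscal Th) :
  (forall K F y, on_bd (cell K) F -> phi K F y = psi K F y) -> ipdT phi = ipdT psi.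
Proof.
move=> e; apply: eq_bigr => K _; apply: eq_bigr => F bF; congr int2.
by apply/funext => y; exact: e.
Qed.

Lemma ipT_lin a (phi psi chi : bscal Th) :
  (forall K, polyf (phi K)) -> (forall K, polyf (psi K)) ->
  (forall K x, chi K x = a * phi K x + psi K x) -> ipT chi = a * ipT phi + ipT psi.
Proof.
move=> p1 p2 e; rewrite (eq_ipT e) /ipT mulr_sumr -big_split; apply: eq_bigr => K _ /=.
rewrite -(int3Z conf); last exact: p1.
by rewrite -(int3D conf); [|apply: polyfZ; exact: p1|exact: p2].
Qed.

Lemma ipdT_lin a (phi psi chi : cells -> fscal Th) :
  (forall K F, on_bd (cell K) F -> polyf (phi K F)) ->
  (forall K F, on_bd (cell K) F -> polyf (psi K F)) ->
  (forall K F y, on_bd (cell K) F -> chi K F y = a * phi K F y + psi K F y) ->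
  ipdT chi = a * ipdT phi + ipdT psi.
Proof.
move=> p1 p2 e; rewrite (eq_ipdT e) /ipdT mulr_sumr -big_split; apply: eq_bigr => K _ /=.
rewrite mulr_sumr -big_split; apply: eq_bigr => F bF /=.
rewrite -(int2Z conf); last exact: p1.
by rewrite -(int2D conf); [|apply: polyfZ; exact: p1|exact: p2].
Qed.

Lemma ipdTD (phi psi : cells -> fscal Th) :
  (forall K F, on_bd (cell K) F -> polyf (phi K F)) ->
  (forall K F, on_bd (cell K) F -> polyf (psi K F)) ->
  ipdT phi + ipdT psi = ipdT (fun K F y => phi K F y + psi K F y).
Proof. by move=> p1 p2; rewrite -[X in X + _]mul1r; apply/esym/ipdT_lin => // *; rewrite mul1r. Qed.

Lemma ipdTB (phi psi : cells -> fscal Th) :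
  (forall K F, on_bd (cell K) F -> polyf (phi K F)) ->
  (forall K F, on_bd (cell K) F -> polyf (psi K F)) ->
  ipdT phi - ipdT psi = ipdT (fun K F y => phi K F y - psi K F y).
Proof.
by move=> p1 p2; rewrite addrC -mulN1r; apply/esym/ipdT_lin => // *; rewrite mulN1r addrC.
Qed.

Lemma ipT_eq0 (phi : bscal Th) : (forall K x, phi K x = 0) -> ipT phi = 0.
Proof.
move=> h; rewrite /ipT big1// => K _; transitivity (int3 (cell K) (fun=> 0)).
  by congr int3; apply/funext => x.
exact: coordint0.
Qed.

Lemma ipdT_eq0 (phi : cells -> fscal Th) :
  (forall K F y, on_bd (cell K) F -> phi K F y = 0) -> ipdT phi = 0.
Proof.
move=> h; rewrite /ipdT big1// => K _; rewrite big1// => F bF.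
transitivity (int2 (fdom F) (fun=> 0)); last exact: coordint0.
by congr int2; apply/funext => y; exact: h.
Qed.

Lemma green_curlT (u v : bvec Th) : (forall K, polyv (u K)) -> (forall K, polyv (v K)) ->
  ipT (fun K x => dot (curl (u K) x) (v K x)) - ipT (fun K x => dot (u K x) (curl (v K) x)) =
  ipdT (fun K F y => dot (cross (nrm K F) (u K (chart F y))) (v K (chart F y))).
Proof.
move=> pu pv; rewrite /ipT -sumrB; apply: eq_bigr => K _.
exact: (green_curl conf).
Qed.

Lemma green_divT (p : bscal Th) (v : bvec Th) : (forall K, polyf (p K)) -> (forall K, polyv (v K)) ->
  ipT (fun K x => p K x * divg (v K) x) + ipT (fun K x => dot (grad (p K) x) (v K x)) =
  ipdT (fun K F y => p K (chart F y) * dot (v K (chart F y)) (nrm K F)).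
Proof.
move=> pu pv; rewrite /ipT -big_split; apply: eq_bigr => K _.
exact: (green_div conf).
Qed.

Lemma ipT_dot_eq0 (v : bvec Th) : (forall K, polyv (v K)) ->
  ipT (fun K x => dot (v K x) (v K x)) = 0 -> forall K x, v K x = 0.
Proof.
move=> pv /eqP; rewrite /ipT psumr_eq0 => [/allP h K|K _]; last first.
  by apply: int3_ge0 => x _; exact: dotvv_ge0.
by apply: (int3_dot_eq0 conf (pv K)); apply/eqP; apply: h; rewrite mem_index_enum.
Qed.

Lemma ipdT_ge0 (phi : cells -> fscal Th) :
  (forall K F y, on_bd (cell K) F -> 0 <= phi K F y) -> 0 <= ipdT phi.
Proof.
move=> h; apply: sumr_ge0 => K _; apply: sumr_ge0 => F bF.
by apply: int2_ge0 => y _; exact: h.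
Qed.

Lemma ipdT_int2_eq0 (phi : cells -> fscal Th) :
  (forall K F y, on_bd (cell K) F -> 0 <= phi K F y) -> ipdT phi = 0 ->
  forall K F, on_bd (cell K) F -> int2 (fdom F) (phi K F) = 0.
Proof.
move=> h /eqP; have h' K F : on_bd (cell K) F -> 0 <= int2 (fdom F) (phi K F).
  by move=> bF; apply: int2_ge0 => y _; exact: h.
rewrite /ipdT psumr_eq0 => [/allP H K F bF|K _]; last by apply: sumr_ge0 => F; exact: h'.
have /implyP/(_ isT) := H K (mem_index_enum _).
rewrite psumr_eq0 => [/allP H'|F' bF']; last exact: h'.
by have /implyP/(_ bF)/eqP := H' F (mem_index_enum _).
Qed.

Section Tangential.
Context {K : cells} {F : faces}.
Hypothesis bF : on_bd (cell K) F.

Lemma tang_nrm v : tang (nrm K F) v = tang (face_normal F) v.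
Proof. by have [->|->] := nrmE conf bF; rewrite ?tangN. Qed.

Lemma MtF_nrm k mu y : MtF k F mu -> dot (mu y) (nrm K F) = 0.
Proof.
by move=> /MtF_normal h; have [->|->] := nrmE conf bF; rewrite ?dotNr h ?oppr0.
Qed.

Lemma MtF_cross k (r : 'rV[R]_2 -> 'rV[R]_3) : Pvec k r ->
  MtF k F (fun y => cross (nrm K F) (r y)).
Proof.
move=> pr; have := MtF_tang F (Pvec_cross (nrm K F) pr); congr MtF.
by apply/funext => y; rewrite -tang_nrm tang_id ?(nrm_unit conf)// dot_crossvl.
Qed.

End Tangential.

End Energy.



Lemma energy_arith (R : realFieldType) (A1 A2 A3 B1 B2 B3 B4 C1 C2 D E G1 G2 : R) :
  A1 - A2 + A3 = 0 -> B1 - B2 + B3 + B4 = 0 -> - C1 + C2 = 0 -> D = 0 -> E = 0 ->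
  B1 - A2 = G1 -> B2 + C1 = G2 -> A1 + (G1 + A3 + B3 + D) + (C2 - E - G2 + B4) = 0.
Proof. lra. Qed.

Lemma add3_ge0_eq0 (R : realFieldType) (a b c : R) : 0 <= a -> 0 <= b -> 0 <= c ->
  a + b + c = 0 -> [/\ a = 0, b = 0 & c = 0].
Proof. by move=> *; split; lra. Qed.

Section HomogeneousSystem.
Context {R : realType} {Th : mesh R} {Omega : set 'rV[R]_3}.
Hypothesis conf : conforming_polyhedral Th Omega.
Local Notation cells := 'I_(ncell Th).
Local Notation faces := 'I_(nface Th).
Implicit Types (K : cells) (F : faces).
Variables (k : nat) (taut : R) (taun : faces -> R).
Hypothesis taut_gt0 : 0 < taut.
Hypothesis taun_ge0 : forall F, 0 <= taun F.
Variable s : hdg_unknowns Th.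
Hypothesis hs : hdg_system k taut (un_g taun) Omega (fun=> 0) (fun=> 0) s.
Let w := w_h s.
Let u := u_h s.
Let p := p_h s.

Let ww : Wh k w. Proof. by case: hs => -[]. Qed.
Let uu : Vh k u. Proof. by case: hs => -[]. Qed.
Let pp : Qh k p. Proof. by case: hs => -[]. Qed.
Let mm : Mthg k Omega (fun=> 0) (uhat s). Proof. by case: hs => -[]. Qed.
Let zz : Mh0 k Omega (phat s). Proof. by case: hs => -[]. Qed.

Let pw K : polyv (w K). Proof. exact: Pvec_polyv (ww K). Qed.
Let pu K : polyv (u K). Proof. exact: Pvec_polyv (uu K). Qed.
Let ppp K : polyf (p K). Proof. exact: Ppoly_polyf (pp K). Qed.
Let puh F : polyv (uhat s F). Proof. exact: MtF_polyv (mm.1 F). Qed.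
Let pph F : polyf (phat s F). Proof. exact: Ppoly_polyf (zz F).1. Qed.

Lemma uhat_bd F : on_bd Omega F -> uhat s F = fun=> 0.
Proof.
move=> bF; rewrite (mm.2 F bF) -[RHS](PM_id conf (MtF0 k F)); congr PM.
by apply/funext => y; rewrite cross0r.
Qed.

Let ut K F y := tang (nrm K F) (u K (chart F y)).

Let put K F : polyv (ut K F).
Proof. by apply: polyv_tang; exact: polyv_chart. Qed.

Let b K F y := PM k F (ut K F) y - uhat s F y.

Let Mb K F : MtF k F (b K F).
Proof.
have := MtF_lin (-1) (mm.1 F) (PM_MtF k F (ut K F)); congr MtF.
by apply/funext => y; rewrite scaleN1r addrC.
Qed.

Let pb K F : polyv (b K F). Proof. exact: MtF_polyv (Mb K F). Qed.

Let pwhat K F : polyv (what k taut s K F).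
Proof.
apply: polyvD; first exact: (polyv_chart F (pw K)).
apply: polyvZ; first exact: polyf_cst.
exact: (polyv_cross (pb K F) (polyv_cst (nrm K F))).
Qed.

Let pun K F : polyf (un_g taun s K F).
Proof.
apply: polyfD; first exact: (polyf_dot (polyv_chart F (pu K)) (polyv_cst _)).
exact: (polyfZ (taun F) (polyfB (polyf_chart F (ppp K)) (pph F))).
Qed.

Lemma flux_identity K F y : on_bd (cell K) F ->
  dot (cross (nrm K F) (u K (chart F y))) (w K (chart F y)) +
  dot (cross (uhat s F y) (nrm K F)) (w K (chart F y)) +
  dot (what k taut s K F y) (cross (u K (chart F y)) (nrm K F)) +
  dot (cross (what k taut s K F y) (nrm K F)) (uhat s F y) =
  taut * dot (b K F y) (ut K F y - uhat s F y).
Proof.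
move=> bF; set n := nrm K F; set U := u K _; set W := w K _; set h := uhat s F y.
have -> : what k taut s K F y = W + taut *: cross (b K F y) n by [].
have n1 : dot n n = 1 := nrm_unit conf bF.
have bn : dot (b K F y) n = 0 := MtF_nrm conf bF y (Mb K F).
have hn : dot h n = 0 := MtF_nrm conf bF y (mm.1 F).
have bU : dot (b K F y) (ut K F y) = dot (b K F y) U.
  by rewrite dotC dot_tangl// dotC.
rewrite dotBr bU; move: (b K F y) bn => B bn.
rewrite crossDl crossZl !dotDl !dotZl dot_cross n1 bn.
have -> : dot (cross (cross B n) n) h = - dot B h.
  rewrite crossC cross_cross n1 scale1r dotNl (dotC n B) bn.
  by rewrite dotBl dotZl mul0r subr0.
have -> : dot (cross n U) W = - dot W (cross U n) by rewrite dotC crossC dotNr.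
have -> : dot (cross W n) h = - dot (cross h n) W.
  by rewrite dot_crossA crossC dotNr dotC.
ring.
Qed.

Lemma energy_identity :
  ipT (fun K x => dot (w K x) (w K x)) +
  taut * ipdT (fun K F y => dot (b K F y) (b K F y)) +
  ipdT (fun K F y => taun F * (p K (chart F y) - phat s F y) ^+ 2) = 0.
Proof.
have [_ [e1 e2 e3 e4 e5]] := hs.
have {}e1 := e1 _ ww; have {}e2 := e2 _ uu; have {}e3 := e3 _ pp.
have {}e4 := e4 _ mm; have {}e5 := e5 _ zz.
have gc := green_curlT conf pu pw; have gd := green_divT conf ppp pu.
have f0 : ipT (fun K x => dot (0 : 'rV[R]_3) (u K x)) = 0.
  by apply: ipT_eq0 => K x; rewrite dot0l.
rewrite f0 in e2.
have pWc K F : polyv (fun y => w K (chart F y)) by exact: polyv_chart.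
have pUc K F : polyv (fun y => u K (chart F y)) by exact: polyv_chart.
have pPc K F : polyf (fun y => p K (chart F y)) by exact: polyf_chart.
have pn K F : polyv (fun _ : 'rV[R]_2 => nrm K F) by exact: polyv_cst.
pose g1 K F y := dot (cross (nrm K F) (u K (chart F y))) (w K (chart F y)).
pose g2 K F y := dot (cross (uhat s F y) (nrm K F)) (w K (chart F y)).
pose g3 K F y := dot (what k taut s K F y) (cross (u K (chart F y)) (nrm K F)).
pose g4 K F y := dot (cross (what k taut s K F y) (nrm K F)) (uhat s F y).
have q1 K F : polyf (g1 K F) by apply: polyf_dot => //; exact: (polyv_cross (pn K F) (pUc K F)).
have q2 K F : polyf (g2 K F) by apply: polyf_dot => //; exact: (polyv_cross (puh F) (pn K F)).
have q3 K F : polyf (g3 K F) by apply: polyf_dot => //; exact: (polyv_cross (pUc K F) (pn K F)).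
have q4 K F : polyf (g4 K F) by apply: polyf_dot => //; exact: (polyv_cross (pwhat K F) (pn K F)).
have qb K F : polyf (fun y => dot (b K F y) (b K F y)) by exact: polyf_dot.
have H1 : ipdT g1 + ipdT g2 + ipdT g3 + ipdT g4 =
    taut * ipdT (fun K F y => dot (b K F y) (b K F y)).
  have q12 K F := polyfD (q1 K F) (q2 K F).
  have q123 K F := polyfD (q12 K F) (q3 K F).
  rewrite (ipdTD conf)// (ipdTD conf)// (ipdTD conf)//.
  rewrite -[RHS]addr0; have orth : ipdT (fun K F y => dot (PM k F (ut K F) y - ut K F y) (b K F y)) = 0.
    apply: big1 => K _; apply: big1 => F bF.
    by have [_ ->] := PMP conf k F (put K F).
  rewrite -[X in _ = _ + X](mulr0 (- taut)) -[X in _ = _ + _ * X]orth [RHS]addrC.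
  have qo K F : polyf (fun y => dot (PM k F (ut K F) y - ut K F y) (b K F y)).
    apply: polyf_dot => //; apply: polyvB => //.
    exact: MtF_polyv (PM_MtF k F _).
  rewrite -[X in _ = _ + X]mul1r.
  have qtb K F : polyf (fun y => taut * dot (b K F y) (b K F y)) by exact: polyfZ.
  have -> : 1 * (taut * ipdT (fun K F y => dot (b K F y) (b K F y))) =
      ipdT (fun K F y => taut * dot (b K F y) (b K F y)).
    rewrite mul1r -[LHS]addr0.
    rewrite -(ipdT_eq0 (phi := fun K F y => 0) (fun _ _ _ _ => erefl)).
    apply/esym/(ipdT_lin conf) => // [K F _|K F y _]; first exact: polyf_cst.
    by rewrite addr0.
  apply: (ipdT_lin conf) => // K F y bF.
  have -> : g1 K F y + g2 K F y + g3 K F y + g4 K F y =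
      taut * dot (b K F y) (ut K F y - uhat s F y) := flux_identity y bF.
  have -> : ut K F y - uhat s F y = b K F y - (PM k F (ut K F) y - ut K F y).
    by rewrite /b opprB [RHS]addrC subrKA.
  rewrite dotBr (dotC (b K F y) (PM _ _ _ _ - _)).
  move: (dot _ _) (dot _ _) => c d; ring.
pose h1 K F y := un_g taun s K F y * p K (chart F y).
pose h2 K F y := un_g taun s K F y * phat s F y.
pose h3 K F y := p K (chart F y) * dot (u K (chart F y)) (nrm K F).
pose h4 K F y := phat s F y * dot (u K (chart F y)) (nrm K F).
have r1 K F : polyf (h1 K F) by exact: polyfM.
have r2 K F : polyf (h2 K F) by exact: polyfM.
have r3 K F : polyf (h3 K F) by apply: polyfM => //; exact: polyf_dot.
have r4 K F : polyf (h4 K F) by apply: polyfM => //; exact: polyf_dot.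
have H2 : ipdT h1 - ipdT h2 - ipdT h3 + ipdT h4 =
    ipdT (fun K F y => taun F * (p K (chart F y) - phat s F y) ^+ 2).
  have r12 K F := polyfB (r1 K F) (r2 K F).
  have r123 K F := polyfB (r12 K F) (r3 K F).
  rewrite (ipdTB conf)// (ipdTB conf)// (ipdTD conf)//; apply: eq_ipdT => K F y _.
  by rewrite /h1 /h2 /h3 /h4 /un_g -/u -/p; ring.
rewrite -H1 -H2.
have c1 : ipT (fun K x => dot (w K x) (curl (u K) x)) = ipT (fun K x => dot (curl (u K) x) (w K x)).
  by apply: eq_ipT => K x; rewrite dotC.
have c2 : ipT (fun K x => dot (u K x) (grad (p K) x)) = ipT (fun K x => dot (grad (p K) x) (u K x)).
  by apply: eq_ipT => K x; rewrite dotC.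
rewrite -c1 in gc; rewrite -c2 in gd.
exact: (energy_arith e1 e2 e3 e4 e5 gc gd).
Qed.

Lemma energy_zero : (forall K x, w K x = 0) /\
  (forall K F y, on_bd (cell K) F -> PM k F (ut K F) y = uhat s F y /\
     taun F * (p K (chart F y) - phat s F y) = 0).
Proof.
have E := energy_identity.
have E1 : 0 <= ipT (fun K x => dot (w K x) (w K x)).
  by apply: sumr_ge0 => K _; apply: int3_ge0 => x _; exact: dotvv_ge0.
have b0 K F y : on_bd (cell K) F -> 0 <= dot (b K F y) (b K F y) by move=> _; exact: dotvv_ge0.
have t0 K F y : on_bd (cell K) F -> 0 <= taun F * (p K (chart F y) - phat s F y) ^+ 2.
  by move=> _; rewrite mulr_ge0// sqr_ge0.
have E2 := ipdT_ge0 b0; have E3 := ipdT_ge0 t0.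
have E2' : 0 <= taut * ipdT (fun K F y => dot (b K F y) (b K F y)).
  by rewrite mulr_ge0// ltW.
have [Z1 Z2 Z3] := add3_ge0_eq0 E1 E2' E3 E.
split; first exact: (ipT_dot_eq0 conf pw Z1).
move=> K F y bF; split.
  apply/eqP; rewrite -subr_eq0; apply/eqP; move: y.
  apply: (int2_dot_eq0 conf (pb K F)); apply: (ipdT_int2_eq0 b0) => //.
  by move/eqP: Z2; rewrite mulf_eq0 gt_eqF//= => /eqP.
have := ipdT_int2_eq0 t0 Z3 bF => /(int2_pos_eq0 conf) H.
have /eqP := H (polyfZ _ (polyfM (polyfB (polyf_chart F (ppp K)) (pph F))
  (polyfB (polyf_chart F (ppp K)) (pph F)))) (fun y => t0 K F y bF) y.
by rewrite mulf_eq0 sqrf_eq0 -mulf_eq0 => /eqP.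
Qed.

End HomogeneousSystem.



Section InteriorFaceSums.
Context {R : realType} {Th : mesh R} {Omega : set 'rV[R]_3}.
Hypothesis conf : conforming_polyhedral Th Omega.
Hypothesis polO : polyhedral_domain Omega.
Local Notation cells := 'I_(ncell Th).
Local Notation faces := 'I_(nface Th).
Implicit Types (K : cells) (F : faces).

Lemma sum_interior_face (C : pred cells) F (G : cells -> R) : ~~ on_bd Omega F ->
  (forall K K', on_bd (cell K) F -> on_bd (cell K') F -> K != K' ->
     C K = C K' /\ G K' = - G K) ->
  \sum_(K | C K && on_bd (cell K) F) G K = 0.
Proof.
move=> nF H; have [K1 [K2 [K12 b1 b2]]] := interior_face conf polO nF.
have [C12 G12] := H _ _ b1 b2 K12.
have E K : on_bd (cell K) F = (K == K1) || (K == K2).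
  apply/idP/idP => [bK|/orP[/eqP ->|/eqP ->]//].
  by have [->|->] := on_bd_two conf b1 b2 bK K12; rewrite eqxx ?orbT.
under eq_bigl do rewrite E.
have [C1|C1] := boolP (C K1).
  rewrite (bigD1 K1)/=; last by rewrite C1 eqxx.
  rewrite (bigD1 K2)/=; last by rewrite -C12 C1 eqxx orbT eq_sym.
  rewrite big1 => [|K /andP[/andP[/andP[_ h] h1] h2]]; last by rewrite (negbTE h1) (negbTE h2) in h.
  by rewrite G12 addr0 subrr.
rewrite big1// => K /andP[CK /orP[/eqP e|/eqP e]]; first by rewrite e (negbTE C1) in CK.
by rewrite e -C12 (negbTE C1) in CK.
Qed.

End InteriorFaceSums.

Section NormalFlux.
Context {R : realType} {Th : mesh R} {Omega : set 'rV[R]_3}.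
Hypothesis conf : conforming_polyhedral Th Omega.
Local Notation cells := 'I_(ncell Th).
Local Notation faces := 'I_(nface Th).
Implicit Types (K : cells) (F : faces).
Context {k : nat} {u : bvec Th} {un : cells -> fscal Th}.
Hypothesis uu : Vh k u.
Hypothesis unE : forall K F y, on_bd (cell K) F ->
  un K F y = dot (u K (chart F y)) (nrm K F).
Let pu K : polyv (u K). Proof. exact: Pvec_polyv (uu K). Qed.

Lemma divergence_free : (forall q : bscal Th, Qh k q ->
    - ipT (fun K x => dot (u K x) (grad (q K) x))
    + ipdT (fun K F y => un K F y * q K (chart F y)) = 0) ->
  forall K x, divg (u K) x = 0.
Proof.
move=> e3 K x.
have pq : Qh k (fun K => divg (u K)).
  by move=> K'; apply: Ppoly_sum => i _; exact: (Ppoly_partial i (uu K' i)).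
have pd K' : polyf (divg (u K')) by exact: polyf_divg.
have := e3 _ pq.
have gd := green_divT conf pd pu.
have -> : ipT (fun K x => dot (u K x) (grad (divg (u K)) x)) =
    ipT (fun K x => dot (grad (divg (u K)) x) (u K x)).
  by apply: eq_ipT => K' z; rewrite dotC.
have -> : ipdT (fun K F y => un K F y * divg (u K) (chart F y)) =
    ipdT (fun K F y => divg (u K) (chart F y) * dot (u K (chart F y)) (nrm K F)).
  by apply: eq_ipdT => K' F y bF; rewrite unE// mulrC.
rewrite -gd addrC addrK => /eqP; rewrite /ipT psumr_eq0 => [/allP h|K' _]; last first.
  by apply: int3_ge0 => z _; rewrite -expr2 sqr_ge0.
have /implyP/(_ isT)/eqP h0 := h K (mem_index_enum _).
have /eqP := int3_pos_eq0 conf (polyfM (pd K) (pd K)) (fun z => sqr_ge0 _) h0 x.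
by rewrite mulf_eq0 orbb => /eqP.
Qed.

Lemma normal_continuous : (forall zeta, Mh0 k Omega zeta ->
    ipdT (fun K F y => un K F y * zeta F y) = 0) ->
  forall K K' F y, ~~ on_bd Omega F -> on_bd (cell K) F -> on_bd (cell K') F ->
  dot (u K (chart F y)) (face_normal F) = dot (u K' (chart F y)) (face_normal F).
Proof.
move=> e5 K K' F y.
move=> nF bF bF'; have [->//|KK'] := eqVneq K K'.
pose z : fscal Th := fun F => if on_bd Omega F then fun=> 0 else
  fun y => \sum_(K | on_bd (cell K) F) dot (u K (chart F y)) (nrm K F).
have pdn K0 F0 : Ppoly k.+1 (fun y => dot (u K0 (chart F0 y)) (nrm K0 F0)).
  apply: Ppoly_sum => i _; apply: Ppoly_eqf (PpolyZ (nrm K0 F0 0 i) (Pvec_chart F0 (uu K0) i)) => y0.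
  by rewrite mulrC.
have pz : Mh0 k Omega z.
  move=> F0; rewrite /z; case: ifP => b0; split=> //; first exact: Ppoly_cst.
  by apply: Ppoly_sum => K0 _; exact: pdn.
have := e5 _ pz.
have pzf F0 : polyf (z F0) := Ppoly_polyf (pz F0).1.
have -> : ipdT (fun K F y => un K F y * z F y) =
    \sum_(F0 : faces) int2 (fdom F0) (fun y => z F0 y * z F0 y).
  rewrite /ipdT (exchange_big_dep xpredT)//=; apply: eq_bigr => F0 _.
  have mF : measurable (pt2 @^-1` fdom F0 : set (measurableTypeR R * measurableTypeR R)).
    by have [? _ _ _ _] := polyhedron_props (fdom_polyhedron conf F0); exact: closed_pt2_measurable.
  have ci K0 : integ2 (fdom F0) (fun y => dot (u K0 (chart F0 y)) (nrm K0 F0) * z F0 y).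
    by apply: (face_integ conf); apply: polyf_continuous; apply: polyfM (Ppoly_polyf (pdn K0 F0)) _.
  have [_ E] := coordint_sum (index_enum cells) (P := fun K0 => on_bd (cell K0) F0) mF (fun K0 _ => ci K0).
  transitivity (\sum_(K0 | on_bd (cell K0) F0) int2 (fdom F0)
      (fun y => dot (u K0 (chart F0 y)) (nrm K0 F0) * z F0 y)).
    apply: eq_bigr => K0 b0; congr int2; apply/funext => y0; congr (_ * _).
    exact: unE.
  transitivity (int2 (fdom F0) (fun y => \sum_(K0 | on_bd (cell K0) F0)
      dot (u K0 (chart F0 y)) (nrm K0 F0) * z F0 y)); first exact: esym E.
  congr int2; apply/funext => y0; rewrite -mulr_suml.
  by rewrite /z; case: ifP => _; rewrite ?mulr0.
move=> /eqP; rewrite psumr_eq0 => [/allP h|F0 _]; last first.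
  by apply: int2_ge0 => y0 _; rewrite -expr2 sqr_ge0.
have /implyP/(_ isT)/eqP h0 := h F (mem_index_enum _).
have /eqP := int2_pos_eq0 conf (polyfM (pzf F) (pzf F)) (fun z => sqr_ge0 _) h0 y.
rewrite mulf_eq0 orbb /z (negbTE nF) (bigD1 K)//= (bigD1 K')/=; last by rewrite bF' eq_sym.
rewrite big1 => [|K0 /andP[/andP[b0 K0K] K0K']]; last first.
  by have [e|e] := on_bd_two conf bF bF' b0 KK'; rewrite e eqxx in K0K K0K'.
rewrite addr0 (nrm_opp conf bF bF' KK') dotNr subr_eq0 => /eqP.
by have [->|->] := nrmE conf bF => //; rewrite !dotNr => /oppr_inj.
Qed.

End NormalFlux.

Section DivergenceFreeIrrotational.
Context {R : realType} {Th : mesh R} {Omega : set 'rV[R]_3}.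
Hypothesis conf : conforming_polyhedral Th Omega.
Hypothesis polO : polyhedral_domain Omega.
Local Notation cells := 'I_(ncell Th).
Local Notation faces := 'I_(nface Th).
Implicit Types (K : cells) (F : faces).
Variables (k : nat) (taut : R) (taun : faces -> R).
Hypothesis taut_gt0 : 0 < taut.
Hypothesis taun_ge0 : forall F, 0 <= taun F.
Variable s : hdg_unknowns Th.
Hypothesis hs : hdg_system k taut (un_g taun) Omega (fun=> 0) (fun=> 0) s.
Let u := u_h s.

Let uu : Vh k u. Proof. by case: hs => -[]. Qed.
Let mm : Mthg k Omega (fun=> 0) (uhat s). Proof. by case: hs => -[]. Qed.
Let pu K : polyv (u K). Proof. exact: Pvec_polyv (uu K). Qed.
Let puh F : polyv (uhat s F). Proof. exact: MtF_polyv (mm.1 F). Qed.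
Let E0 := energy_zero conf taut_gt0 taun_ge0 hs.

Lemma hom_w K x : w_h s K x = 0. Proof. exact: E0.1. Qed.

Lemma hom_PM K F y : on_bd (cell K) F ->
  PM k F (fun y => tang (nrm K F) (u K (chart F y))) y = uhat s F y.
Proof. by move=> bF; have [] := E0.2 K F y bF. Qed.

Lemma hom_un K F y : on_bd (cell K) F ->
  un_g taun s K F y = dot (u K (chart F y)) (nrm K F).
Proof. by move=> bF; have [_ h] := E0.2 K F y bF; rewrite /un_g h addr0. Qed.

Lemma hom_curl K x : curl (u K) x = 0.
Proof.
have pr : Wh k (fun K => curl (u K)).
  move=> K' i; apply: Ppoly_eqf (PpolyB (Ppoly_partial (i + 1) (uu K' (i + 2)))
    (Ppoly_partial (i + 2) (uu K' (i + 1)))) => z.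
  by rewrite mxE.
have pc K' : polyv (curl (u K')) by exact: polyv_curl.
have [_ [e1 _ _ _ _]] := hs; have := e1 _ pr.
have -> : ipT (fun K x => dot (w_h s K x) (curl (u K) x)) = 0.
  by apply: ipT_eq0 => K' z; rewrite hom_w dot0l.
have gc := green_curlT conf pu pc.
have -> : ipdT (fun K F y => dot (cross (uhat s F y) (nrm K F)) (curl (u K) (chart F y))) =
    - ipdT (fun K F y => dot (cross (nrm K F) (u K (chart F y))) (curl (u K) (chart F y))).
  apply/eqP; rewrite -addr_eq0; apply/eqP; apply: (etrans (ipdTD conf _ _)).
  - move=> K' F _; apply: polyf_dot; last exact: (polyv_chart F (pc K')).
    exact: (polyv_cross (puh F) (polyv_cst _)).
  - move=> K' F _; apply: polyf_dot; last exact: (polyv_chart F (pc K')).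
    exact: (polyv_cross (polyv_cst _) (polyv_chart F (pu K'))).
  apply: big1 => K' _; apply: big1 => F bF.
  have put : polyv (fun y => tang (nrm K' F) (u K' (chart F y))).
    by apply: polyv_tang; exact: polyv_chart.
  have [_ orth] := PMP conf k F put.
  have := orth _ (MtF_cross conf bF (Pvec_chart F (pr K'))) => <-.
  congr int2; apply/funext => y; rewrite (hom_PM y bF) dotBl -dot_crossA; congr (_ + _).
  rewrite dot_tangl ?(nrm_unit conf)// ?dot_crossvl// -dot_crossA.
  by rewrite crossC dotNl.
rewrite sub0r -opprD -gc addrC subrK => /eqP; rewrite oppr_eq0 => /eqP h.
exact: (ipT_dot_eq0 conf pc h).
Qed.

Lemma hom_div K x : divg (u K) x = 0.
Proof.
have [_ [_ _ e3 _ _]] := hs.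
exact: (divergence_free conf uu hom_un e3).
Qed.

Lemma hom_potential K : exists2 phi, Ppoly k.+2 phi & forall x, grad phi x = u K x.
Proof.
have [phi pphi gphi] := polynomial_potential (fun i => uu K i) (fun i j x => curl_eq0 (hom_curl K x) i j).
by exists phi => // x; apply/rowP => i; rewrite mxE gphi.
Qed.

Lemma hom_tang K F y : on_bd (cell K) F -> tang (nrm K F) (u K (chart F y)) = uhat s F y.
Proof.
move=> bF; rewrite -(hom_PM y bF) (PM_id conf)//.
have [phi pphi gphi] := hom_potential K.
have := MtF_grad conf F pphi; congr MtF; apply/funext => z.
by rewrite (tang_nrm conf bF) gphi.
Qed.

Lemma hom_normal K K' F y : ~~ on_bd Omega F -> on_bd (cell K) F -> on_bd (cell K') F ->
  dot (u K (chart F y)) (face_normal F) = dot (u K' (chart F y)) (face_normal F).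
Proof.
have [_ [_ _ _ _ e5]] := hs.
exact: (normal_continuous conf uu hom_un e5).
Qed.

Lemma hom_continue K K' F : ~~ on_bd Omega F -> on_bd (cell K) F -> on_bd (cell K') F ->
  forall x, u K x = u K' x.
Proof.
move=> nF bF bF' x; apply/eqP; rewrite -subr_eq0; apply/eqP; move: x.
have pd : Pvec k.+1 (fun x => u K x - u K' x).
  by move=> i; apply: Ppoly_eqf (PpolyB (uu K i) (uu K' i)) => x; rewrite !mxE.
have sub i j x : partial j (fun z => (u K z - u K' z) 0 i) x =
    partial j (fun z => u K z 0 i) x - partial j (fun z => u K' z 0 i) x.
  rewrite (_ : (fun z => _) = fun z => u K z 0 i - u K' z 0 i); last by apply/funext => z; rewrite !mxE.
  by apply: partialB; apply: polyf_diff; exact: pu.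
apply: (unique_continuation (o := forig F) (frameF conf F) pd) => [x|x|y].
- apply: sym_curl_eq0 => i j; rewrite !sub (curl_eq0 (hom_curl K x) i j).
  by rewrite (curl_eq0 (hom_curl K' x) i j).
- rewrite /divg; under eq_bigr do rewrite sub.
  by rewrite sumrB -[X in X - _]/(divg (u K) x) -[X in _ - X]/(divg (u K') x) !hom_div subrr.
apply/eqP; rewrite subr_eq0; apply/eqP; change (u K (chart F y) = u K' (chart F y)).
have n1 := face_normal_unit conf F.
have d v : v = tang (face_normal F) v + dot v (face_normal F) *: face_normal F.
  by rewrite tangE// subrK.
rewrite [LHS]d [RHS]d (hom_normal y nF bF bF').
rewrite -{1}(tang_nrm conf bF) (hom_tang y bF) -{1}(tang_nrm conf bF').
by rewrite (hom_tang y bF').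
Qed.

End DivergenceFreeIrrotational.



Section Components.
Context {R : realType} {Th : mesh R} {Omega : set 'rV[R]_3}.
Hypothesis conf : conforming_polyhedral Th Omega.
Hypothesis polO : polyhedral_domain Omega.
Local Notation cells := 'I_(ncell Th).
Local Notation faces := 'I_(nface Th).
Implicit Types (K : cells) (F : faces).

Definition face_adjacent : rel cells := fun K K' =>
  [exists F : faces, [&& ~~ on_bd Omega F, on_bd (cell K) F & on_bd (cell K') F]].

Lemma component_face K0 K K' F : ~~ on_bd Omega F -> on_bd (cell K) F -> on_bd (cell K') F ->
  connect face_adjacent K0 K = connect face_adjacent K0 K'.
Proof.
move=> nF bF bF'; apply/idP/idP => h; apply: (connect_trans h); apply: connect1;
  by apply/existsP; exists F; rewrite nF bF bF'.
Qed.

Lemma component_const {T : Type} (f : cells -> T) :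
  (forall K K' F, ~~ on_bd Omega F -> on_bd (cell K) F -> on_bd (cell K') F -> f K = f K') ->
  forall K0 K, connect face_adjacent K0 K -> f K = f K0.
Proof.
move=> H K0 K /connectP[p + ->]; elim: p K0 => //= K1 p IH K0 /andP[/existsP[F /and3P[nF b0 b1]] pth].
by rewrite IH//; exact: H nF b1 b0.
Qed.

Lemma component_gauss K0 (v : 'rV[R]_3 -> 'rV[R]_3) : polyv v ->
  \sum_(K | connect face_adjacent K0 K) int3 (cell K) (divg v) =
  \sum_(K | connect face_adjacent K0 K) \sum_(F | on_bd (cell K) F && on_bd Omega F)
    int2 (fdom F) (fun y => dot (v (chart F y)) (nrm K F)).
Proof.
move=> pv; pose C K := connect face_adjacent K0 K.
pose G K F := int2 (fdom F) (fun y => dot (v (chart F y)) (nrm K F)).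
under eq_bigr => K _ do rewrite (gauss conf K pv) (bigID (on_bd Omega))/=.
rewrite big_split/= -[RHS]addr0; congr (_ + _).
rewrite (exchange_big_dep (fun F => ~~ on_bd Omega F))/=; last by move=> K F _ /andP[].
apply: big1 => F nF.
transitivity (\sum_(K | C K && on_bd (cell K) F) G K F).
  by apply: eq_bigl => K; rewrite nF andbT.
apply: (sum_interior_face conf polO nF) => K K' b b' KK'; split.
  exact: component_face nF b b'.
rewrite /G; have pF : polyf (fun y => dot (v (chart F y)) (nrm K F)).
  exact: (polyf_dot (polyv_chart F pv) (polyv_cst _)).
rewrite -[RHS]mulN1r -(int2Z conf)//; congr int2; apply/funext => y.
by rewrite mulN1r (nrm_opp conf b b' KK') dotNr.
Qed.

Lemma partial_dot (e : 'rV[R]_3) i x : partial i (dot e) x = e 0 i.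
Proof.
rewrite partial_sum => [|j _]; last first.
  by apply: polyf_diff; apply: polyfZ; exists 1%N; exact: Ppoly_coord.
rewrite (bigD1 i)//= big1 => [|j ji].
  rewrite partialZ; last by apply: (@polyf_diff _ 2); exists 1%N; exact: Ppoly_coord.
  by rewrite partial_coord eqxx mulr1 addr0.
rewrite partialZ; last by apply: (@polyf_diff _ 2); exists 1%N; exact: Ppoly_coord.
by rewrite partial_coord eq_sym (negbTE ji) mulr0.
Qed.

Lemma grad_dot (e x : 'rV[R]_3) : grad (dot e) x = e.
Proof. by apply/rowP => i; rewrite mxE partial_dot. Qed.

Lemma divg_cst (e x : 'rV[R]_3) : divg (fun=> e) x = 0.
Proof. by apply: big1 => i _; rewrite partial_cst. Qed.

Lemma component_boundary K0 (e : 'rV[R]_3) : e != 0 ->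
  exists K F, [/\ connect face_adjacent K0 K, on_bd (cell K) F, on_bd Omega F
    & dot e (face_normal F) != 0].
Proof.
move=> e0; apply: contrapT => H.
have pe : polyf (dot e) by exists 1%N; exact: Ppoly_dot.
have pv : polyv (fun x => dot e x *: e).
  exact: (polyvZ pe (polyv_cst e)).
have dv x : divg (fun x => dot e x *: e) x = dot e e.
  by rewrite (divg_scale x pe (polyv_cst e)) divg_cst mulr0 add0r grad_dot.
have := component_gauss K0 pv.
rewrite [RHS]big1 => [|K CK]; last first.
  apply: big1 => F /andP[bK bF]; transitivity (int2 (fdom F) (fun=> 0)); last exact: coordint0.
  congr int2; apply/funext => y; rewrite dotZl.
  have -> : dot e (nrm K F) = 0; last by rewrite mulr0.
  apply: contrapT => /eqP en; apply: H; exists K, F; split=> //.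
  by move: en; have [->|->] := nrmE conf bK => //; rewrite dotNr oppr_eq0.
have pee : polyf (fun _ : 'rV[R]_3 => dot e e) by exact: polyf_cst.
under eq_bigr do rewrite (_ : divg _ = fun=> dot e e) ?(funext dv)//.
move=> /eqP; rewrite psumr_eq0 => [/allP h|K _]; last by apply: int3_ge0 => x _; exact: dotvv_ge0.
have /implyP := h K0 (mem_index_enum _); rewrite connect0 => /(_ isT)/eqP h0.
have := int3_pos_eq0 conf pee (fun=> dotvv_ge0 e) h0 0 => /dotvv_eq0 ee.
by rewrite ee eqxx in e0.
Qed.

End Components.

Lemma planes_meet {R : realType} (m n : 'rV[R]_3) (a b : R) : cross m n != 0 ->
  exists x, dot m x = a /\ dot n x = b.
Proof.
move=> c0; set c := cross m n.
have cc : dot c c != 0 by apply: contra c0 => /eqP /dotvv_eq0 /eqP.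
exists ((a / dot c c) *: cross n c + (b / dot c c) *: cross c m).
rewrite !dotDr !dotZr; split.
  have -> : dot m (cross n c) = dot c c by rewrite -dot_crossA.
  have -> : dot m (cross c m) = 0 by rewrite dotC dot_crossvr.
  by rewrite mulr0 addr0 divfK.
have -> : dot n (cross n c) = 0 by rewrite dotC dot_crossvl.
have -> : dot n (cross c m) = dot c c by rewrite dotC dot_crossA.
by rewrite mulr0 add0r divfK.
Qed.

Section VelocityVanishes.
Context {R : realType} {Th : mesh R} {Omega : set 'rV[R]_3}.
Hypothesis conf : conforming_polyhedral Th Omega.
Hypothesis polO : polyhedral_domain Omega.
Local Notation cells := 'I_(ncell Th).
Local Notation faces := 'I_(nface Th).
Implicit Types (K : cells) (F : faces).
Variables (k : nat) (taut : R) (taun : faces -> R).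
Hypothesis taut_gt0 : 0 < taut.
Hypothesis taun_ge0 : forall F, 0 <= taun F.
Variable s : hdg_unknowns Th.
Hypothesis hs : hdg_system k taut (un_g taun) Omega (fun=> 0) (fun=> 0) s.
Let u := u_h s.
Let e := @face_adjacent R Th Omega.

Let uu : Vh k u. Proof. by case: hs => -[]. Qed.
Let pu K : polyv (u K). Proof. exact: Pvec_polyv (uu K). Qed.

Lemma plane_constant K F (phi : 'rV[R]_3 -> R) : on_bd (cell K) F -> on_bd Omega F ->
  polyf phi -> (forall x, grad phi x = u K x) ->
  forall x x', dot (face_normal F) x = dot (face_normal F) x' ->
    dot (face_normal F) x = dot (face_normal F) (forig F) -> phi x = phi x'.
Proof.
move=> bK bF [l pphi] gphi x x' xx' xo.
have g0 y : grad phi (chart F y) *m (frame F)^T = 0.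
  have := hom_tang conf taut_gt0 taun_ge0 hs y bK; rewrite -/u.
  rewrite (uhat_bd conf hs bF) (tang_nrm conf bK) (tang_frame (frameF conf F)) gphi.
  by move=> /(congr1 (mulmxr (frame F)^T)); rewrite /= mulmx_frameK ?(frameF conf)// mul0mx.
pose f y := phi (chart F y).
have pf : Ppoly l f by exact: (Ppoly_comp (chart_poly F) pphi).
have df y i : partial i f y = 0.
  have := grad_chart (Ppoly_diff (chart F y) pphi); rewrite g0.
  by move=> /matrixP/(_ 0 i); rewrite !mxE.
have fc y : f y = f 0.
  have [q Q] := Ppoly_line 0 y pf.
  have q0 : q^`() = 0.
    apply: (poly_eventually0 ltr01) => t _; have [_ <-] := Q t.
    by apply: big1 => i _; rewrite df mulr0.
  have [E1 _] := Q 1; have [E2 _] := Q 0.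
  move: E1 E2; rewrite add0r scale1r scale0r addr0 => -> ->.
  exact: deriv_eq0_const.
have onp z : dot (face_normal F) z = dot (face_normal F) (forig F) -> phi z = f 0.
  move=> /eqP; rewrite -subr_eq0 -dotBr dotC => /eqP /(chart_project conf) <-.
  exact: fc.
by rewrite !onp// -xx'.
Qed.

Lemma hom_u K0 x : u K0 x = 0.
Proof.
have uC K : connect e K0 K -> u K = u K0.
  apply: (component_const (Omega := Omega) (f := u)) => K1 K2 F nF b1 b2; apply/funext => z.
  exact: (hom_continue conf taut_gt0 taun_ge0 hs nF b1 b2 z).
have [phi pphi gphi] := hom_potential conf taut_gt0 taun_ge0 hs K0.
have pphif : polyf phi by exact: Ppoly_polyf pphi.
have pc K F x1 x2 : connect e K0 K -> on_bd (cell K) F -> on_bd Omega F ->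
    dot (face_normal F) x1 = dot (face_normal F) (forig F) ->
    dot (face_normal F) x2 = dot (face_normal F) (forig F) -> phi x1 = phi x2.
  move=> CK bK bF h1 h2; apply: (plane_constant bK bF pphif) => // [z|]; last by rewrite h1 h2.
  by rewrite uC.
have meet K F K' F' x1 x2 : connect e K0 K -> on_bd (cell K) F -> on_bd Omega F ->
    connect e K0 K' -> on_bd (cell K') F' -> on_bd Omega F' ->
    cross (face_normal F) (face_normal F') != 0 ->
    dot (face_normal F) x1 = dot (face_normal F) (forig F) ->
    dot (face_normal F') x2 = dot (face_normal F') (forig F') -> phi x1 = phi x2.
  move=> CK bK bF CK' bK' bF' /planes_meet H h1 h2.
  have [z [z1 z2]] := H (dot (face_normal F) (forig F)) (dot (face_normal F') (forig F')).
  by rewrite (pc K F x1 z)// (pc K' F' z x2).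
have e00 : (delta_mx 0 0 : 'rV[R]_3) != 0.
  by apply/eqP => /matrixP/(_ 0 0)/eqP; rewrite !mxE eqxx oner_eq0.
have [K1 [F1 [C1 b1 B1 _]]] := component_boundary conf polO K0 e00.
pose c := phi (forig F1).
have all K F z : connect e K0 K -> on_bd (cell K) F -> on_bd Omega F ->
    dot (face_normal F) z = dot (face_normal F) (forig F) -> phi z = c.
  move=> CK bK bF hz; have [par|npar] := eqVneq (cross (face_normal F) (face_normal F1)) 0; last first.
    exact: (meet K F K1 F1).
  have n1 := face_normal_unit conf F1; have n2 := face_normal_unit conf F.
  have r0 : row 0 (frame F1) != 0.
    apply/eqP => r0; have := frame_dot (frameF conf F1) 0 0; rewrite r0 dot0l eqxx.
    by move/eqP; rewrite eq_sym oner_eq0.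
  have [K2 [F2 [C2 b2 B2 h2]]] := component_boundary conf polO K0 r0.
  have np1 : cross (face_normal F1) (face_normal F2) != 0.
    apply: contra h2 => /eqP c12.
    have : cross (face_normal F1) (cross (face_normal F1) (face_normal F2)) = 0.
      by rewrite c12 cross0r.
    rewrite cross_cross n1 scale1r => /eqP; rewrite subr_eq0 => /eqP <-.
    by rewrite dotZr (frame_dot_normal (frame F1)) mulr0.
  have np : cross (face_normal F) (face_normal F2) != 0.
    have : cross (face_normal F1) (cross (face_normal F) (face_normal F1)) = 0.
      by rewrite par cross0r.
    rewrite cross_cross n1 scale1r => /eqP; rewrite subr_eq0 => /eqP nn.
    rewrite nn crossZl scaler_eq0 negb_or np1 andbT.
    apply/eqP => d0; move: n2; rewrite nn d0 scale0r dot0l => /eqP.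
    by rewrite eq_sym oner_eq0.
  rewrite (meet K F K2 F2 z (forig F2))//.
  by rewrite /c (meet K1 F1 K2 F2 (forig F1) (forig F2)).
have pphic : polyf (fun x => phi x - c) by apply: polyfB => //; exact: polyf_cst.
have pv : polyv (fun x => (phi x - c) *: u K0 x) by exact: polyvZ.
have gp z : grad (fun x => phi x - c) z = u K0 z.
  rewrite -[RHS]gphi; apply/rowP => i; rewrite !mxE; apply: (etrans (partialB i _ _)).
  - exact: polyf_diff.
  - by apply: (@polyf_diff _ 2); exact: polyf_cst.
  by rewrite partial_cst subr0.
have dv z : divg (fun x => (phi x - c) *: u K0 x) z = dot (u K0 z) (u K0 z).
  rewrite (divg_scale z pphic (pu K0)) gp.
  by rewrite (hom_div conf taut_gt0 taun_ge0 hs) mulr0 add0r.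
have := component_gauss conf polO K0 pv.
rewrite [RHS]big1 => [|K CK]; last first.
  apply: big1 => F /andP[bK bF]; transitivity (int2 (fdom F) (fun=> 0)); last exact: coordint0.
  congr int2; apply/funext => y; rewrite (all K F)// ?subrr ?scale0r ?dot0l//.
  apply/eqP; rewrite -subr_eq0 -dotBr dotC.
  by have := chart_normal F y 0; rewrite /chart mul0mx addr0 => ->.
under eq_bigr do rewrite (_ : divg _ = fun z => dot (u K0 z) (u K0 z)) ?(funext dv)//.
move=> /eqP; rewrite psumr_eq0 => [/allP h|K _]; last by apply: int3_ge0 => z _; exact: dotvv_ge0.
have /implyP := h K0 (mem_index_enum _); rewrite connect0 => /(_ isT)/eqP h0.
exact: (int3_dot_eq0 conf (pu K0) h0).
Qed.

Lemma hom_uhat F y : uhat s F y = 0.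
Proof.
have [_ [_ exK _]] := conf; have [K bK] := exK F.
rewrite -(hom_tang conf taut_gt0 taun_ge0 hs y bK) -[u_h s K _]/(u K _).
by rewrite hom_u tang0.
Qed.

End VelocityVanishes.



Lemma grad_eq0_const {R : realType} {d : nat} (f : 'rV[R]_d.+1 -> R) : polyf f ->
  (forall x i, partial i f x = 0) -> forall x y, f x = f y.
Proof.
move=> [l pf] df; have fc y : f y = f 0.
  have [q Q] := Ppoly_line 0 y pf.
  have q0 : q^`() = 0.
    apply: (poly_eventually0 ltr01) => t _; have [_ <-] := Q t.
    by apply: big1 => i _; rewrite df mulr0.
  have [E1 _] := Q 1; have [E2 _] := Q 0.
  move: E1 E2; rewrite add0r scale1r scale0r addr0 => -> ->.
  exact: deriv_eq0_const.
by move=> x y; rewrite fc -(fc y).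
Qed.

Section PressureEquation.
Context {R : realType} {Th : mesh R} {Omega : set 'rV[R]_3}.
Hypothesis conf : conforming_polyhedral Th Omega.
Hypothesis polO : polyhedral_domain Omega.
Local Notation cells := 'I_(ncell Th).
Local Notation faces := 'I_(nface Th).
Implicit Types (K : cells) (F : faces).
Variables (k : nat) (taut : R) (taun : faces -> R).
Hypothesis taut_gt0 : 0 < taut.
Hypothesis taun_ge0 : forall F, 0 <= taun F.
Variable s : hdg_unknowns Th.
Hypothesis hs : hdg_system k taut (un_g taun) Omega (fun=> 0) (fun=> 0) s.
Let p := p_h s.
Let m := phat s.

Let pp : Qh k p. Proof. by case: hs => -[]. Qed.
Let zz : Mh0 k Omega m. Proof. by case: hs => -[]. Qed.
Let ppp K : polyf (p K). Proof. exact: Ppoly_polyf (pp K). Qed.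
Let pm F : polyf (m F). Proof. exact: Ppoly_polyf (zz F).1. Qed.

Lemma hom_pressure_eq K0 (v : 'rV[R]_3 -> 'rV[R]_3) : Pvec k.+1 v ->
  int3 (cell K0) (fun x => dot (grad (p K0) x) (v x)) +
  \sum_(F | on_bd (cell K0) F)
    int2 (fdom F) (fun y => (m F y - p K0 (chart F y)) * dot (v (chart F y)) (nrm K0 F)) = 0.
Proof.
move=> pv; pose V : bvec Th := fun K => if K == K0 then v else fun=> 0.
have VV : Vh k V by move=> K; rewrite /V; case: ifP => _ //; exact: Pvec0.
have pV K : polyv (V K) := Pvec_polyv (VV K).
have [_ [_ e2 _ _ _]] := hs; have := e2 _ VV.
have -> : ipT (fun K x => dot (w_h s K x) (curl (V K) x)) = 0.
  by apply: ipT_eq0 => K x; rewrite (hom_w conf taut_gt0 taun_ge0 hs) dot0l.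
have -> : ipT (fun K x => dot (0 : 'rV[R]_3) (V K x)) = 0.
  by apply: ipT_eq0 => K x; rewrite dot0l.
have -> : ipdT (fun K F y => dot (what k taut s K F y) (cross (V K (chart F y)) (nrm K F))) = 0.
  apply: ipdT_eq0 => K F y bF; rewrite /what (hom_w conf taut_gt0 taun_ge0 hs).
  by rewrite (hom_PM conf taut_gt0 taun_ge0 hs y bF) subrr cross0l scaler0 addr0 dot0l.
have gd := green_divT conf ppp pV.
have pVn K F : polyf (fun y => dot (V K (chart F y)) (nrm K F)).
  exact: (polyf_dot (polyv_chart F (pV K)) (polyv_cst _)).
have q1 K F : on_bd (cell K) F -> polyf (fun y => phat s F y * dot (V K (chart F y)) (nrm K F)).
  by move=> _; exact: polyfM.
have q2 K F : on_bd (cell K) F -> polyf (fun y => p K (chart F y) * dot (V K (chart F y)) (nrm K F)).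
  by move=> _; apply: polyfM => //; exact: polyf_chart.
have := ipdTB conf q1 q2; rewrite -gd.
set A := ipT _; set B := ipT _; set C := ipdT _; set D := ipdT _ => e1 e3.
have {e1 e3} : B + D = 0.
  move: e1 e3; rewrite -/p -/A; move: A B C D => A B C D e1 e3.
  rewrite -e1; move: e3; lra.
have -> : B = int3 (cell K0) (fun x => dot (grad (p K0) x) (v x)).
  rewrite /B /ipT (bigD1 K0)//= big1 => [|K /negbTE KK0].
    by rewrite addr0 /V eqxx.
  transitivity (int3 (cell K) (fun=> 0)); last exact: coordint0.
  by congr int3; apply/funext => x; rewrite /V KK0 dotC dot0l.
have -> // : D = \sum_(F | on_bd (cell K0) F)
    int2 (fdom F) (fun y => (m F y - p K0 (chart F y)) * dot (v (chart F y)) (nrm K0 F)).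
rewrite /D /ipdT (bigD1 K0)//= [X in _ + X]big1 => [|K /negbTE KK0].
  rewrite addr0; apply: eq_bigr => F _; congr int2; apply/funext => y.
  by rewrite /V eqxx mulrBl.
apply: big1 => F _; transitivity (int2 (fdom F) (fun=> 0)); last exact: coordint0.
by congr int2; apply/funext => y; rewrite /V KK0 dot0l !mulr0 subr0.
Qed.

Lemma hom_pressure : (forall K x, grad (p K) x = 0) ->
  (forall K F y, on_bd (cell K) F -> p K (chart F y) = m F y) ->
  (forall K x, p K x = 0) /\ (forall F y, m F y = 0).
Proof.
move=> gp pm'; have pc K x x' : p K x = p K x'.
  apply: grad_eq0_const => // z i; have := gp K z.
  by move=> /matrixP/(_ 0 i); rewrite !mxE.
have p0 K x : p K x = 0.
  have e00 : (delta_mx 0 0 : 'rV[R]_3) != 0.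
    by apply/eqP => /matrixP/(_ 0 0)/eqP; rewrite !mxE eqxx oner_eq0.
  have [K1 [F1 [C1 b1 B1 _]]] := component_boundary conf polO K e00.
  have pK : p K1 = p K.
    apply: (component_const (Omega := Omega) _ C1) => K2 K3 F nF b2 b3; apply/funext => z.
    by rewrite (pc K2 z (chart F 0)) (pc K3 z (chart F 0)) !pm'.
  by rewrite -pK (pc K1 x (chart F1 0)) pm'// (zz F1).2.
split=> // F y; have [_ [_ exK _]] := conf; have [K bK] := exK F.
by rewrite -(pm' K F y bK) p0.
Qed.

Lemma hom_pressure_g : (forall F, 0 < taun F) ->
  (forall K x, p K x = 0) /\ (forall F y, m F y = 0).
Proof.
move=> tn0; have pm' K F y : on_bd (cell K) F -> p K (chart F y) = m F y.
  move=> bF; have [_ /(_ K F y bF)[_ /eqP]] := energy_zero conf taut_gt0 taun_ge0 hs.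
  by rewrite mulf_eq0 gt_eqF//= subr_eq0 => /eqP.
apply: hom_pressure => // K x.
have pg : Pvec k.+1 (grad (p K)).
  move=> i; apply: Ppoly_eqf (Ppoly_le (leq_trans (leq_pred k) (leqnSn k)) (Ppoly_partial i (pp K))) => z.
  by rewrite mxE.
have := hom_pressure_eq K pg; rewrite big1 ?addr0 => [|F bF].
  by move=> h; exact: (int3_dot_eq0 conf (Pvec_polyv pg) h).
transitivity (int2 (fdom F) (fun=> 0)); last exact: coordint0.
by congr int2; apply/funext => y; rewrite pm'// subrr mul0r.
Qed.

End PressureEquation.



Section Simplex.
Context {R : realType}.

Lemma polyfM_eq0 {d : nat} (f g : 'rV[R]_d.+1 -> R) : polyf f -> polyf g ->
  (forall x, f x * g x = 0) -> (forall x, f x = 0) \/ (forall x, g x = 0).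
Proof.
move=> pf pg fg; have [f0|] := pselect (forall x, f x = 0); [by left|right].
have [x fx] : exists x, f x != 0.
  by apply: contrapT => H; apply: b => x; apply: contrapT => /eqP ?; apply: H; exists x.
apply: (polyf_eq0 (D := f @^-1` (~` [set 0])) pg).
  exists x; apply: (polyf_continuous pf); apply: open_nbhs_nbhs; split=> [|/eqP]; last exact/negP.
  by apply: closed_openC; exact: closed_eq.
by move=> z /= /eqP fz; have /eqP := fg z; rewrite mulf_eq0 (negbTE fz) => /eqP.
Qed.

Lemma polyf_prod_eq0 {d : nat} (I : Type) (r : seq I) (f : I -> 'rV[R]_d.+1 -> R) :
  (forall i, polyf (f i)) -> (forall x, \prod_(i <- r) f i x = 0) ->
  exists i, forall x, f i x = 0.
Proof.
move=> pf; elim: r => [/(_ 0)/eqP|i r IH H]; first by rewrite big_nil oner_eq0.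
have pr (s : seq I) : polyf (fun x => \prod_(i <- s) f i x).
  elim: s => [|j s IHs].
    by have := polyf_cst (d := d.+1) (1 : R); congr polyf; apply/funext => x; rewrite big_nil.
  by have := polyfM (pf j) IHs; congr polyf; apply/funext => x; rewrite big_cons.
have Hm x : f i x * \prod_(j <- r) f j x = 0 by rewrite -[RHS](H x) big_cons.
by have [fi|/IH//] := polyfM_eq0 (pf i) (pr r) Hm; exists i.
Qed.

Definition barycentric (v : 'I_4 -> 'rV[R]_3) (l : 'I_4 -> 'rV[R]_3 -> R)
    (g : 'I_4 -> 'rV[R]_3) :=
  [/\ forall i x y, l i x - l i y = dot (g i) (x - y),
      forall i j, l i (v j) = (i == j)%:R,
      forall x, \sum_i l i x = 1
    & forall x, x = \sum_i l i x *: v i].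

Lemma exists_barycentric (v : 'I_4 -> 'rV[R]_3) : affinely_independent v ->
  exists l g, barycentric v l g.
Proof.
rewrite /affinely_independent; set T := \matrix_i _ => fT.
have uT : T \in unitmx by rewrite -row_free_unit.
pose g0 j := (col j (invmx T))^T.
pose g i := if unlift ord0 i is Some j then g0 j else - \sum_j g0 j.
have gE x : \sum_j dot (g0 j) x *: row j T = x.
  rewrite -[RHS](mulmxKV uT); apply/rowP => i; rewrite summxE [RHS]mxE.
  apply: eq_bigr => j _; rewrite !mxE; congr (_ * _); apply: eq_bigr => a _.
  by rewrite !mxE mulrC.
have rT j : row j T = v (lift ord0 j) - v ord0 by rewrite rowK.
pose l i x := (i == ord0)%:R + dot (g i) (x - v ord0).
have gS : \sum_i g i = 0.
  rewrite big_ord_recl /g unlift_none; under [X in _ + X]eq_bigr do rewrite liftK.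
  by rewrite addNr.
have lS x : \sum_i l i x = 1.
  rewrite /l big_split/= -dot_suml gS dot0l addr0 (bigD1 ord0)//= big1 ?addr0//.
  by move=> i /negbTE ->.
have gv j k : dot (g0 j) (row k T) = (k == j)%:R.
  have /matrixP/(_ k j) := mulmxV uT; rewrite [in RHS]mxE => <-.
  by rewrite mxE; apply: eq_bigr => a _; rewrite !mxE mulrC.
exists l, g; split=> //.
- by move=> i x y; rewrite /l opprD addrACA subrr add0r -dotBr opprB addrA subrK.
- move=> i j; rewrite /l; case: (unliftP ord0 j) => [k ->|->]; last first.
    by rewrite subrr dotC dot0l addr0.
  rewrite -rT /g; case: (unliftP ord0 i) => [a ->|->].
    by rewrite eq_sym (negbTE (neq_lift _ _)) add0r gv (inj_eq lift_inj) eq_sym.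
  rewrite eqxx (negbTE (neq_lift _ _)) dotNl dot_suml (bigD1 k)//= gv eqxx big1.
    by rewrite addr0 subrr.
  by move=> a ak; rewrite gv eq_sym (negbTE ak).
move=> x; rewrite big_ord_recl.
have l0 : l ord0 x = 1 - \sum_j l (lift ord0 j) x by rewrite -(lS x) big_ord_recl addrK.
have lj j : l (lift ord0 j) x = dot (g0 j) (x - v ord0).
  by rewrite /l eq_sym (negbTE (neq_lift _ _)) add0r /g liftK.
rewrite l0 scalerBl scale1r scaler_suml -[LHS](subrK (v ord0)) -[X in X + _ = _](gE (x - v ord0)).
under eq_bigr do rewrite rT -lj scalerBr.
by rewrite sumrB addrC addrA addrAC.
Qed.

Section Barycentric.
Context {v : 'I_4 -> 'rV[R]_3} {l : 'I_4 -> 'rV[R]_3 -> R} {g : 'I_4 -> 'rV[R]_3}.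
Hypothesis bl : barycentric v l g.

Lemma bary_affine i x : l i x = l i 0 + dot (g i) x.
Proof. by have [h _ _ _] := bl; have := h i x 0; rewrite subr0 => <-; rewrite addrC subrK. Qed.

Lemma bary_Ppoly i : Ppoly 1 (l i).
Proof.
apply: Ppoly_eqf (PpolyD (Ppoly_cst 1 (l i 0)) (Ppoly_dot (g i))) => x.
exact/esym/bary_affine.
Qed.

Lemma bary_comb i (n : nat) (p : 'I_n -> 'rV[R]_3) (a : 'I_n -> R) : \sum_j a j = 1 ->
  l i (\sum_j a j *: p j) = \sum_j a j * l i (p j).
Proof.
move=> a1; rewrite bary_affine.
under [RHS]eq_bigr do rewrite bary_affine mulrDr.
rewrite big_split/= -mulr_suml a1 mul1r; congr (_ + _).
by rewrite dotC dot_suml; apply: eq_bigr => j _; rewrite dotZl dotC.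
Qed.

Lemma bary_grad_edge i a b : dot (g i) (v a - v b) = (i == a)%:R - (i == b)%:R.
Proof. by have [h lv _ _] := bl; rewrite -h !lv. Qed.

Lemma bary_vector z : z = \sum_i dot (g i) z *: v i.
Proof.
have [h _ _ r] := bl; rewrite -[LHS]subr0 [in LHS](r z) [X in _ - X = _](r 0) -sumrB.
by apply: eq_bigr => i _; rewrite -scalerBl h subr0.
Qed.

Lemma bary_sum_grad z : \sum_i dot (g i) z = 0.
Proof.
have [h _ S _] := bl; rewrite -[RHS](subrr 1) -[X in _ = X - _](S z) -[X in _ = _ - X](S 0) -sumrB.
by apply: eq_bigr => i _; rewrite h subr0.
Qed.

Lemma hull_bary : hull (range v) = [set x | forall i, 0 <= l i x].
Proof.
have [_ lv S r] := bl; apply/seteqP; split=> [_ [n [p [a [pv a0 a1 ->]]]] i|x lx].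
  rewrite bary_comb//; apply: sumr_ge0 => j _; rewrite mulr_ge0//.
  by have [k _ <-] := pv j; rewrite lv ler0n.
by exists 4%N, v, (fun i => l i x); split=> // i; exists i.
Qed.

Lemma hull_face_bary i x : hull (range v) x -> l i x = 0 -> hull (v @` [set j | j != i]) x.
Proof.
have [_ lv S r] := bl; rewrite hull_bary => /= lx lix.
have [i' i'i] : exists i', i' != i.
  by have [->|ne] := eqVneq i 0; [exists 1|exists 0; rewrite eq_sym].
exists 4%N, (fun j => if j == i then v i' else v j), (fun i => l i x); split=> // [j|].
  by case: eqVneq => [_|ji]; [exists i'|exists j].
rewrite [LHS]r; apply: eq_bigr => j _; case: eqVneq => // ->.
by rewrite lix !scale0r.
Qed.

End Barycentric.

End Simplex.



Section SimplexFaces.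
Context {R : realType} {Th : mesh R} {Omega : set 'rV[R]_3}.
Hypothesis conf : conforming_polyhedral Th Omega.
Local Notation cells := 'I_(ncell Th).
Local Notation faces := 'I_(nface Th).
Context {K : cells} {v : 'I_4 -> 'rV[R]_3} {l : 'I_4 -> 'rV[R]_3 -> R} {g : 'I_4 -> 'rV[R]_3}.
Hypothesis bl : barycentric v l g.
Hypothesis cellE : cell K = hull (range v).
Hypothesis exF : forall i, exists F : faces, face F = hull (v @` [set j | j != i]).
Implicit Types (F : faces).

Lemma simplex_face_index F : on_bd (cell K) F -> exists i, forall y, l i (chart F y) = 0.
Proof.
move=> bF; have pl i : polyf (fun y => l i (chart F y)).
  by apply: polyf_chart; exists 1%N; exact: (bary_Ppoly bl).
have [_ _ _ [y0 Uy0] _] := polyhedron_props (fdom_polyhedron conf F).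
have pp : polyf (fun y => \prod_(i <- index_enum 'I_4) l i (chart F y)).
  elim: (index_enum _) => [|i r IH].
    by have := polyf_cst (d := 2) (1 : R); congr polyf; apply/funext => y; rewrite big_nil.
  by have := polyfM (pl i) IH; congr polyf; apply/funext => y; rewrite big_cons.
apply: (polyf_prod_eq0 (r := index_enum 'I_4) pl).
apply: (polyf_eq0 (D := fdom F) pp); first by exists y0.
move=> y Fy; have [cx nix] := on_bd_face bF Fy.
have := closed_cell conf cx; rewrite cellE (hull_bary bl) => /= lx.
apply/eqP; rewrite prodf_seq_eq0; apply: contrapT => /negP/hasPn H; apply: nix.
have : \forall x \near chart F y, forall i, 0 <= l i x.
  apply: (@filter_forall _ _ _ (nbhs (chart F y)) (nbhs_filter _)) => i.
  have lt : 0 < l i (chart F y) by rewrite lt_def lx andbT H// mem_index_enum.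
  have : nbhs (chart F y) (l i @^-1` [set z | 0 < z]).
    apply: (Ppoly_continuous (bary_Ppoly bl i)); apply: open_nbhs_nbhs; split; [exact: open_gt|exact: lt].
  by apply: (@filterS _ _ (nbhs_filter _)) => x /= /ltW.
apply: (@filterS _ _ (nbhs_filter _)) => x lx'.
by rewrite cellE (hull_bary bl).
Qed.

Lemma simplex_face_unique F F' i : on_bd (cell K) F -> on_bd (cell K) F' ->
  (forall y, l i (chart F y) = 0) -> (forall y, l i (chart F' y) = 0) -> F = F'.
Proof.
have [F0 F0E] := exF i; suff H F1 : on_bd (cell K) F1 -> (forall y, l i (chart F1 y) = 0) -> F1 = F0.
  by move=> bF bF' lF lF'; rewrite (H F) // (H F').
move=> bF lF; apply/eqP/negPn/negP => ne; have [_ [_ _ disj]] := conf.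
have [y Uy] := exists_relint conf F1.
have : (relint F1 `&` face F0) (chart F1 y); last by rewrite disj.
split; first by exists y.
rewrite F0E; apply: (hull_face_bary bl) => //; rewrite -cellE; apply: (closed_cell conf).
exact: (on_bd_face bF (interior_subset Uy)).1.
Qed.

Lemma simplex_face_gradient F i : on_bd (cell K) F -> (forall y, l i (chart F y) = 0) ->
  forall t, (dot (g i) t == 0) = (dot t (nrm K F) == 0).
Proof.
move=> bF lF t; have [h lv _ _] := bl.
have [j ji] : exists j, i != j.
  by have [->|ne] := eqVneq i 0; [exists 1|exists 0].
have g0 : g i != 0.
  apply/eqP => gi0; have := bary_grad_edge bl i i j.
  rewrite gi0 dot0l eqxx (negbTE ji) subr0 => /eqP.
  by rewrite eq_sym oner_eq0.
have gr a : dot (g i) (row a (frame F)) = 0.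
  have := h i (chart F (delta_mx 0 a)) (chart F 0); rewrite !lF subrr /chart mul0mx addr0.
  by rewrite addrC addKr -rowE.
have gn : g i = dot (g i) (face_normal F) *: face_normal F.
  by rewrite {1}(frame_complete (frameF conf F) (g i)) !gr !scale0r !add0r.
have d0 : dot (g i) (face_normal F) != 0.
  by apply: contra g0 => /eqP d0; rewrite gn d0 scale0r.
rewrite gn dotZl mulf_eq0 (negbTE d0)/= dotC.
by have [->|->] := nrmE conf bF; rewrite // dotNr oppr_eq0.
Qed.

End SimplexFaces.

Section SimplicialPressure.
Context {R : realType} {Th : mesh R} {Omega : set 'rV[R]_3}.
Hypothesis simp : conforming_simplicial Th Omega.
Hypothesis polO : polyhedral_domain Omega.
Local Notation cells := 'I_(ncell Th).
Local Notation faces := 'I_(nface Th).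
Implicit Types (K : cells) (F : faces).
Variables (k : nat) (taut : R) (taun : faces -> R).
Hypothesis taut_gt0 : 0 < taut.
Hypothesis taun_ge0 : forall F, 0 <= taun F.
Variable s : hdg_unknowns Th.
Hypothesis hs : hdg_system k taut (un_g taun) Omega (fun=> 0) (fun=> 0) s.
Let p := p_h s.
Let m := phat s.
Let conf := simp.1.

Let pp : Qh k p. Proof. by case: hs => -[]. Qed.
Let zz : Mh0 k Omega m. Proof. by case: hs => -[]. Qed.
Let ppp K : polyf (p K). Proof. exact: Ppoly_polyf (pp K). Qed.
Let pm F : polyf (m F). Proof. exact: Ppoly_polyf (zz F).1. Qed.
Let hpe := hom_pressure_eq conf taut_gt0 taun_ge0 hs.

Let simplex K : exists v l g, [/\ barycentric v l g, cell K = hull (range v)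
  & forall i, exists F : faces, face F = hull (v @` [set j | j != i])].
Proof.
have [_ [vtx [h1 h2 _ _]]] := simp; have [aff cE] := h1 K.
by have [l [g bl]] := exists_barycentric aff; exists (vtx K), l, g.
Qed.

Lemma hom_pressure_grad K x : grad (p K) x = 0.
Proof.
have [v [l [g [bl cE exF]]]] := simplex K.
have pl i : polyf (l i) := Ppoly_polyf (bary_Ppoly bl i).
have edge i j : i != j -> dot (grad (p K) x) (v i - v j) = 0.
  move=> ij; have [k0|[k' kE]] : k = 0%N \/ exists k', k = k'.+1.
    by case: (k) => [|k']; [left|right; exists k'].
    have -> : grad (p K) x = 0; last by rewrite dot0l.
    by have := pp K; rewrite k0 => /Ppoly0E ->; rewrite grad_cst.
  have ppk : Ppoly k'.+1 (p K) by rewrite -kE.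
  pose b x := dot (grad (p K) x) (v i - v j).
  have pb : Ppoly k' b.
    apply: Ppoly_sum => a _.
    apply: Ppoly_eqf (PpolyZ ((v i - v j) 0 a) (Ppoly_partial a ppk)) => z.
    by rewrite mulrC [grad _ _ _ _]mxE.
  have pbf := Ppoly_polyf pb.
  have pV : Pvec k.+1 (fun x => (l i x * l j x * b x) *: (v i - v j)).
    rewrite kE => a; apply: Ppoly_eqf (PpolyZ ((v i - v j) 0 a)
      (PpolyM (PpolyM (bary_Ppoly bl i) (bary_Ppoly bl j)) pb)) => z.
    by rewrite mulrC !mxE.
  have := hpe K pV; rewrite [X in _ + X]big1 ?addr0 => [|F bF]; last first.
    transitivity (int2 (fdom F) (fun=> 0)); last exact: coordint0.
    congr int2; apply/funext => y; rewrite dotZl.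
    have [c lc] := simplex_face_index conf bl cE bF.
    have [ci|ci] := eqVneq c i; first by rewrite -ci lc !(mul0r, mulr0).
    have [cj|cj] := eqVneq c j; first by rewrite -cj lc !(mul0r, mulr0).
    have /eqP : dot (g c) (v i - v j) = 0.
      by rewrite (bary_grad_edge bl) (negbTE ci) (negbTE cj) subrr.
    by rewrite (simplex_face_gradient conf bl bF lc) => /eqP ->; rewrite !mulr0.
  have -> : (fun x => dot (grad (p K) x) ((l i x * l j x * b x) *: (v i - v j))) =
      fun x => (l i x * l j x) * (b x * b x).
    by apply/funext => z; rewrite dotZr mulrA.
  have pll : polyf (fun x => l i x * l j x) by exact: polyfM.
  have pbb : polyf (fun x => b x * b x) by exact: polyfM.
  move=> /(int3_nonneg_eq0 conf (polyfM pll pbb)) H.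
  have {}H z : l i z * l j z * (b z * b z) = 0.
    apply: H => {}z; rewrite cE (hull_bary bl) => /= lz.
    by apply: mulr_ge0; [exact: mulr_ge0|rewrite -expr2 sqr_ge0].
  have [ll|bb] := polyfM_eq0 pll pbb H; last by have /eqP := bb x; rewrite mulf_eq0 orbb => /eqP.
  have [_ lv _ _] := bl; have [l0|l0] := polyfM_eq0 (pl i) (pl j) ll.
    by have /eqP := l0 (v i); rewrite lv eqxx oner_eq0.
  by have /eqP := l0 (v j); rewrite lv eqxx oner_eq0.
apply: dotvv_eq0; have E := bary_vector bl (grad (p K) x).
rewrite {2}E dotC dot_suml.
have h i : dot (v i) (grad (p K) x) = dot (v 0) (grad (p K) x).
  have [->//|i0] := eqVneq i 0.
  by apply/eqP; rewrite -subr_eq0 -dotBl dotC edge.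
under eq_bigr do rewrite dotZl h.
by rewrite -mulr_suml (bary_sum_grad bl) mul0r.
Qed.

Lemma hom_pressure_trace K F y : on_bd (cell K) F -> p K (chart F y) = m F y.
Proof.
move=> bF; have [v [l [g [bl cE exF]]]] := simplex K.
have [c lc] := simplex_face_index conf bl cE bF.
pose q y := m F y - p K (chart F y).
have pq : Ppoly k.+1 q.
  apply: PpolyB; first exact: (zz F).1.
  exact: Ppoly_le (leqnSn k) (Ppoly_comp (chart_poly F) (pp K)).
have pqf := Ppoly_polyf pq.
have plc i : polyf (fun y => l i (chart F y)).
  by apply: polyf_chart; exact: Ppoly_polyf (bary_Ppoly bl i).
have orth j (b : 'rV[R]_2 -> R) : Ppoly k b -> int2 (fdom F) (fun y => q y * (l j (chart F y) * b y)) = 0.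
  move=> pb; have [jc|jc] := eqVneq j c.
    transitivity (int2 (fdom F) (fun=> 0)); last exact: coordint0.
    by congr int2; apply/funext => z; rewrite jc lc mul0r mulr0.
  pose b3 x := b (- (forig F *m (frame F)^T) + x *m (frame F)^T).
  have pb3 : Ppoly k b3 by apply: Ppoly_comp pb => i; exact: Ppoly_affine.
  have b3E z : b3 (chart F z) = b z.
    by rewrite /b3 addrC -mulmxBl (chartK conf).
  have pV : Pvec k.+1 (fun x => (l j x * b3 x) *: (v j - v c)).
    move=> a; apply: Ppoly_eqf (PpolyZ ((v j - v c) 0 a) (PpolyM (bary_Ppoly bl j) pb3)) => z.
    by rewrite mulrC !mxE.
  have := hpe K pV.
  have -> : int3 (cell K) (fun x => dot (grad (p K) x) ((l j x * b3 x) *: (v j - v c))) = 0.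
    transitivity (int3 (cell K) (fun=> 0)); last exact: coordint0.
    by congr int3; apply/funext => x; rewrite hom_pressure_grad dot0l.
  rewrite add0r (bigD1 F)//= big1 ?addr0 => [|F' /andP[bF' F'F]]; last first.
    transitivity (int2 (fdom F') (fun=> 0)); last exact: coordint0.
    congr int2; apply/funext => z; rewrite dotZl.
    have [c' lc'] := simplex_face_index conf bl cE bF'.
    have [c'j|c'j] := eqVneq c' j; first by rewrite -c'j lc' !(mul0r, mulr0).
    have c'c : c' != c.
      apply: contra F'F => /eqP e; apply/eqP.
      by apply: (simplex_face_unique conf bl cE exF bF' bF _ lc); rewrite -e.
    have /eqP : dot (g c') (v j - v c) = 0.
      by rewrite (bary_grad_edge bl) (negbTE c'j) (negbTE c'c) subrr.
    by rewrite (simplex_face_gradient conf bl bF' lc') => /eqP ->; rewrite !mulr0.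
  set t := dot (v j - v c) (nrm K F).
  have t0 : t != 0.
    rewrite -(simplex_face_gradient conf bl bF lc) (bary_grad_edge bl) eqxx.
    by rewrite (eq_sym c j) (negbTE jc) sub0r oppr_eq0 oner_eq0.
  have -> : (fun y => (m F y - p K (chart F y)) *
      dot ((l j (chart F y) * b3 (chart F y)) *: (v j - v c)) (nrm K F)) =
      fun y => t * (q y * (l j (chart F y) * b y)).
    by apply/funext => z; rewrite dotZl -/t b3E /q; ring.
  rewrite (int2Z conf); last by apply: polyfM => //; apply: polyfM => //; exact: Ppoly_polyf pb.
  by move=> /eqP; rewrite mulf_eq0 (negbTE t0)/= => /eqP.
have [_ _ S1 rec] := bl.
have [h ph hE] := Ppoly_split pq.
pose wv j := (v j - forig F) *m (frame F)^T.
pose H j y := q 0 + \sum_a wv j 0 a * h a y.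
have pH j : Ppoly k (H j).
  apply: PpolyD; first exact: Ppoly_cst.
  by apply: Ppoly_sum => a _; exact: PpolyZ.
have yE (z : 'rV[R]_2) (a : 'I_2) : z 0 a = \sum_j l j (chart F z) * wv j 0 a.
  rewrite -[in LHS](chartK conf F z) [in LHS](rec (chart F z)).
  have -> : forig F = \sum_j l j (chart F z) *: forig F.
    by rewrite -scaler_suml S1 scale1r.
  rewrite -sumrB mulmx_suml summxE; apply: eq_bigr => j _.
  by rewrite -scalerBr -scalemxAl mxE.
have qE z : q z = \sum_j l j (chart F z) * H j z.
  rewrite [in LHS]hE /H; under [RHS]eq_bigr do rewrite mulrDr.
  rewrite big_split/= -mulr_suml S1 mul1r; congr (_ + _).
  under [RHS]eq_bigr do rewrite mulr_sumr.
  rewrite exchange_big; apply: eq_bigr => a _ /=; rewrite yE mulr_suml.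
  by apply: eq_bigr => j _; rewrite mulrA.
suff : q y = 0 by rewrite /q => /eqP; rewrite subr_eq0 => /eqP ->.
have pqq := polyfM pqf pqf.
have qq : int2 (fdom F) (fun z => q z * q z) = 0.
  have -> : (fun z => q z * q z) = fun z => \sum_j q z * (l j (chart F z) * H j z).
    by apply/funext => z; rewrite {2}qE mulr_sumr.
  have mF : measurable (pt2 @^-1` fdom F : set (measurableTypeR R * measurableTypeR R)).
    by have [? _ _ _ _] := polyhedron_props (fdom_polyhedron conf F); exact: closed_pt2_measurable.
  have pi j : polyf (fun z => q z * (l j (chart F z) * H j z)).
    by apply: polyfM => //; apply: polyfM => //; exact: Ppoly_polyf (pH j).
  have [_ E] := coordint_sum (index_enum 'I_4) (P := xpredT) mF
    (fun i _ => face_integ conf F (polyf_continuous (pi i))).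
  apply: (etrans E); apply: big1 => j _; exact: orth.
by have /eqP := int2_pos_eq0 conf pqq (fun z => sqr_ge0 _) qq y; rewrite mulf_eq0 orbb => /eqP.
Qed.

Lemma hom_pressure_s : (forall K x, p K x = 0) /\ (forall F y, m F y = 0).
Proof.
apply: (hom_pressure conf polO hs) => *; first exact: hom_pressure_grad.
exact: hom_pressure_trace.
Qed.

End SimplicialPressure.



Section LinearRelation.
Context {R : realType}.
Implicit Types (a X Y Z : R).

Definition linr a X Y Z := X = a * Y + Z.

Lemma linrD a X Y Z X' Y' Z' : linr a X Y Z -> linr a X' Y' Z' -> linr a (X + X') (Y + Y') (Z + Z').
Proof. by rewrite /linr => -> ->; rewrite mulrDr addrACA. Qed.

Lemma linrN a X Y Z : linr a X Y Z -> linr a (- X) (- Y) (- Z).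
Proof. by rewrite /linr => ->; rewrite mulrN opprD. Qed.

Lemma linrB a X Y Z X' Y' Z' : linr a X Y Z -> linr a X' Y' Z' -> linr a (X - X') (Y - Y') (Z - Z').
Proof. by move=> h h'; apply: linrD => //; exact: linrN. Qed.

Lemma dot_linl a (u v w : 'rV[R]_3) : dot (a *: u + v) w = a * dot u w + dot v w.
Proof. by rewrite dotDl dotZl. Qed.

Lemma dot_linr a (u v w : 'rV[R]_3) : dot w (a *: u + v) = a * dot w u + dot w v.
Proof. by rewrite dotDr dotZr. Qed.

Lemma cross_linl a (u v w : 'rV[R]_3) : cross (a *: u + v) w = a *: cross u w + cross v w.
Proof. by rewrite crossDl crossZl. Qed.

Lemma partial_lin a i (f h : 'rV[R]_3 -> R) x : polyf f -> polyf h ->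
  partial i (fun z => a * f z + h z) x = a * partial i f x + partial i h x.
Proof.
move=> pf ph; apply: (etrans (partialD i _ _)).
- by apply: polyf_diff; exact: polyfZ.
- exact: polyf_diff.
by congr (_ + _); apply: partialZ; exact: polyf_diff.
Qed.

Lemma curl_lin a (u v : 'rV[R]_3 -> 'rV[R]_3) x : polyv u -> polyv v ->
  curl (fun z => a *: u z + v z) x = a *: curl u x + curl v x.
Proof.
move=> pu pv; apply/rowP => i; rewrite !mxE.
have E j : (fun z => (a *: u z + v z) 0 j) = fun z => a * u z 0 j + v z 0 j.
  by apply/funext => z; rewrite !mxE.
rewrite !E (partial_lin a (i + 1) x (pu (i + 2)) (pv (i + 2))).
by rewrite (partial_lin a (i + 2) x (pu (i + 1)) (pv (i + 1))); ring.
Qed.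

Lemma divg_lin a (u v : 'rV[R]_3 -> 'rV[R]_3) x : polyv u -> polyv v ->
  divg (fun z => a *: u z + v z) x = a * divg u x + divg v x.
Proof.
move=> pu pv; rewrite /divg mulr_sumr -big_split; apply: eq_bigr => i _ /=.
have -> : (fun z => (a *: u z + v z) 0 i) = fun z => a * u z 0 i + v z 0 i.
  by apply/funext => z; rewrite !mxE.
exact: (partial_lin a i x (pu i) (pv i)).
Qed.

Lemma grad_lin a (p q : 'rV[R]_3 -> R) x : polyf p -> polyf q ->
  grad (fun z => a * p z + q z) x = a *: grad p x + grad q x.
Proof. by move=> pp pq; apply/rowP => i; rewrite !mxE; exact: partial_lin. Qed.

Lemma curl0 x : curl (fun _ : 'rV[R]_3 => 0) x = 0.
Proof. by apply/rowP => i; rewrite !mxE !partial_cst subrr. Qed.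

End LinearRelation.

Section BilinearForm.
Context {R : realType} {Th : mesh R} {Omega : set 'rV[R]_3}.
Hypothesis conf : conforming_polyhedral Th Omega.
Local Notation cells := 'I_(ncell Th).
Local Notation faces := 'I_(nface Th).
Implicit Types (K : cells) (F : faces) (s t : hdg_unknowns Th).
Variables (k : nat) (taut : R) (taun : faces -> R).

Definition admissible s := [/\ Wh k (w_h s), Vh k (u_h s), Qh k (p_h s), Mth k (uhat s)
  & forall F, Ppoly k.+1 (phat s F)].

Definition lin_unknowns a s s' s'' :=
  [/\ forall K x, w_h s'' K x = a *: w_h s K x + w_h s' K x,
      forall K x, u_h s'' K x = a *: u_h s K x + u_h s' K x,
      forall K x, p_h s'' K x = a * p_h s K x + p_h s' K x,
      forall F y, uhat s'' F y = a *: uhat s F y + uhat s' F y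
    & forall F y, phat s'' F y = a * phat s F y + phat s' F y].

Let un := un_g taun.

Definition hdg_form1 s (r : bvec Th) :=
  ipT (fun K x => dot (w_h s K x) (r K x))
      - ipT (fun K x => dot (u_h s K x) (curl (r K) x))
      + ipdT (fun K F y => dot (cross (uhat s F y) (nrm K F)) (r K (chart F y))).

Definition hdg_form2 s (v : bvec Th) :=
  ipT (fun K x => dot (w_h s K x) (curl (v K) x))
      - ipT (fun K x => p_h s K x * divg (v K) x)
      + ipdT (fun K F y => dot (what k taut s K F y) (cross (v K (chart F y)) (nrm K F)))
      + ipdT (fun K F y => phat s F y * dot (v K (chart F y)) (nrm K F)).

Definition hdg_form3 s (q : bscal Th) :=
  - ipT (fun K x => dot (u_h s K x) (grad (q K) x))
      + ipdT (fun K F y => un s K F y * q K (chart F y)).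

Definition hdg_form4 s (eta : fvec Th) :=
  ipdT (fun K F y => dot (cross (what k taut s K F y) (nrm K F)) (eta F y)).

Definition hdg_form5 s (zeta : fscal Th) := ipdT (fun K F y => un s K F y * zeta F y).

Definition hdg_form s t := hdg_form1 s (w_h t) + hdg_form2 s (u_h t) + hdg_form3 s (p_h t)
  + hdg_form4 s (uhat t) + hdg_form5 s (phat t).

Lemma admissible_poly s : admissible s ->
  [/\ forall K, polyv (w_h s K), forall K, polyv (u_h s K), forall K, polyf (p_h s K),
      forall F, polyv (uhat s F) & forall F, polyf (phat s F)].
Proof.
move=> [h1 h2 h3 h4 h5]; split=> i.
- exact: Pvec_polyv (h1 i).
- exact: Pvec_polyv (h2 i).
- exact: Ppoly_polyf (h3 i).
- exact: MtF_polyv (h4 i).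
- exact: Ppoly_polyf (h5 i).
Qed.

Lemma what_polyv s K F : admissible s -> polyv (what k taut s K F).
Proof.
move=> /admissible_poly[pw pu _ ph _]; apply: polyvD; first exact: (polyv_chart F (pw K)).
apply: polyvZ; first exact: polyf_cst.
apply: (polyv_cross (polyvB _ (ph F)) (polyv_cst (nrm K F))).
exact: MtF_polyv (PM_MtF k F _).
Qed.

Lemma un_polyf s K F : admissible s -> polyf (un s K F).
Proof.
move=> /admissible_poly[_ pu pp _ ph].
apply: polyfD; first exact: (polyf_dot (polyv_chart F (pu K)) (polyv_cst _)).
exact: (polyfZ (taun F) (polyfB (polyf_chart F (pp K)) (ph F))).
Qed.

Lemma what_lin a s s' s'' K F y : admissible s -> admissible s' -> lin_unknowns a s s' s'' ->
  what k taut s'' K F y = a *: what k taut s K F y + what k taut s' K F y.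
Proof.
move=> /admissible_poly[_ pu _ _ _] /admissible_poly[_ pu' _ _ _] [h1 h2 _ h4 _].
rewrite /what h1 h4.
have -> : (fun z => tang (nrm K F) (u_h s'' K (chart F z))) =
    fun z => a *: tang (nrm K F) (u_h s K (chart F z)) + tang (nrm K F) (u_h s' K (chart F z)).
  by apply/funext => z; rewrite h2 tangD tangZ.
rewrite (PM_lin conf); [|by apply: polyv_tang; exact: polyv_chart..].
set A := PM _ _ _ _; set B := PM _ _ _ _.
rewrite (_ : a *: A + B - _ = a *: (A - uhat s F y) + (B - uhat s' F y)); last first.
  by rewrite scalerBr opprD addrACA.
by rewrite cross_linl !scalerDr !scalerA mulrC addrACA.
Qed.

Lemma un_lin a s s' s'' K F y : lin_unknowns a s s' s'' ->
  un s'' K F y = a * un s K F y + un s' K F y.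
Proof. by move=> [_ h2 h3 _ h5]; rewrite /un /un_g h2 h3 h5 dot_linl; ring. Qed.

Lemma hdg_form_linl a s s' s'' t : admissible s -> admissible s' -> admissible t ->
  lin_unknowns a s s' s'' -> hdg_form s'' t = a * hdg_form s t + hdg_form s' t.
Proof.
move=> As As' At lin; have [h1 h2 h3 h4 h5] := lin.
have [pw pu pp puh pph] := admissible_poly As.
have [pw' pu' pp' puh' pph'] := admissible_poly As'.
have [qw qu qp quh qph] := admissible_poly At.
have pn K F : polyv (fun _ : 'rV[R]_2 => nrm K F) by exact: polyv_cst.
have cv F v : polyv v -> polyv (fun y => v (chart F y)) by exact: polyv_chart.
have cf F f : polyf f -> polyf (fun y => f (chart F y)) by exact: polyf_chart.
have pwh K F := what_polyv K F As; have pwh' K F := what_polyv K F As'.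
have pun K F := un_polyf K F As; have pun' K F := un_polyf K F As'.
apply: linrD; [apply: linrD; [apply: linrD; [apply: linrD|]|]|].
- apply: linrD; [apply: linrB|].
  + by apply: (ipT_lin conf) => [K|K|K x]; [exact: polyf_dot|exact: polyf_dot|rewrite h1 dot_linl].
  + by apply: (ipT_lin conf) => [K|K|K x]; [apply: polyf_dot => //; exact: polyv_curl..|rewrite h2 dot_linl].
  + apply: (ipdT_lin conf) => [K F _|K F _|K F y _].
    * by apply: polyf_dot; [exact: polyv_cross|exact: cv].
    * by apply: polyf_dot; [exact: polyv_cross|exact: cv].
    * by rewrite h4 cross_linl dot_linl.
- apply: linrD; [apply: linrD; [apply: linrB|]|].
  + by apply: (ipT_lin conf) => [K|K|K x]; [apply: polyf_dot => //; exact: polyv_curl..|rewrite h1 dot_linl].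
  + apply: (ipT_lin conf) => [K|K|K x]; [apply: polyfM => //; exact: polyf_divg..|].
    by rewrite h3 mulrDl mulrA.
  + apply: (ipdT_lin conf) => [K F _|K F _|K F y _].
    * by apply: polyf_dot => //; apply: polyv_cross => //; exact: cv.
    * by apply: polyf_dot => //; apply: polyv_cross => //; exact: cv.
    * by rewrite (what_lin K F y As As' lin) dot_linl.
  + apply: (ipdT_lin conf) => [K F _|K F _|K F y _].
    * by apply: polyfM => //; apply: polyf_dot => //; exact: cv.
    * by apply: polyfM => //; apply: polyf_dot => //; exact: cv.
    * by rewrite h5 mulrDl mulrA.
- apply: linrD; [apply: linrN|].
  + by apply: (ipT_lin conf) => [K|K|K x]; [apply: polyf_dot => //; exact: polyv_grad..|rewrite h2 dot_linl].
  + apply: (ipdT_lin conf) => [K F _|K F _|K F y _].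
    * by apply: polyfM => //; exact: cf.
    * by apply: polyfM => //; exact: cf.
    * by rewrite (un_lin K F y lin) mulrDl mulrA.
- apply: (ipdT_lin conf) => [K F _|K F _|K F y _].
  + by apply: polyf_dot => //; exact: polyv_cross.
  + by apply: polyf_dot => //; exact: polyv_cross.
  + by rewrite (what_lin K F y As As' lin) cross_linl dot_linl.
- apply: (ipdT_lin conf) => [K F _|K F _|K F y _].
  + exact: polyfM.
  + exact: polyfM.
  + by rewrite (un_lin K F y lin) mulrDl mulrA.
Qed.

Lemma hdg_form_linr a s t t' t'' : admissible s -> admissible t -> admissible t' ->
  lin_unknowns a t t' t'' -> hdg_form s t'' = a * hdg_form s t + hdg_form s t'.
Proof.
move=> As At At' lin; have [h1 h2 h3 h4 h5] := lin.
have [pw pu pp puh pph] := admissible_poly As.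
have [qw qu qp quh qph] := admissible_poly At.
have [qw' qu' qp' quh' qph'] := admissible_poly At'.
have pn K F : polyv (fun _ : 'rV[R]_2 => nrm K F) by exact: polyv_cst.
have cv F v : polyv v -> polyv (fun y => v (chart F y)) by exact: polyv_chart.
have cf F f : polyf f -> polyf (fun y => f (chart F y)) by exact: polyf_chart.
have pwh K F := what_polyv K F As.
have pun K F := un_polyf K F As.
have w'' K : w_h t'' K = fun x => a *: w_h t K x + w_h t' K x by apply/funext.
have u'' K : u_h t'' K = fun x => a *: u_h t K x + u_h t' K x by apply/funext.
have p'' K : p_h t'' K = fun x => a * p_h t K x + p_h t' K x by apply/funext.
apply: linrD; [apply: linrD; [apply: linrD; [apply: linrD|]|]|].
- apply: linrD; [apply: linrB|].
  + by apply: (ipT_lin conf) => [K|K|K x]; [exact: polyf_dot|exact: polyf_dot|rewrite h1 dot_linr].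
  + apply: (ipT_lin conf) => [K|K|K x]; [apply: polyf_dot => //; exact: polyv_curl..|].
    by rewrite w'' curl_lin// dot_linr.
  + apply: (ipdT_lin conf) => [K F _|K F _|K F y _].
    * by apply: polyf_dot; [exact: polyv_cross|exact: cv].
    * by apply: polyf_dot; [exact: polyv_cross|exact: cv].
    * by rewrite h1 dot_linr.
- apply: linrD; [apply: linrD; [apply: linrB|]|].
  + apply: (ipT_lin conf) => [K|K|K x]; [apply: polyf_dot => //; exact: polyv_curl..|].
    by rewrite u'' curl_lin// dot_linr.
  + apply: (ipT_lin conf) => [K|K|K x]; [apply: polyfM => //; exact: polyf_divg..|].
    by rewrite u'' divg_lin// mulrDr mulrCA.
  + apply: (ipdT_lin conf) => [K F _|K F _|K F y _].
    * by apply: polyf_dot => //; apply: polyv_cross => //; exact: cv.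
    * by apply: polyf_dot => //; apply: polyv_cross => //; exact: cv.
    * by rewrite h2 cross_linl dot_linr.
  + apply: (ipdT_lin conf) => [K F _|K F _|K F y _].
    * by apply: polyfM => //; apply: polyf_dot => //; exact: cv.
    * by apply: polyfM => //; apply: polyf_dot => //; exact: cv.
    * by rewrite h2 dot_linl mulrDr mulrCA.
- apply: linrD; [apply: linrN|].
  + apply: (ipT_lin conf) => [K|K|K x]; [apply: polyf_dot => //; exact: polyv_grad..|].
    by rewrite p'' grad_lin// dot_linr.
  + apply: (ipdT_lin conf) => [K F _|K F _|K F y _].
    * by apply: polyfM => //; exact: cf.
    * by apply: polyfM => //; exact: cf.
    * by rewrite h3 mulrDr mulrCA.
- apply: (ipdT_lin conf) => [K F _|K F _|K F y _].
  + by apply: polyf_dot => //; exact: polyv_cross.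
  + by apply: polyf_dot => //; exact: polyv_cross.
  + by rewrite h4 dot_linr.
- apply: (ipdT_lin conf) => [K F _|K F _|K F y _].
  + exact: polyfM.
  + exact: polyfM.
  + by rewrite h5 mulrDr mulrCA.
Qed.

Definition hdg_test t :=
  [/\ Wh k (w_h t), Vh k (u_h t), Qh k (p_h t), Mthg k Omega (fun=> 0) (uhat t)
    & Mh0 k Omega (phat t)].

Lemma hdg_test_admissible t : hdg_test t -> admissible t.
Proof. by move=> [h1 h2 h3 [h4 _] h5]; split=> // F; exact: (h5 F).1. Qed.

Lemma Mthg0P (mu : fvec Th) : Mthg k Omega (fun=> 0) mu <->
  Mth k mu /\ forall F, on_bd Omega F -> mu F = fun=> 0.
Proof.
have P0 F : PM k F (fun y => cross (outward_normal (closure Omega) F) ((fun=> 0) (chart F y))) = fun=> 0.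
  rewrite -[RHS](PM_id conf (MtF0 k F)); congr PM.
  by apply/funext => y; rewrite cross0r.
by split=> -[h1 h2]; split=> // F bF; rewrite (h2 F bF) P0.
Qed.

Let zv : bvec Th := fun _ _ => 0.
Let zs : bscal Th := fun _ _ => 0.
Let zfv : fvec Th := fun _ _ => 0.
Let zfs : fscal Th := fun _ _ => 0.

Lemma hdg_systemP f g s :
  hdg_system k taut un Omega f g s <->
  [/\ Wh k (w_h s), Vh k (u_h s), Qh k (p_h s), Mthg k Omega g (uhat s)
    & Mh0 k Omega (phat s)] /\
  forall t, hdg_test t -> hdg_form s t = ipT (fun K x => dot (f x) (u_h t K x)).
Proof.
have z1 : Wh k zv by move=> K; exact: Pvec0.
have z2 : Vh k zv by move=> K; exact: Pvec0.
have z3 : Qh k zs by move=> K; exact: Ppoly_cst.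
have z4 : Mthg k Omega (fun=> 0) zfv.
  by apply/Mthg0P; split=> // F; exact: MtF0.
have z5 : Mh0 k Omega zfs by move=> F; split=> //; exact: Ppoly_cst.
have e1 : hdg_form1 s zv = 0.
  rewrite /hdg_form1 !ipT_eq0 ?ipdT_eq0 ?subr0 ?addr0//.
  - by move=> K F y _; rewrite dotC dot0l.
  - by move=> K x; rewrite curl0 dotC dot0l.
  - by move=> K x; rewrite dotC dot0l.
have e2 : hdg_form2 s zv = 0.
  rewrite /hdg_form2 !ipT_eq0 ?ipdT_eq0 ?subr0 ?addr0//.
  - by move=> K F y _; rewrite dot0l mulr0.
  - by move=> K F y _; rewrite cross0l dotC dot0l.
  - by move=> K x; rewrite divg_cst mulr0.
  - by move=> K x; rewrite curl0 dotC dot0l.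
have e3 : hdg_form3 s zs = 0.
  rewrite /hdg_form3 ipT_eq0 ?ipdT_eq0 ?oppr0 ?addr0//.
  - by move=> K F y _; rewrite mulr0.
  - by move=> K x; rewrite grad_cst dotC dot0l.
have e4 : hdg_form4 s zfv = 0 by apply: ipdT_eq0 => K F y _; rewrite dotC dot0l.
have e5 : hdg_form5 s zfs = 0 by apply: ipdT_eq0 => K F y _; rewrite mulr0.
have f0 : ipT (fun K x => dot (f x) (zv K x)) = 0 by apply: ipT_eq0 => K x; rewrite dotC dot0l.
split=> [[mem [h1 h2 h3 h4 h5]]|[mem H]].
  split=> // t [t1 t2 t3 t4 t5].
  rewrite /hdg_form [hdg_form1 _ _](h1 _ t1) [hdg_form2 _ _](h2 _ t2) [hdg_form3 _ _](h3 _ t3).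
  by rewrite [hdg_form4 _ _](h4 _ t4) [hdg_form5 _ _](h5 _ t5) add0r !addr0.
split=> //; split=> [r hr|v hv|q hq|eta he|zeta hz].
- have := H (HDGUnknowns r zv zs zfv zfs); rewrite /hdg_form/= e2 e3 e4 e5 f0 !addr0.
  by apply.
- have := H (HDGUnknowns zv v zs zfv zfs); rewrite /hdg_form/= e1 e3 e4 e5 add0r !addr0.
  by apply.
- have := H (HDGUnknowns zv zv q zfv zfs); rewrite /hdg_form/= e1 e2 e4 e5 f0 !add0r !addr0.
  by apply.
- have := H (HDGUnknowns zv zv zs eta zfs); rewrite /hdg_form/= e1 e2 e3 e5 f0 !add0r !addr0.
  by apply.
- have := H (HDGUnknowns zv zv zs zfv zeta); rewrite /hdg_form/= e1 e2 e3 e4 f0 !add0r.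
  by apply.
Qed.

End BilinearForm.
Arguments hdg_test {R Th} Omega k t.



Section DataFunctional.
Context {R : realType} {Th : mesh R} {Omega : set 'rV[R]_3}.
Hypothesis conf : conforming_polyhedral Th Omega.
Hypothesis polO : polyhedral_domain Omega.
Local Notation cells := 'I_(ncell Th).
Local Notation mR := (measurableTypeR R).
Implicit Types (K : cells).
Variable f : 'rV[R]_3 -> 'rV[R]_3.
Hypothesis fL2 : L2vec Omega f.

Lemma data_integ K i (v : 'rV[R]_3 -> R) : continuous v ->
  integ3 (interior (cell K)) (fun x => f x 0 i * v x).
Proof.
move=> cv; have [_ bK _ _ _] := polyhedron_props (cell_polyhedron conf K).
have [[oO _ _ _ _] _] := polO.
set A := interior (cell K).
have mA : measurable (pt3 @^-1` A : set (mR * mR * mR)).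
  by apply: open_pt3_measurable; exact: open_interior.
have mO : measurable (pt3 @^-1` Omega : set (mR * mR * mR)) by exact: open_pt3_measurable.
have AO : pt3 @^-1` A `<=` pt3 @^-1` Omega.
  by move=> t; exact: (interior_cell_sub conf polO).
have bA : bounded_set A.
  have [M [Mr HM]] := bK; exists M; split=> // N MN x /interior_subset; exact: HM.
have [mf fi] := fL2 i.
have mfA : measurable_fun (pt3 @^-1` A : set (mR * mR * mR)) (fun t => f (pt3 t) 0 i).
  exact: measurable_funS mf.
have mvA : measurable_fun (pt3 @^-1` A : set (mR * mR * mR)) (v \o pt3).
  by apply: measurable_funTS; exact: continuous_pt3_measurable.
have [M vM] := continuous_bounded_on bA cv.
have i1 : integ3 A (fun=> 1) by exact: integ3_continuous bA mA (@polyf_continuous R 2 _ (polyf_cst 1)).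
have f2 : integ3 A (fun x => f x 0 i ^+ 2).
  by split=> //; exact: integrableS fi.
have [_ gi] := coordintegrableZ `|M| (coordintegrableD i1 f2).
split=> //; apply: le_integrable gi => //.
  by apply/measurable_EFinP; exact: measurable_funM.
move=> t At; rewrite lee_fin /= normrM.
rewrite [leRHS]ger0_norm; last by rewrite mulr_ge0// addr_ge0// sqr_ge0.
rewrite mulrC ler_pM//; first by rewrite (le_trans (vM _ At))// ler_norm.
set r := f _ _ _; rewrite -[X in 1 + X]real_normK ?num_real//.
have [le1|/ltW ge1] := leP `|r| 1.
  by rewrite (le_trans le1)// lerDl sqr_ge0.
by rewrite ler_wpDl// expr2 ler_peMr.
Qed.

Lemma data_lin a (u v w : bvec Th) : (forall K, polyv (u K)) -> (forall K, polyv (v K)) ->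
  (forall K x, w K x = a *: u K x + v K x) ->
  ipT (fun K x => dot (f x) (w K x)) =
  a * ipT (fun K x => dot (f x) (u K x)) + ipT (fun K x => dot (f x) (v K x)).
Proof.
move=> pu pv wE; rewrite /ipT mulr_sumr -big_split; apply: eq_bigr => K _ /=.
have di (z : bvec Th) : (forall K, polyv (z K)) -> integ3 (interior (cell K)) (fun x => dot (f x) (z K x)).
  move=> pz; have mA : measurable (pt3 @^-1` interior (cell K) : set (mR * mR * mR)).
    by apply: open_pt3_measurable; exact: open_interior.
  by have [] := coordint_sum (index_enum 'I_3) (P := xpredT) mA
    (fun i _ => data_integ K i (polyf_continuous (pz K i))).
rewrite !(int3_interior conf K).
transitivity (int3 (interior (cell K)) (fun x => a * dot (f x) (u K x) + dot (f x) (v K x))).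
  by congr int3; apply/funext => x; rewrite wE dotDr dotZr.
apply: (etrans (coordintD (coordintegrableZ a (di u pu)) (di v pv))).
by congr (_ + _); apply: coordintZ; exact: di.
Qed.

End DataFunctional.

Section WellPosedness.
Context {R : realType} {Th : mesh R} {Omega : set 'rV[R]_3}.
Hypothesis conf : conforming_polyhedral Th Omega.
Hypothesis polO : polyhedral_domain Omega.
Local Notation cells := 'I_(ncell Th).
Local Notation faces := 'I_(nface Th).
Implicit Types (K : cells) (F : faces) (s t : hdg_unknowns Th).
Variables (k : nat) (taut : R) (taun : faces -> R).
Let B := hdg_form k taut taun.

Let X : lmodType R := ((cells -> 'rV[R]_3 -> 'rV[R]_3) * (cells -> 'rV[R]_3 -> 'rV[R]_3)
  * (cells -> 'rV[R]_3 -> R) * (faces -> 'rV[R]_2 -> 'rV[R]_3) * (faces -> 'rV[R]_2 -> R))%type.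

Let mk (x : X) : hdg_unknowns Th := HDGUnknowns x.1.1.1.1 x.1.1.1.2 x.1.1.2 x.1.2 x.2.
Let tup s : X := (w_h s, u_h s, p_h s, uhat s, phat s).

Let mk_tup s : mk (tup s) = s. Proof. by case: s. Qed.
Let tup_mk x : tup (mk x) = x. Proof. by case: x => [[[[]]]]. Qed.

Let mk_lin a x y : lin_unknowns a (mk x) (mk y) (mk (a *: x + y)).
Proof. by case: x => [[[[x1 x2] x3] x4] x5]; case: y => [[[[y1 y2] y3] y4] y5]. Qed.

Let S : set X := [set x | hdg_test Omega k (mk x)].

Lemma hdg_test_lin a s s' s'' : hdg_test Omega k s -> hdg_test Omega k s' ->
  lin_unknowns a s s' s'' -> hdg_test Omega k s''.
Proof.
move=> [h1 h2 h3 /(Mthg0P conf)[h4 h4'] h5] [g1 g2 g3 /(Mthg0P conf)[g4 g4'] g5] [l1 l2 l3 l4 l5].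
split.
- by move=> K; rewrite (funext (l1 K)); exact: Pvec_lin.
- by move=> K; rewrite (funext (l2 K)); exact: Pvec_lin.
- by move=> K; rewrite (funext (l3 K)); apply: PpolyD => //; exact: PpolyZ.
- apply/(Mthg0P conf); split=> [F|F bF]; first by rewrite (funext (l4 F)); exact: MtF_lin.
  by apply/funext => y; rewrite l4 h4'// g4'// scaler0 addr0.
- move=> F; split; first by rewrite (funext (l5 F)); apply: PpolyD; [apply: PpolyZ; exact: (h5 F).1|exact: (g5 F).1].
  by move=> bF y; rewrite l5 (h5 F).2// (g5 F).2// mulr0 addr0.
Qed.

Let S_subspace : subspace S.
Proof.
split; last by move=> a x y Sx Sy; exact: hdg_test_lin (mk_lin a x y).
split=> //.
- by move=> K; exact: Pvec0.
- by move=> K; exact: Pvec0.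
- by move=> K; exact: Ppoly_cst.
- by apply/(Mthg0P conf); split=> // F; exact: MtF0.
- by move=> F; split=> //; exact: Ppoly_cst.
Qed.

Let S_findim : findim S.
Proof.
have fv d : findim [set v : 'rV[R]_d -> 'rV[R]_3 | Pvec k.+1 v] by exact: findim_Pvec.
have f1 := findim_family (I := cells) (fun K => findim_Pvec (R := R) (d := 3) k).
have f2 := findim_family (I := cells) (fun K => findim_Pvec (R := R) (d := 3) k.+1).
have f3 := findim_family (I := cells) (fun K => findim_Ppoly (R := R) (d := 3) k).
have f4 := findim_family (I := faces) (fun F => MtF_findim (Th := Th) k F).
have f5 := findim_family (I := faces) (fun F => findim_Ppoly (R := R) (d := 2) k.+1).
apply: findim_sub (findim_pair (findim_pair (findim_pair (findim_pair f1 f2) f3) f4) f5).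
move=> x [h1 h2 h3 [h4 _] h5]; do !split.
- exact: h1.
- exact: h2.
- exact: h3.
- exact: h4.
- by move=> F; exact: (h5 F).1.
Qed.

Hypothesis hom0 : forall s, hdg_system k taut (un_g taun) Omega (fun=> 0) (fun=> 0) s ->
  [/\ forall K x, w_h s K x = 0, forall K x, u_h s K x = 0, forall K x, p_h s K x = 0,
      forall F y, uhat s F y = 0 & forall F y, phat s F y = 0].

Lemma hdg_form_injective s : hdg_test Omega k s -> (forall t, hdg_test Omega k t -> B s t = 0) ->
  [/\ forall K x, w_h s K x = 0, forall K x, u_h s K x = 0, forall K x, p_h s K x = 0,
      forall F y, uhat s F y = 0 & forall F y, phat s F y = 0].
Proof.
move=> ts H; apply: hom0; apply/(hdg_systemP conf); split=> [|t tt]; first exact: ts.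
by rewrite [LHS]H//; apply/esym; apply: ipT_eq0 => K x; rewrite dot0l.
Qed.

Theorem hdg_well_posed (f g : 'rV[R]_3 -> 'rV[R]_3) : L2vec Omega f ->
  exists! s, hdg_system k taut (un_g taun) Omega f g s.
Proof.
move=> fL2.
have adm s : hdg_test Omega k s -> admissible k s by exact: hdg_test_admissible.
pose PG F := PM k F (fun y => cross (outward_normal (closure Omega) F) (g (chart F y))).
pose G : fvec Th := fun F => if on_bd Omega F then PG F else fun=> 0.
have MG : Mth k G by move=> F; rewrite /G; case: ifP => _; [exact: PM_MtF|exact: MtF0].
pose sG : hdg_unknowns Th := HDGUnknowns (fun _ _ => 0) (fun _ _ => 0) (fun _ _ => 0) G (fun _ _ => 0).
have aG : admissible k sG.
  split=> //= i; [exact: Pvec0|exact: Pvec0|exact: Ppoly_cst|exact: Ppoly_cst].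
pose Lf t := ipT (fun K x => dot (f x) (u_h t K x)).
have [||||x Sx xE] := @bilinear_solve _ _ S (fun x y => B (mk x) (mk y))
    (fun y => Lf (mk y) - B sG (mk y)) S_subspace S_findim.
- move=> a x y z Sx Sy Sz.
  by apply: (hdg_form_linl conf) (mk_lin a x y); exact: adm.
- move=> a x y z Sx Sy Sz.
  by apply: (hdg_form_linr conf) (mk_lin a x y); exact: adm.
- move=> a x y Sx Sy; apply: linrB.
    have [_ px _ _ _] := admissible_poly (adm _ Sx).
    have [_ py _ _ _] := admissible_poly (adm _ Sy).
    by apply: (data_lin conf polO fL2 px py) => K z; have [_ ->] := mk_lin a x y.
  by apply: (hdg_form_linr conf) (mk_lin a x y) => //; exact: adm.
- move=> x Sx H; have [|h1 h2 h3 h4 h5] := hdg_form_injective Sx.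
    by move=> t tt; have := H (tup t); rewrite /S/= mk_tup; apply.
  rewrite -[LHS]tup_mk -[RHS]tup_mk /tup.
  by congr (_, _, _, _, _); do 2 apply/funext => ?.
pose s := HDGUnknowns (w_h (mk x)) (u_h (mk x)) (p_h (mk x))
  (fun F y => uhat (mk x) F y + G F y) (phat (mk x)).
have lin : lin_unknowns 1 (mk x) sG s.
  split=> *; rewrite /= ?scale1r ?mul1r ?addr0//.
have [x1 x2 x3 /(Mthg0P conf)[x4 x4'] x5] := Sx.
have sS : hdg_system k taut (un_g taun) Omega f g s.
  apply/(hdg_systemP conf); split.
    split=> //; split=> [F|F bF].
      have := MtF_lin 1 (x4 F) (MG F); congr MtF; apply/funext => y.
      by rewrite scale1r.
    by apply/funext => y; rewrite /= -[x.1.2 F y]/(uhat (mk x) F y) x4'// add0r /G bF.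
  move=> t tt; have St : S (tup t) by rewrite /S/= mk_tup.
  have := xE _ St; rewrite mk_tup => E.
  rewrite (hdg_form_linl conf taut taun (adm _ Sx) aG (adm _ tt) lin) mul1r.
  by rewrite [hdg_form _ _ _ (mk x) t]E subrK.
exists s; split=> // s' /(hdg_systemP conf)[[m1 m2 m3 m4 m5] H'].
have /(hdg_systemP conf)[[n1 n2 n3 n4 n5] H] := sS.
have as' : admissible k s' by split=> //; [exact: m4.1|move=> F; exact: (m5 F).1].
have as_ : admissible k s by split=> //; [exact: n4.1|move=> F; exact: (n5 F).1].
pose d := mk ((-1) *: tup s' + tup s).
have lind : lin_unknowns (-1) s' s d.
  by have := mk_lin (-1) (tup s') (tup s); rewrite !mk_tup.
have [l1 l2 l3 l4 l5] := lind.
have td : hdg_test Omega k d.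
  split.
  - by move=> K; rewrite (funext (l1 K)); exact: Pvec_lin.
  - by move=> K; rewrite (funext (l2 K)); exact: Pvec_lin.
  - by move=> K; rewrite (funext (l3 K)); apply: PpolyD => //; exact: PpolyZ.
  - apply/(Mthg0P conf); split=> [F|F bF].
      by rewrite (funext (l4 F)); exact: MtF_lin (m4.1 F) (n4.1 F).
    by apply/funext => y; rewrite l4 (m4.2 F bF) (n4.2 F bF) scaleN1r addNr.
  - move=> F; split.
      by rewrite (funext (l5 F)); apply: PpolyD; [apply: PpolyZ; exact: (m5 F).1|exact: (n5 F).1].
    by move=> bF y; rewrite l5 (m5 F).2// (n5 F).2// mulr0 addr0.
have [|z1 z2 z3 z4 z5] := hdg_form_injective td.
  move=> t tt; rewrite /B (hdg_form_linl conf taut taun as' as_ (adm _ tt) lind).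
  by rewrite H// H'// mulN1r addNr.
have fv (u v : 'rV[R]_3) : -1 *: u + v = 0 -> v = u.
  by rewrite scaleN1r addrC => /eqP; rewrite subr_eq0 => /eqP.
have fr (u v : R) : -1 * u + v = 0 -> v = u.
  by rewrite mulN1r addrC => /eqP; rewrite subr_eq0 => /eqP.
rewrite -[LHS]mk_tup -[RHS]mk_tup /tup; congr (mk (_, _, _, _, _));
  apply/funext => i; apply/funext => z.
- by apply: fv; rewrite -l1 z1.
- by apply: fv; rewrite -l2 z2.
- by apply: fr; rewrite -l3 z3.
- by apply: fv; rewrite -l4 z4.
- by apply: fr; rewrite -l5 z5.
Qed.

End WellPosedness.



Section GlobalDivergence.
Context {R : realType} {Th : mesh R} {Omega : set 'rV[R]_3}.
Hypothesis conf : conforming_polyhedral Th Omega.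
Hypothesis polO : polyhedral_domain Omega.
Local Notation cells := 'I_(ncell Th).
Local Notation faces := 'I_(nface Th).
Local Notation mR := (measurableTypeR R).
Implicit Types (K : cells) (F : faces).

Let bO : bounded_set Omega. Proof. by have [[]] := polO. Qed.
Let mO : measurable (pt3 @^-1` Omega : set (mR * mR * mR)).
Proof. by have [[? _ _ _ _] _] := polO; exact: open_pt3_measurable. Qed.

Definition on_cell K (h : 'rV[R]_3 -> R) (x : 'rV[R]_3) : R :=
  if `[< interior (cell K) x >] then h x else 0.

Lemma on_cell_measurable K (h : 'rV[R]_3 -> R) (D : set (mR * mR * mR)) : continuous h ->
  measurable_fun D (on_cell K h \o pt3).
Proof.
move=> ch; apply: measurable_funTS.
have mA : measurable (pt3 @^-1` interior (cell K) : set (mR * mR * mR)).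
  by apply: open_pt3_measurable; exact: open_interior.
have -> : on_cell K h \o pt3 = (h \o pt3) \_ (pt3 @^-1` interior (cell K)).
  apply/funext => t; rewrite /patch /on_cell /=.
  have -> // : (t \in pt3 @^-1` interior (cell K)) = `[< interior (cell K) (pt3 t) >].
  by apply/idP/asboolP; rewrite inE.
have H : measurable_fun (pt3 @^-1` interior (cell K) : set (mR * mR * mR)) (h \o pt3).
  by apply: measurable_funTS; exact: continuous_pt3_measurable.
exact: (measurable_restrictT _ mA).1 H.
Qed.

Lemma on_cell_bounded K (h : 'rV[R]_3 -> R) : continuous h ->
  exists M, forall x, Omega x -> `|on_cell K h x| <= M.
Proof.
move=> ch; have [M hM] := continuous_bounded_on bO ch; exists `|M| => x Ox.
rewrite /on_cell; case: ifP => _; last by rewrite normr0.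
by rewrite (le_trans (hM x Ox))// ler_norm.
Qed.

Lemma on_cell_integ K (h : 'rV[R]_3 -> R) : continuous h -> integ3 Omega (on_cell K h).
Proof.
move=> ch; have [M hM] := on_cell_bounded K ch.
apply: (coordintegrable_bounded (@leb3_bounded R)) hM => //.
exact: on_cell_measurable.
Qed.

Lemma int3_on_cell K (h : 'rV[R]_3 -> R) : int3 Omega (on_cell K h) = int3 (cell K) h.
Proof.
rewrite (int3_interior conf); rewrite /int3 /Rintegral; congr fine.
have mA : measurable (pt3 @^-1` interior (cell K) : set (mR * mR * mR)).
  by apply: open_pt3_measurable; exact: open_interior.
rewrite integral_mkcond [RHS]integral_mkcond; apply: eq_integral => t _.
rewrite /patch /on_cell; have [iK|niK] := asboolP (interior (cell K) (pt3 t)).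
  have Ot : (pt3 @^-1` Omega) t by exact: (interior_cell_sub conf polO iK).
  by rewrite !mem_set.
by rewrite [in RHS]memNset//; case: ifP.
Qed.

Variable u : bvec Th.
Hypothesis pu : forall K, polyv (u K).

Lemma assembleE x i : assemble u x 0 i = \sum_K on_cell K (fun x => u K x 0 i) x.
Proof.
rewrite /assemble summxE; apply: eq_bigr => K _; rewrite /on_cell.
by case: ifP => //; rewrite mxE.
Qed.

Lemma assemble_L2 : L2vec Omega (assemble u).
Proof.
move=> i; have cu K : continuous (fun x => u K x 0 i) := polyf_continuous (pu K i).
have mf : measurable_fun (pt3 @^-1` Omega : set (mR * mR * mR)) ((fun x => assemble u x 0 i) \o pt3).
  rewrite (_ : _ \o _ = fun t => \sum_K (on_cell K (fun x => u K x 0 i) \o pt3) t); last first.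
    by apply/funext => t; rewrite /= assembleE.
  by apply: measurable_sum => K; exact: on_cell_measurable.
split=> //.
have [M hM] : exists M, forall x, Omega x -> `|assemble u x 0 i ^+ 2| <= M.
  have /choice[M hM] K := on_cell_bounded K (cu K).
  exists ((\sum_K M K) ^+ 2) => x Ox; rewrite normrX ler_sqr ?nnegrE//; last first.
    by apply: sumr_ge0 => K _; exact: le_trans (normr_ge0 _) (hM K x Ox).
  rewrite assembleE; apply: (le_trans (ler_norm_sum _ _ _)).
  by apply: ler_sum => K _; exact: hM.
have [|_ //] := coordintegrable_bounded (@leb3_bounded R) bO mO _ hM.
by apply: measurable_funX.
Qed.

Hypothesis du : forall K x, divg (u K) x = 0.
Hypothesis nu : forall K K' F y, ~~ on_bd Omega F -> on_bd (cell K) F -> on_bd (cell K') F ->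
  dot (u K (chart F y)) (face_normal F) = dot (u K' (chart F y)) (face_normal F).

Lemma assemble_weak_div : weak_div Omega (assemble u) (fun=> 0).
Proof.
move=> phi [sm [C cC [CO phi0]]].
have dphi x : differentiable phi x := sm [::] x.
have dpphi i x : differentiable (partial i phi) x := sm [:: delta_mx 0 i] x.
have cphi : continuous phi by move=> x; apply: differentiable_continuous.
have cpphi i : continuous (partial i phi) by move=> x; apply: differentiable_continuous.
transitivity (0 : R); last first.
  apply/esym/eqP; rewrite oppr_eq0; apply/eqP.
  transitivity (int3 Omega (fun=> 0)); last exact: coordint0.
  by congr int3; apply/funext => x; rewrite mul0r.
have cg K : continuous (fun x => dot (u K x) (grad phi x)).
  have E : (fun x => dot (u K x) (grad phi x)) = fun x => \sum_i u K x 0 i * partial i phi x.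
    by apply/funext => x; apply: eq_bigr => i _; rewrite mxE.
  rewrite E => x; apply: differentiable_continuous; apply: differentiable_sumf => i _.
  by apply: differentiableM => //; exact: polyf_diff (pu K i).
transitivity (\sum_K int3 (cell K) (fun x => dot (u K x) (grad phi x))).
  have [_ E] := coordint_sum (index_enum cells) (P := xpredT) mO (fun K _ => on_cell_integ K (cg K)).
  transitivity (int3 Omega (fun x => \sum_K on_cell K (fun x => dot (u K x) (grad phi x)) x)).
    congr int3; apply/funext => x; rewrite /assemble dot_suml; apply: eq_bigr => K _.
    by rewrite /on_cell; case: ifP => //; rewrite dot0l.
  apply: (etrans E); apply: eq_bigr => K _; exact: int3_on_cell.
transitivity (\sum_K \sum_(F | on_bd (cell K) F)
    int2 (fdom F) (fun y => phi (chart F y) * dot (u K (chart F y)) (nrm K F))).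
  apply: eq_bigr => K _.
  have du' i x : differentiable (fun z => u K z 0 i) x := polyf_diff x (pu K i).
  have dpu i x : differentiable (fun z => phi z * u K z 0 i) x by exact: differentiableM.
  have pE i x : partial i (fun z => phi z * u K z 0 i) x =
      partial i phi x * u K x 0 i + phi x * partial i (fun z => u K z 0 i) x.
    exact: partialM.
  have cpu i : continuous (partial i (fun z => phi z * u K z 0 i)).
    rewrite (funext (pE i)) => x; apply: differentiable_continuous.
    apply: differentiableD; apply: differentiableM => //.
    exact: polyf_diff (polyf_partial i (pu K i)).
  transitivity (\sum_i int3 (cell K) (partial i (fun z => phi z * u K z 0 i))).
    have mK : measurable (pt3 @^-1` cell K : set (mR * mR * mR)).
      by apply: closed_pt3_measurable; exact: (closed_cell conf).
    have [_ E] := coordint_sum (index_enum 'I_3) (P := xpredT) mK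
      (fun i _ => cell_integ conf K (cpu i)).
    transitivity (int3 (cell K) (fun x => \sum_i partial i (fun z => phi z * u K z 0 i) x)); last exact: E.
    congr int3; apply/funext => x; under [RHS]eq_bigr do rewrite pE.
    rewrite big_split/= -mulr_sumr -[X in _ * X]/(divg (u K) x) du mulr0 addr0.
    by apply: eq_bigr => i _; rewrite mxE mulrC.
  transitivity (\sum_i \sum_(F | on_bd (cell K) F)
      int2 (fdom F) (fun y => phi (chart F y) * u K (chart F y) 0 i * nrm K F 0 i)).
    by apply: eq_bigr => i _; exact: (divergence_cell conf).
  rewrite exchange_big; apply: eq_bigr => F bF /=.
  have mF : measurable (pt2 @^-1` fdom F : set (mR * mR)).
    by have [? _ _ _ _] := polyhedron_props (fdom_polyhedron conf F); exact: closed_pt2_measurable.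
  have ci i : continuous (fun y => phi (chart F y) * u K (chart F y) 0 i * nrm K F 0 i).
    have c1 : continuous (fun x => nrm K F 0 i * (phi x * u K x 0 i)).
      move=> x; apply: differentiable_continuous.
      exact: differentiableM (differentiable_cst _ _) (dpu i x).
    move=> y; have := @continuous_comp _ _ _ (chart F) _ y (@continuous_chart _ _ F y) (c1 _).
    by congr continuous_at; apply/funext => z /=; rewrite mulrC.
  have [_ E] := coordint_sum (index_enum 'I_3) (P := xpredT) mF
    (fun i _ => face_integ conf F (ci i)).
  transitivity (int2 (fdom F) (fun y =>
      \sum_i phi (chart F y) * u K (chart F y) 0 i * nrm K F 0 i)); first exact: esym E.
  congr int2; apply/funext => y.
  by rewrite /dot mulr_sumr; apply: eq_bigr => i _; rewrite mulrA.
rewrite (exchange_big_dep xpredT)//=; apply: big1 => F _.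
have [bF|nF] := boolP (on_bd Omega F).
  apply: big1 => K bK.
  have H0 y : fdom F y -> phi (chart F y) * dot (u K (chart F y)) (nrm K F) = 0.
    move=> Fy; rewrite phi0 ?mul0r// => /CO Oy.
    have [_ niO] := on_bd_face bF Fy; apply: niO.
    by have [[oO _ _ _ _] _] := polO; rewrite (interior_id _).1.
  transitivity (int2 (fdom F) (fun=> 0)); last exact: coordint0.
  exact: (eq_coordint _ _ H0).
apply: (@sum_interior_face _ _ _ conf polO xpredT F (fun K => int2 (fdom F)
  (fun y => phi (chart F y) * dot (u K (chart F y)) (nrm K F)))) => // K K' b b' KK'.
split=> //.
have cc : continuous (fun y => phi (chart F y) * dot (u K (chart F y)) (nrm K F)).
  have c1 : continuous (fun x => phi x * dot (u K x) (nrm K F)).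
    move=> x; apply: differentiable_continuous; apply: differentiableM => //.
    by apply: polyf_diff; exact: (polyf_dot (pu K) (polyv_cst _)).
  by move=> y; exact: (@continuous_comp _ _ _ (chart F) _ y (@continuous_chart _ _ F y) (c1 _)).
transitivity (int2 (fdom F) (fun y => - (phi (chart F y) * dot (u K (chart F y)) (nrm K F)))).
  congr int2; apply/funext => y.
  rewrite (nrm_opp conf b b' KK') dotNr mulrN; congr (- (_ * _)).
  by have [->|->] := nrmE conf b; rewrite ?dotNr (nu y nF b b').
exact: coordintN (face_integ conf F cc).
Qed.

Lemma assemble_Hdiv : Hdiv Omega (assemble u).
Proof.
split; first exact: assemble_L2.
exists (fun=> 0); last exact: assemble_weak_div.
split; first exact: measurable_cst.
have [||_ //] := coordintegrable_bounded (@leb3_bounded R) bO mO (M := 0) (f := fun=> (0 : R) ^+ 2).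
- exact: measurable_cst.
- by move=> x _; rewrite expr0n normr0.
Qed.

End GlobalDivergence.



Lemma un_sE {R : realType} (Th : mesh R) : @un_s R Th = un_g (fun=> 0).
Proof.
apply/funext => s; apply/funext => K; apply/funext => F; apply/funext => y.
by rewrite /un_s /un_g mul0r addr0.
Qed.

Theorem lemma2p1 (R : realType) (Omega : set 'rV[R]_3)
    (hOmega : polyhedral_domain Omega) (hsc : simply_connected Omega) (k : nat) :
  (forall (Th : mesh R) (sigma taut : R),
     conforming_simplicial Th Omega -> shape_regular Th sigma -> 0 < taut ->
     forall f g : 'rV[R]_3 -> 'rV[R]_3,
       L2vec Omega f -> L2bd Th Omega g -> tangential_bd Th Omega g ->
       (exists! s : hdg_unknowns Th, HDG_s k taut Omega f g s) /\
       (forall s : hdg_unknowns Th, HDG_s k taut Omega f g s ->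
          Hdiv Omega (assemble (u_h s)) /\
          weak_div Omega (assemble (u_h s)) (fun=> 0)))
  /\
  (forall (Th : mesh R) (taut : R) (taun : 'I_(nface Th) -> R),
     conforming_polyhedral Th Omega -> 0 < taut -> (forall F, 0 < taun F) ->
     forall f g : 'rV[R]_3 -> 'rV[R]_3,
       L2vec Omega f -> L2bd Th Omega g -> tangential_bd Th Omega g ->
       exists! s : hdg_unknowns Th, HDG_g k taut taun Omega f g s).
Proof.
split=> [Th _ taut simp _ taut0 f g fL2 _ _|Th taut taun conf taut0 taun0 f g fL2 _ _].
  have conf := simp.1; have taun0 (F : 'I_(nface Th)) : 0 <= (fun=> 0) F :> R by [].
  rewrite /HDG_s un_sE; split=> [|s hs].
    apply: (hdg_well_posed conf hOmega) => // s hs.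
    have [p0 m0] := hom_pressure_s simp hOmega taut0 taun0 hs.
    split=> //.
    - exact: (hom_w conf taut0 taun0 hs).
    - exact: (hom_u conf hOmega taut0 taun0 hs).
    - exact: (hom_uhat conf hOmega taut0 taun0 hs).
  have [[_ uu _ _ _] [_ _ e3 _ e5]] := hs.
  have unE K F y : on_bd (cell K) F ->
      un_g (fun=> 0) s K F y = dot (u_h s K (chart F y)) (nrm K F).
    by rewrite /un_g mul0r addr0.
  have pu K : polyv (u_h s K) := Pvec_polyv (uu K).
  have du := divergence_free conf uu unE e3.
  have nu := normal_continuous conf uu unE e5.
  by split; [exact: assemble_Hdiv|exact: assemble_weak_div].
apply: (hdg_well_posed conf hOmega) => // s hs.
have taun0' F : 0 <= taun F by exact: ltW.
have [p0 m0] := hom_pressure_g conf hOmega taut0 taun0' hs taun0.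
split=> //.
- exact: (hom_w conf taut0 taun0' hs).
- exact: (hom_u conf hOmega taut0 taun0' hs).
- exact: (hom_uhat conf hOmega taut0 taun0' hs).
Qed.
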